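(* Let $\Lambda\subset\mathbb{Z}$ and $I\subset\mathbb{R}$ be (possibly infinite) intervals, and let $\mathcal{L}$ be a random continuous function on $\Lambda\times I$ which is in the class $\mathbf{LC}$. Then for any $j\in\Lambda$ and $t\in I$ the mean of $\mathcal{L}_j(t)$, denoted $\overline{\mathcal{L}}_j(t)$, exists. Let $\hat{\mathcal{L}}_j(t)=\mathcal{L}_j(t)-\overline{\mathcal{L}}_j(t)$. Then the following hold. (i) For all $p\ge1$, $j\in\Lambda$ and $t,s\in I$, $$\mathbb{E}|\hat{\mathcal{L}}_j(t)-\hat{\mathcal{L}}_j(s)|^p\le N_p|t-s|^{p/2},$$ where $N_p=\mathbb{E}|\mathcal N|^p$ for a standard normal $\mathcal N$. (ii) There exist universal constants $C_1,C_2>0$ such that for all $[a,b]\subset I$, $j\in\Lambda$ and $K\ge0$, $$\mathbb{P}\left(\sup_{t,s\in[a,b],\,t\ne s}\frac{|\hat{\mathcal{L}}_j(t)-\hat{\mathcal{L}}_j(s)|}{\sqrt{|t-s|\log(2(b-a)/|t-s|)}}>K\right)\le C_1e^{-C_2K^2}.$$ (iii) For any $p>0$ and $\alpha\in(0,\frac12)$ there exists a constant $C(\alpha,p)>0$ such that for all $[a,b]\subset I$ and $j\in\Lambda$, $$\mathbb{E}\,\|\hat{\mathcal{L}}_j\|^p_{\alpha,[a,b]}\le C(\alpha,p)(b-a)^{p/2-\alpha p}.$$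
   Context: For a continuous function $z$ on $[a,b]$, $\|z\|_{\alpha,[a,b]}=\sup_{t,s\in[a,b],\,t\ne s}\frac{|z(t)-z(s)|}{|t-s|^\alpha}$. For integers $k\le\ell$ and reals $a<b$ put $J=\{k,k+1,\dots,\ell\}$, $R=J\times[a,b]$. $C(R)$ denotes the continuous functions $z:J\times[a,b]\to\mathbb{R}$; write $z_j(t)=z(j,t)$ and $z(t)=(z_k(t),\dots,z_\ell(t))\in\mathbb{R}^J$. $C_0(R)=\{z\in C(R):z(a)=0\}$, $C_{0,0}(R)=\{z\in C(R):z(a)=z(b)=0\}$. Free case: for $\mathsf{s}=(R,x,\eta)$ with $x\in\mathbb{R}^J$, $\eta\in C_0(R)$, $\gamma_{\mathsf{s}}$ is the law on $C(R)$ of $\{B_j(t)+x_j+\eta_j(t)\}_{j\in J,t\in[a,b]}$, $B_j$ independent Brownian motions with diffusion constant 1 and $B_j(a)=0$. $\mathsf{S}^R$ is the set of such triples. Bridge case: for $\breve{\mathsf{s}}=(R,x,y,\breve\eta)$ with $x,y\in\mathbb{R}^J$, $\breve\eta\in C_{0,0}(R)$, $\gamma_{\breve{\mathsf{s}}}$ is the law of $\{\breve B_j(t)+\frac{(b-t)x_j+(t-a)y_j}{b-a}+\breve\eta_j(t)\}$, $\breve B_j$ independent Brownian bridges (diffusion constant 1) on $[a,b]$ vanishing at $a,b$. $\breve{\mathsf{S}}^R$ is the set of such tuples. $\mathsf{H}^R$ is the set of functionals on $C(R)$ of the form $\mathbf{H}(z)=\sum_{i=1}^mf_i(z(t_i))+\int_a^bF(t,z(t))\,dt$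 with $m\in\mathbb{N}_0$, $t_i\in[a,b]$, $f_i:\mathbb{R}^J\to\mathbb{R}$ convex, $F:[a,b]\times\mathbb{R}^J\to\mathbb{R}$ continuous and convex in the second variable for each fixed $t$. The measures $e^{-\mathbf{H}}\gamma_{\mathsf{s}}$, $e^{-\mathbf{H}}\gamma_{\breve{\mathsf{s}}}$ have finite total mass; $\mu_{\mathsf{s},\mathbf{H}}$, $\mu_{\breve{\mathsf{s}},\mathbf{H}}$ are the probability measures proportional to them. Local weak convergence: let $\Lambda_i\subset\mathbb{Z}$, $I_i\subset\mathbb{R}$ be (possibly infinite) intervals and $\mu_i$ Borel probability measures on $C(\Lambda_i\times I_i,\mathbb{R})$, $i\in\mathbb{N}\cup\{\infty\}$. $\mu_i\to\mu_\infty$ locally weakly if $\Lambda_i\times I_i\subset\Lambda_\infty\times I_\infty$ for all $i$, every compact $K\subset\Lambda_\infty\times I_\infty$ is contained in $\Lambda_i\times I_i$ for $i$ large, and the marginal law of $\mu_i$ on $C(K,\mathbb{R})$ converges weakly to that of $\mu_\infty$ for every such $K$. Class $\mathbf{LC}$: let $\mathring{\mathfrak{M}}$ be the collection of all measures $\mu_{\mathsf{s},\mathbf{H}}$ and $\mu_{\breve{\mathsf{s}},\mathbf{H}}$ (over all $R$, $\mathsf{s}\in\mathsf{S}^R$, $\breve{\mathsf{s}}\in\breve{\mathsf{S}}^R$, $\mathbf{H}\in\mathsf{H}^R$), and $\mathfrak{M}$ the collection of locally weak limits of sequences in $\mathring{\mathfrak{M}}$. A random continuous function on $\Lambda\times I$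 is in the class $\mathbf{LC}$ if its law belongs to $\mathfrak{M}$. *)

(* Defs.v *)
From HB Require Import structures.
From mathcomp Require Import all_boot all_order all_algebra.
From mathcomp Require Import all_classical all_reals all_analysis.

Set Implicit Arguments.
Unset Strict Implicit.
Unset Printing Implicit Defensive.

Import Order.TTheory GRing.Theory Num.Theory.
Import numFieldNormedType.Exports.

Local Open Scope classical_set_scope.
Local Open Scope ring_scope.

(* The integers as a discrete space, so that [int * R] carries the product
   topology. *)
HB.instance Definition _ := hasNbhs.Build int principal_filter.
HB.instance Definition _ := Discrete_ofNbhs.Build int erefl.

(* [cspace A] is the space C(A) of continuous real functions on a subset A of
   Z x R, and [cborel A] the same space with its Borel sigma-algebra. *)
Section ContinuousFunctions.
Context {R : realType}.
Implicit Types A K : set (int * R).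

Definition cspace A : Type := continuousType (set_type A) R.

Definition mkC A (f : set_type A -> R) (cf : continuous f) : cspace A := mkcts cf.

HB.instance Definition _ A := Choice.on (cspace A).
HB.instance Definition _ A :=
  isPointed.Build (cspace A) (mkC (@cst_continuous (set_type A) R 0)).

(* The compact-open topology, that is, locally uniform convergence; for A
   compact it is the topology of the supremum norm. *)
HB.instance Definition _ A := Topological.copy (cspace A)
  (initial_topology
    ((fun z : cspace A => z : set_type A -> R) :
      cspace A -> {compact-open, set_type A -> R})).

Definition cborel A := g_sigma_algebraType (@open (cspace A)).

HB.instance Definition _ A := Measurable.on (cborel A).

(* z_j(t), extended by 0 to the points (j, t) outside A. *)
Definition lineval A (z : cspace A) (j : int) (t : R) : R :=
  'valL_0 (z : set_type A -> R) (j, t).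

Lemma restr_continuous A K (z : cspace A) : K `<=` A ->
  continuous (sigL K ('valL_0 (z : set_type A -> R))).
Proof.
move=> KA; apply/subspace_sigL_continuousP.
apply: (continuous_subspaceW KA); apply/subspace_valL_continuousP'.
exact: (@cts_fun _ _ z).
Qed.

(* The restriction C(A) -> C(K) when K is a subset of A; a junk value
   otherwise. *)
Definition restr A K (z : cspace A) : cspace K :=
  if pselect (K `<=` A) is left KA then mkC (@restr_continuous A K z KA) else point.

End ContinuousFunctions.

Section LocalWeakConvergence.
Context {R : realType}.

Definition marginal (A K : set (int * R)) (mu : probability (cborel A) R) :
    set (cborel K) -> \bar R :=
  pushforward mu (restr K : cborel A -> cborel K).
Arguments marginal {A} K mu.

(* nu_ i and nu are set functions, not bundled measures, so as to apply to
   [marginal] without a measurability proof for [restr]. *)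
Definition weak_cvg (K : set (int * R)) (nu_ : (set (cborel K) -> \bar R)^nat)
    (nu : set (cborel K) -> \bar R) : Prop :=
  forall phi : cspace K -> R, continuous phi ->
    (exists M : R, forall z, `|phi z| <= M) ->
    (\int[nu_ i]_z (phi z)%:E)%E @[i --> \oo] --> (\int[nu]_z (phi z)%:E)%E.

Definition local_weak_cvg (A_ : (set (int * R))^nat)
    (mu_ : forall i, probability (cborel (A_ i)) R)
    (A : set (int * R)) (mu : probability (cborel A) R) : Prop :=
  (forall i, A_ i `<=` A) /\
  forall K : set (int * R), compact K -> K `<=` A ->
    (\forall i \near \oo, K `<=` A_ i) /\
    weak_cvg (fun i => marginal K (mu_ i)) (marginal K mu).

End LocalWeakConvergence.

Section Independence.
Context d {T : measurableType d} {R : realType} (P : probability T R).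

(* Mutual independence of the families of events F i, for i in D. *)
Definition independent_families {I : eqType} (D : set I)
    (F : I -> set (set T)) : Prop :=
  forall (s : seq I) (E : I -> set T), uniq s ->
    (forall i, i \in s -> D i /\ F i (E i)) ->
    P (\big[setI/setT]_(i <- s) E i) = (\prod_(i <- s) P (E i))%E.

Definition sigma_generated {I : Type} (D : set I) (X : I -> T -> R) :
    set (set T) :=
  <<s [set S | exists i (B : set R),
         [/\ D i, measurable B & S = X i @^-1` B]] >>.

End Independence.

Section BrownianMotion.
Context d {T : measurableType d} {R : realType} (P : probability T R).

(* Brownian motion on [a, b] with diffusion constant 1, started from 0. The
   second argument of [normal_prob] is the standard deviation. *)
Definition brownian_motion (a b : R) (W : R -> T -> R) : Prop :=
  [/\ forall t, t \in `[a, b] -> measurable_fun setT (W t),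
      forall w, W a w = 0,
      forall w, {within `[a, b], continuous (W ^~ w)},
      (forall s t, a <= s -> s < t -> t <= b ->
        forall B : set R, measurable B ->
        P [set w | B (W t w - W s w)] = normal_prob 0 (Num.sqrt (t - s)) B)
    & forall t : R^nat, {homo t : i j / (i <= j)%N >-> i <= j} ->
        (forall i, t i \in `[a, b]) ->
        independent_families P [set: nat] (fun i =>
          sigma_generated [set tt] (fun _ w => W (t i.+1) w - W (t i) w))].

Definition independent_brownian_motions (n : nat) (a b : R)
    (W : 'I_n -> R -> T -> R) : Prop :=
  (forall i, brownian_motion a b (W i)) /\
  independent_families P [set: 'I_n] (fun i =>
    sigma_generated `[a, b] (W i)).

End BrownianMotion.

(* The rectangle {k, ..., l} x [a, b] with k = [line0] and l = k + [height]. *)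
Record rectangle (R : realType) := Rectangle {
  line0 : int;
  height : nat;
  tleft : R;
  tright : R;
  tleft_lt_tright : tleft < tright }.

Section GibbsMeasures.
Context {R : realType}.
Implicit Types r : rectangle R.

Definition rset r : set (int * R) :=
  `[line0 r, line0 r + (height r)%:Z] `*` `[tleft r, tright r].

(* R^J, where the coordinate i : 'I_(height r).+1 belongs to the line
   [line r i] of J. *)
Definition vecJ r := 'rV[R]_(height r).+1.

Definition line r (i : 'I_(height r).+1) : int := line0 r + (i : nat)%:Z.

Definition slice r (z : cspace (rset r)) (t : R) : vecJ r :=
  \row_i lineval z (line i) t.

Definition C0 r (z : cspace (rset r)) : Prop := slice z (tleft r) = 0.

Definition C00 r (z : cspace (rset r)) : Prop :=
  slice z (tleft r) = 0 /\ slice z (tright r) = 0.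

Definition free_law r (x : vecJ r) (eta : cspace (rset r))
    (gamma : probability (cborel (rset r)) R) : Prop :=
  exists d (T : measurableType d) (P : probability T R)
    (B : 'I_(height r).+1 -> R -> T -> R) (Z : {RV P >-> cborel (rset r)}),
    [/\ independent_brownian_motions P (tleft r) (tright r) B,
        (forall w i t, t \in `[tleft r, tright r] ->
          lineval (Z w) (line i) t = B i t w + x 0 i + lineval eta (line i) t)
      & forall E, measurable E -> gamma E = distribution P Z E].

(* When W is a Brownian motion on [a, b] started from 0, this process is a
   Brownian bridge on [a, b] vanishing at both ends. *)
Definition brownian_bridge (T : Type) (a b : R) (W : R -> T -> R)
    (t : R) (w : T) : R :=
  W t w - (t - a) / (b - a) * W b w.

Definition bridge_law r (x y : vecJ r) (eta : cspace (rset r))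
    (gamma : probability (cborel (rset r)) R) : Prop :=
  let a := tleft r in let b := tright r in
  exists d (T : measurableType d) (P : probability T R)
    (W : 'I_(height r).+1 -> R -> T -> R) (Z : {RV P >-> cborel (rset r)}),
    [/\ independent_brownian_motions P a b W,
        (forall w i t, t \in `[a, b] ->
          lineval (Z w) (line i) t =
            brownian_bridge a b (W i) t w
            + ((b - t) * x 0 i + (t - a) * y 0 i) / (b - a)
            + lineval eta (line i) t)
      & forall E, measurable E -> gamma E = distribution P Z E].

Definition convex_functional r (H : cspace (rset r) -> R) : Prop :=
  exists (m : nat) (t : 'I_m -> R) (f : 'I_m -> vecJ r -> R)
    (F : R -> vecJ r -> R),
    [/\ (forall i, t i \in `[tleft r, tright r]),
        (forall i, convex_function setT (f i)),
        {within `[tleft r, tright r] `*` setT,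
          continuous (fun p : R * vecJ r => F p.1 p.2)},
        (forall s, s \in `[tleft r, tright r] -> convex_function setT (F s))
      & forall z, H z = \sum_(i < m) f i (slice z (t i))
          + \int[lebesgue_measure]_(s in `[tleft r, tright r]) F s (slice z s)].

Definition gibbs_measure r (gamma : probability (cborel (rset r)) R)
    (H : cspace (rset r) -> R) (mu : probability (cborel (rset r)) R) : Prop :=
  exists2 c : R, 0 < c & forall E : set (cborel (rset r)), measurable E ->
    mu E = (c%:E * \int[gamma]_(z in E) (expR (- H z))%:E)%E.

Definition prelimit_LC r (mu : probability (cborel (rset r)) R) : Prop :=
  exists (gamma : probability (cborel (rset r)) R) (H : cspace (rset r) -> R),
    [/\ (exists x eta, C0 eta /\ free_law x eta gamma) \/
        (exists x y eta, C00 eta /\ bridge_law x y eta gamma),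
        convex_functional H
      & gibbs_measure gamma H mu].

Definition limit_LC (A : set (int * R)) (mu : probability (cborel A) R) : Prop :=
  exists (r_ : (rectangle R)^nat)
    (mu_ : forall i, probability (cborel (rset (r_ i))) R),
    (forall i, prelimit_LC (mu_ i)) /\ local_weak_cvg mu_ mu.

Definition class_LC d (T : measurableType d) (P : probability T R)
    (A : set (int * R)) (L : {RV P >-> cborel A}) : Prop :=
  limit_LC (distribution P L).

End GibbsMeasures.

Section Quantities.
Context {R : realType}.

Definition line_mean d (T : measurableType d) (P : probability T R)
    (A : set (int * R)) (L : {RV P >-> cborel A}) (j : int) (t : R) : R :=
  fine ('E_P[fun w => lineval (L w) j t])%E.

Definition centered d (T : measurableType d) (P : probability T R)
    (A : set (int * R)) (L : {RV P >-> cborel A}) (j : int) (t : R) (w : T) : R :=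
  lineval (L w) j t - line_mean L j t.

Definition normal_abs_moment (p : R) : \bar R :=
  (\int[normal_prob (0 : R) 1]_x (`|x| `^ p)%:E)%E.

Definition modulus_ratio (a b : R) (omega : R -> R) (z : R -> R) : \bar R :=
  ereal_sup [set u | exists t s : R,
    [/\ t \in `[a, b], s \in `[a, b], t != s
      & u = (`|z t - z s| / omega `|t - s|)%:E]].

Definition holder_norm (alpha a b : R) (z : R -> R) : \bar R :=
  modulus_ratio a b (fun h => h `^ alpha) z.

Definition levy_modulus (a b h : R) : R :=
  Num.sqrt (h * ln (2 * (b - a) / h)).

End Quantities.

(* Main.v *)
Require Import Defs.
From HB Require Import structures.
From mathcomp Require Import all_boot all_order all_algebra.
From mathcomp Require Import all_classical all_reals all_analysis.
From mathcomp Require Import ring lra zify measurable_realfun.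

Set Implicit Arguments.
Unset Strict Implicit.
Unset Printing Implicit Defensive.

Import Order.TTheory GRing.Theory Num.Theory.
Import numFieldNormedType.Exports.

Local Open Scope classical_set_scope.
Local Open Scope ring_scope.

(* Write kappa = 1/|t - s|. The proof rests on the property that, for the law of the increment
   l = L_j(t) - L_j(s), every Gaussian smoothing x |-> E exp(-(l - x)^2 / 2e^2) is log-concave
   relative to the Gaussian of variance 1/kappa + e^2 (and log-concave, kappa = 0, for the law of
   L_j(t) itself). Being tested on bounded continuous functions, the property passes to locally
   weak limits, so it suffices to prove it for the Gibbs measures. There the integral in H is
   approximated by Riemann sums, which reduces the claim to finitely many independent Brownian
   increments, where it is Prekopa's theorem combined with the Cauchy-Schwarz inequality
   l^2 <= |t - s| * sum of (increment^2 / time step).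
   For kappa = 0 the property forces exponential tails, hence the means exist. For kappa > 0 it
   implies E phi(l - E l) <= E phi(S N) for convex phi >= 0 and S^2 > 1/kappa: the density of the
   smoothed law exceeds the centered Gaussian one on an interval only, and subtracting from phi
   its secant on that interval, which both laws integrate to the same value, leaves an integrand
   of constant sign. The choice phi = |x|^p gives (i), and phi = exp(x^2 / 8|t - s|) gives the
   bound behind the dyadic chaining that yields (ii) and (iii). *)

(** * Prekopa's theorem *)

(** Locally weak limits control neither densities nor unbounded moments, and a limit law need not
    have a density. This is why curvature is read off integrals of the bounded continuous
    [gauss_kernel], why the mean is obtained from the limit property itself, and why the Gaussian
    comparison is run on the limit law and not on the Gibbs measures. Smoothing adds variance [e^2],
    so the exact variance [1/kappa] is out of reach: the gap between [S^2] and [1/kappa] is split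
    between the smoothing and a surplus of convexity that makes the crossing set bounded. Only (i)
    lets the gap tend to 0; for (ii) and (iii) the fixed value [S^2 = 2/kappa] is enough. Since [H]
    need not be bounded below, it is cut at [-N]: this makes the Gaussian integrals finite and lets
    dominated convergence pass from Riemann sums to [H]; the cut is removed afterwards. Continuity
    of the mean in time is not given. It is deduced from (i) with [p = 1], and is needed before
    dyadic points can control a supremum over the centered path. *)

Section Convexity.
Context {R : realType}.

(** Phrased over an arbitrary module because it is used on [R^o], on row vectors and on function
    spaces [I -> R^o]. *)
Definition cvx (E : lmodType R) (f : E -> R) : Prop :=
  forall x y t, 0 < t < 1 ->
    f (t *: x + (1 - t) *: y) <= t * f x + (1 - t) * f y.

(** Convexity between [x] and [x + e] bounds the increment from above, the chord ending at [x - e]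
    bounds it from below. This local Lipschitz estimate gives continuity. *)
Lemma cvx_modulus (f : R^o -> R) (x h : R) : cvx f -> `|h| <= 1 ->
  `|f (x + h) - f x| <= `|h| * (`|f (x + 1) - f x| + `|f (x - 1) - f x|).
Proof.
move=> cf h1.
have key (e k : R) : `|e| = 1 -> 0 < k < 1 ->
    `|f (x + k * e) - f x| <= k * (`|f (x + e) - f x| + `|f (x - e) - f x|).
  move=> e1 /andP[k0 k1].
  have H1 : f (x + k * e) - f x <= k * (f (x + e) - f x).
    have k01 : 0 < k < 1 by rewrite k0.
    have := cf (x + e) x k k01.
    have -> : k *: (x + e : R^o) + (1 - k) *: (x : R^o) = x + k * e.
      by rewrite /GRing.scale /=; ring.
    by move=> H; lra.
  (* Here [x] is the combination of [x + k * e] and [x - e] with weights [1 / (1 + k)] and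
     [k / (1 + k)]. *)
  have H2 : f x - f (x + k * e) <= k * (f (x - e) - f x).
    have p0 : 0 < 1 + k by lra.
    have k01 : 0 < (1 + k)^-1 < 1.
      by rewrite invr_gt0 p0 /= invf_lt1 //; lra.
    have := cf (x + k * e) (x - e) (1 + k)^-1 k01.
    have -> : (1 + k)^-1 *: (x + k * e : R^o) + (1 - (1 + k)^-1) *: (x - e : R^o) = x.
      by rewrite /GRing.scale /=; field; rewrite gt_eqF.
    rewrite -(ler_pM2l p0) => H.
    have E : (1 + k) * ((1 + k)^-1 * f (x + k * e) + (1 - (1 + k)^-1) * f (x - e))
      = f (x + k * e) + k * f (x - e) by field; rewrite gt_eqF.
    by rewrite E in H; lra.
  have A1 : f (x + e) - f x <= `|f (x + e) - f x| := ler_norm _.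
  have A2 : f (x - e) - f x <= `|f (x - e) - f x| := ler_norm _.
  have A3 := normr_ge0 (f (x + e) - f x).
  have A4 := normr_ge0 (f (x - e) - f x).
  by rewrite ler_norml; apply/andP; split; nra.
have [->|h0] := eqVneq h 0; first by rewrite addr0 subrr !normr0 mul0r.
have key' : forall k : R, 0 < k <= 1 -> forall e, `|e| = 1 ->
    `|f (x + k * e) - f x| <= k * (`|f (x + e) - f x| + `|f (x - e) - f x|).
  move=> k /andP[k0]; rewrite le_eqVlt => /predU1P[-> e e1|k1 e e1].
    by rewrite !mul1r lerDl.
  by apply: key => //; rewrite k0.
have hh : 0 < `|h| <= 1 by rewrite normr_gt0 h0.
have [hp|hn] := lerP 0 h.
  have := key' _ hh 1 (normr1 _); rewrite mulr1.
  by rewrite (ger0_norm hp).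
have := key' _ hh (- 1) _; rewrite normrN normr1 => /(_ erefl).
by rewrite mulrN1 (ltr0_norm hn) !opprK [X in _ <= _ * X -> _]addrC.
Qed.

Lemma cvx_continuous (f : R^o -> R) : cvx f -> continuous (f : R -> R).
Proof.
move=> cf x; apply/cvgrPdist_le => /= e e0.
set M := `|f (x + 1) - f x| + `|f (x - 1) - f x|.
have M0 : 0 <= M by rewrite addr_ge0.
near=> y.
have hy : `|y - x| <= 1.
  by rewrite distrC; near: y; apply: cvgr_dist_le => //; exact: cvg_id.
rewrite distrC -[in f y](subrK x y) [y - x + x]addrC.
apply: le_trans (cvx_modulus x cf hy) _.
have : `|y - x| <= e / (M + 1).
  rewrite distrC; near: y; apply: cvgr_dist_le; first exact: cvg_id.
  by rewrite divr_gt0 // ltr_wpDl.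
move=> H; apply: (@le_trans _ _ (e / (M + 1) * M)).
  by rewrite ler_wpM2r.
rewrite mulrAC ler_pdivrMr ?ltr_wpDl // ler_wpM2l ?ltW //.
by rewrite ltrDl.
Unshelve. all: by end_near. Qed.

Notation leb := (@lebesgue_measure R).

Lemma lebesgue_measure_interval_le (X : set R) (v : R) : is_interval X ->
  0 <= v -> (forall p q, X p -> X q -> q - p <= v) -> (leb X <= v%:E)%E.
Proof.
move=> iX v0 h; have [->|/set0P[p0 Xp0]] := eqVneq X set0.
  by rewrite measure0 lee_fin.
have ubX p : X p -> ubound X (v + p) by move=> Xp q Xq; rewrite -lerBlDr h.
have sX : has_sup X by split; [exists p0|exists (v + p0); exact: ubX].
have lbX : lbound X (sup X - v).
  by move=> p Xp; rewrite lerBlDl; apply: ge_sup; [exists p0|exact: ubX].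
have iiX : has_inf X by split; [exists p0|exists (sup X - v)].
have infsup : inf X <= sup X.
  by apply: (@le_trans _ _ p0); [apply: ge_inf; case: iiX|apply: ub_le_sup; case: sX].
apply: (@le_trans _ _ (leb `[inf X, sup X])).
  apply: le_measure; rewrite ?inE //; first exact: is_interval_measurable.
  move=> q Xq /=; rewrite in_itv /=; apply/andP; split.
    by apply: ge_inf => //; case: iiX.
  by apply: ub_le_sup => //; case: sX.
rewrite lebesgue_measure_itv /= lte_fin; case: ifPn => _; rewrite ?lee_fin //.
by rewrite lerBlDr -lerBlDl; apply: lb_le_inf => //; exists p0.
Qed.

Lemma lebesgue_measure_seg_le (X : set R) (p q : R) :
  is_interval X -> X p -> X q -> ((q - p)%:E <= leb X)%E.
Proof.
move=> iX Xp Xq; have [pq|qp] := ltP p q; last first.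
  by apply: (@le_trans _ _ 0%E) => //; rewrite lee_fin subr_le0.
have -> : ((q - p)%:E = leb `[p, q])%E.
  by rewrite lebesgue_measure_itv /= lte_fin pq EFinB.
apply: le_measure => //; rewrite ?inE //; first exact: is_interval_measurable.
by move=> z /=; rewrite in_itv /=; exact: iX.
Qed.

(** Dimension one: two points of [A] and two of [B] give two points of [C] at the combined distance,
    and the length of an interval is the supremum of such distances. Nonemptiness matters, since an
    empty [A] would put no constraint on [C]. *)
Lemma brunn_minkowski_interval (A B C : set R) (t : R) : 0 < t < 1 ->
  is_interval A -> is_interval B -> is_interval C -> A !=set0 -> B !=set0 ->
  (forall x y, A x -> B y -> C (t * x + (1 - t) * y)) ->
  (t%:E * leb A + (1 - t)%:E * leb B <= leb C)%E.
Proof.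
move=> /andP[t0 t1] iA iB iC [a Aa] [b Bb] ABC.
have t1' : 0 < 1 - t by rewrite subr_gt0.
have [->|] := eqVneq (leb C) +oo%E; first by rewrite leey.
rewrite -ltey => Cfin.
have /fineK CE : leb C \is a fin_num by rewrite ge0_fin_numE.
set c := fine (leb C) in CE.
have key p q p' q' : A p -> A q -> B p' -> B q' ->
    t * (q - p) + (1 - t) * (q' - p') <= c.
  move=> Ap Aq Bp Bq; rewrite -lee_fin CE.
  apply: le_trans (lebesgue_measure_seg_le iC (ABC _ _ Ap Bp) (ABC _ _ Aq Bq)).
  by rewrite lee_fin; lra.
(* Suprema are taken one set at a time: over [A] with two points of [B] fixed, then over [B] with
   the length of [A] already in the bound. *)
have lA p' q' : B p' -> B q' ->
    (leb A <= ((c - (1 - t) * (q' - p')) / t)%:E)%E.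
  move=> Bp Bq; apply: lebesgue_measure_interval_le => //.
    by rewrite divr_ge0 ?(ltW t0) //; have := key _ _ _ _ Aa Aa Bp Bq; lra.
  move=> p q Ap Aq; rewrite ler_pdivlMr //.
  by have := key _ _ _ _ Ap Aq Bp Bq; lra.
have /fineK AE : leb A \is a fin_num.
  by rewrite ge0_fin_numE //; apply: le_lt_trans (lA _ _ Bb Bb) _; rewrite ltry.
set al := fine (leb A) in AE.
have lB : (leb B <= ((c - t * al) / (1 - t))%:E)%E.
  have lA' p' q' : B p' -> B q' -> t * al + (1 - t) * (q' - p') <= c.
    move=> Bp Bq; have := lA _ _ Bp Bq.
    by rewrite -AE lee_fin ler_pdivlMr // => ?; lra.
  apply: lebesgue_measure_interval_le => //.
    by rewrite divr_ge0 ?(ltW t1') //; have := lA' _ _ Bb Bb; lra.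
  by move=> p' q' Bp Bq; rewrite ler_pdivlMr //; have := lA' _ _ Bp Bq; lra.
have /fineK BE : leb B \is a fin_num.
  by rewrite ge0_fin_numE //; apply: le_lt_trans lB _; rewrite ltry.
move: lB; rewrite -AE -BE -CE -!EFinM -EFinD !lee_fin ler_pdivlMr // => ?.
by rewrite -/al; lra.
Qed.

(** Tonelli for the part of the subgraph of [F] below height [l]. The cut at [l] is there because
    levels are compared only below 1. *)
Lemma layer_cake (F : R -> R) (l : R) : measurable_fun setT F ->
  (forall x, 0 <= F x) -> 0 < l ->
  (\int[leb]_(s in `]0%R, l[) leb [set x | (s < F x)%R])%E =
  (\int[leb]_x (Num.min l (F x))%:E)%E.
Proof.
move=> mF F0 l0.
pose A := [set p : R * R | 0 < p.2 < l /\ p.2 < F p.1].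
have mA : measurable A.
  have -> : A = (snd @^-1` `]0, l[) `&`
      ((fun p : R * R => F p.1 - p.2) @^-1` `]0, +oo[).
    by apply/seteqP; split=> p; rewrite /A /= !in_itv /= andbT subr_gt0.
  apply: measurableI; rewrite -[X in measurable X]setTI.
    exact: (@measurable_snd _ _ R R) => //.
  apply: (_ : measurable_fun setT (fun p : R * R => F p.1 - p.2)) => //.
  by apply: measurable_funB => //; exact: measurableT_comp.
have := @indic_fubini_tonelli _ _ _ _ R leb leb A mA.
rewrite indic_fubini_tonelli_FE // indic_fubini_tonelli_GE // => E.
rewrite integral_mkcond /=; transitivity (\int[leb]_y (leb \o ysection A) y)%E.
  apply: eq_integral => s _; rewrite patchE /=; case: ifPn.
    rewrite inE /= in_itv /= => s0l; congr (leb _); apply/seteqP; split=> x /=.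
      by move=> sF; rewrite /ysection /= inE.
    by rewrite /ysection /= inE => -[].
  rewrite notin_setE /= in_itv /= => /negP s0l; rewrite (_ : ysection _ _ = set0) ?measure0 //.
  by apply/seteqP; split=> // x; rewrite /ysection /= inE => -[] /=; rewrite (negbTE s0l).
rewrite -E; apply: eq_integral => x _ /=.
rewrite (_ : xsection A x = `]0%R, Num.min l (F x)[%classic); last first.
  apply/seteqP; split=> s; rewrite /xsection /= inE /A /= in_itv /= lt_min.
    by move=> [/andP[-> ->] ->].
  by move=> /and3P[-> -> ->].
rewrite lebesgue_measure_itv /= lte_fin; case: ltP => h; first by rewrite sube0.
apply/esym; congr (_ %:E); apply/eqP; rewrite eq_le h /= le_min (ltW l0).
exact: F0.
Qed.

Lemma integral_pos_gt0 d (T : measurableType d) (mu : {measure set T -> \bar R})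
    (f : T -> \bar R) : measurable_fun setT f -> (forall x, 0 < f x)%E ->
  (0 < mu setT)%E -> (0 < \int[mu]_x f x)%E.
Proof.
move=> mf f0 mu0.
rewrite lt_neqAle integral_ge0 ?andbT; last by move=> x _; exact: ltW.
apply/eqP => /esym f_0.
have /(ae_eq_integral_abs mu measurableT mf) : (\int[mu]_x `|f x| = 0)%E.
  by rewrite -[RHS]f_0; apply: eq_integral => x _; rewrite gee0_abs // ltW.
move=> [N [mN N0 sN]]; suff : (mu setT <= 0)%E by rewrite leNgt mu0.
rewrite -N0; apply: le_measure; rewrite ?inE // => x _; apply: sN => /=.
by move=> /(_ I); have := f0 x => /[swap] ->; rewrite ltxx.
Qed.

Lemma lebesgue_measureT_gt0 : (0 < leb setT)%E.
Proof.
apply: (@lt_le_trans _ _ (leb `[0, 1])).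
  by rewrite lebesgue_measure_itv /= lte_fin ltr01 sube0 lte01.
by apply: le_measure; rewrite ?inE.
Qed.

Lemma cvx_superlevel_interval (f : R^o -> R) (s : R) : cvx f ->
  is_interval [set x : R | s < expR (- f x)].
Proof.
move=> cf x y /= sx sy z /andP[xz zy].
have [->//|nxz] := eqVneq z x; have [->//|nzy] := eqVneq z y.
have {xz}xz : x < z by rewrite lt_neqAle eq_sym nxz.
have {zy}zy : z < y by rewrite lt_neqAle nzy.
set t := (y - z) / (y - x).
have xy : 0 < y - x by lra.
have t01 : 0 < t < 1.
  rewrite /t; apply/andP; split; first by rewrite divr_gt0 // subr_gt0.
  by rewrite ltr_pdivrMr // mul1r; lra.
have := cf x y t t01.
have -> : t *: (x : R^o) + (1 - t) *: (y : R^o) = z.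
  by rewrite /GRing.scale /= /t; field; rewrite gt_eqF.
move=> H; have [fxy|fyx] := leP (f x) (f y).
  apply: lt_le_trans sy _; rewrite ler_expR lerN2; apply: le_trans H _.
  by move: t01 => /andP[? ?]; nra.
apply: lt_le_trans sx _; rewrite ler_expR lerN2; apply: le_trans H _.
by move: t01 => /andP[? ?]; nra.
Qed.

(** With both infima equal to 0, every superlevel set at a level [s < 1] of the two exponentials is
    a nonempty interval, so Brunn-Minkowski applies level by level. The normalization yields the
    arithmetic mean, stronger than the geometric mean of the usual statement. *)
Lemma prekopa_normalized (f g h : R^o -> R) (t : R) : 0 < t < 1 ->
  cvx f -> cvx g -> cvx h ->
  (forall x y, h (t * x + (1 - t) * y) <= t * f x + (1 - t) * g y) ->
  inf (range f) = 0 -> inf (range g) = 0 -> has_lbound (range f) ->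
  has_lbound (range g) ->
  (t%:E * \int[leb]_x (expR (- f x))%:E +
   (1 - t)%:E * \int[leb]_x (expR (- g x))%:E <=
    \int[leb]_x (expR (- h x))%:E)%E.
Proof.
move=> t01 cf cg ch fgh f0 g0 lf lg.
have m (k : R^o -> R) : cvx k -> measurable_fun setT (fun x : R => expR (- k x)).
  move=> ck; apply: measurableT_comp => //; apply: measurableT_comp => //.
  by apply: continuous_measurable_fun; exact: cvx_continuous.
have e0 (k : R^o -> R) x : 0 <= expR (- k x) by exact: expR_ge0.
have E (k : R^o -> R) : cvx k -> inf (range k) = 0 -> has_lbound (range k) ->
  (\int[leb]_x (expR (- k x))%:E =
   \int[leb]_(s in `]0%R, 1%R[) leb [set x | (s < expR (- k x))%R])%E.
  move=> ck k0 lk; rewrite layer_cake //; last exact: m.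
  apply: eq_integral => x _; congr (_ %:E); apply/esym/min_idPr.
  rewrite -expR0 ler_expR lerNl oppr0 -k0; apply: ge_inf => //; exact: imageT.
have mlev (k : R^o -> R) : cvx k -> measurable_fun (`]0%R, 1%R[ : set R)
    (fun s : R => leb [set x | (s < expR (- k x))%R]).
  move=> ck.
  apply: measurable_funTS.
  pose A := [set p : R * R | p.2 < expR (- k p.1)].
  have mA : measurable A.
    have -> : A = ((fun p : R * R => expR (- k p.1) - p.2) @^-1` `]0, +oo[).
      by apply/seteqP; split=> p; rewrite /A /= !in_itv /= andbT subr_gt0.
    rewrite -[X in measurable X]setTI.
    apply: (_ : measurable_fun setT (fun p : R * R => expR (- k p.1) - p.2)) => //.
    apply: measurable_funB => //.
    by apply: (@measurableT_comp _ _ _ _ _ _ (fun x : R => expR (- k x))); first exact: m.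
  have := @measurable_fun_ysection _ _ _ _ R leb A mA.
  apply: eq_measurable_fun => s _ /=; congr (leb _).
  by apply/seteqP; split=> x; rewrite /ysection /= inE.
rewrite (E f) // (E g) //.
(* Levels of [expR (- h x)] above 1 are discarded, which only lowers the right-hand side. *)
apply: (@le_trans _ _ (\int[leb]_(s in `]0%R, 1%R[) leb [set x | (s < expR (- h x))%R])%E); last first.
  rewrite layer_cake //; last exact: m.
  apply: ge0_le_integral => //.
  - by apply/measurable_EFinP; apply: measurable_minr => //; exact: m.
  - by apply/measurable_EFinP; exact: m.
  - by move=> x _; rewrite lee_fin ge_min lexx orbT.
have [t0 t1] := andP t01.
rewrite -!ge0_integralZl //=; [|exact: mlev|by rewrite lee_fin subr_ge0 ltW|exact: mlev|by rewrite lee_fin ltW].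
rewrite -ge0_integralD //; first last.
- by apply: emeasurable_funM => //; exact: mlev.
- by move=> x _; rewrite mule_ge0 // lee_fin subr_ge0 ltW.
- by apply: emeasurable_funM => //; exact: mlev.
- by move=> x _; rewrite mule_ge0 // lee_fin ltW.
apply: ge0_le_integral => //.
- by move=> x _; rewrite adde_ge0 // mule_ge0 // lee_fin ?subr_ge0 ltW.
- by apply: emeasurable_funD; apply: emeasurable_funM => //; exact: mlev.
- exact: mlev.
move=> s /=; rewrite in_itv /= => /andP[s0 s1].
have ne (k : R^o -> R) : inf (range k) = 0 -> has_lbound (range k) ->
    [set x : R | s < expR (- k x)] !=set0.
  move=> k0 lk; have [] := @inf_adherent _ (range k) (- ln s).
  - by rewrite oppr_gt0 ln_lt0 // s0.
  - by split => //; exists (k 0); exact: imageT.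
  move=> _ [x _ <-]; rewrite k0 add0r => kx; exists x => /=.
  by rewrite -[X in X < _]lnK ?posrE // ltr_expR ltrNr.
apply: brunn_minkowski_interval => //; try exact: cvx_superlevel_interval; try exact: ne.
move=> x y /= sx sy; move: sx sy.
rewrite -(lnK (_ : s \is Num.pos)) ?posrE // !ltr_expR => sx sy.
have := fgh x y; nra.
Qed.

Lemma integral_expRN_shift (f : R -> R) (c : R) : measurable_fun setT f ->
  (\int[leb]_x (expR (- (f x - c)))%:E =
   (expR c)%:E * \int[leb]_x (expR (- f x))%:E)%E.
Proof.
move=> mf; rewrite -ge0_integralZl //=.
- by apply: eq_integral => x _; rewrite -EFinM -expRD opprB.
- by apply/measurable_EFinP; do 2 apply: measurableT_comp => //.
Qed.

Lemma cvx_shift (E : lmodType R) (f : E -> R) (c : R) : cvx f ->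
  cvx (fun x => f x - c).
Proof. by move=> cf x y t t01; have := cf x y t t01; lra. Qed.

Lemma ln_concave (a b t : R) : 0 < t < 1 -> 0 < a -> 0 < b ->
  t * ln a + (1 - t) * ln b <= ln (t * a + (1 - t) * b).
Proof.
move=> /andP[t0 t1] a0 b0.
have t1' : 0 < 1 - t by lra.
set m := t * a + (1 - t) * b.
have m0 : 0 < m by rewrite addr_gt0 // mulr_gt0.
have key x : 0 < x -> ln x <= ln m + (x / m - 1).
  move=> x0; rewrite -lerBlDl -ln_div ?posrE // -[X in ln X](subrK 1) addrC.
  by apply: le_ln1Dx; rewrite ltrBrDl subrr divr_gt0.
have := key _ a0; have := key _ b0.
have E : t * (a / m - 1) + (1 - t) * (b / m - 1) = 0.
  by rewrite /m; field; rewrite gt_eqF.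
nra.
Qed.

(** Subtracting the infima [a] and [b] from [f] and [g], and [t * a + (1 - t) * b] from [h], reduces
    to the normalized case; concavity of [ln] then turns the arithmetic mean into the logarithmic
    form. *)
Lemma prekopa_one (f g h : R^o -> R) (t : R) : 0 < t < 1 ->
  cvx f -> cvx g -> cvx h ->
  (forall x y, h (t * x + (1 - t) * y) <= t * f x + (1 - t) * g y) ->
  has_lbound (range f) -> has_lbound (range g) ->
  (\int[leb]_x (expR (- f x))%:E < +oo)%E ->
  (\int[leb]_x (expR (- g x))%:E < +oo)%E ->
  (\int[leb]_x (expR (- h x))%:E < +oo)%E ->
  - ln (fine (\int[leb]_x (expR (- h x))%:E)%E) <=
  t * - ln (fine (\int[leb]_x (expR (- f x))%:E)%E) +
  (1 - t) * - ln (fine (\int[leb]_x (expR (- g x))%:E)%E).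
Proof.
move=> t01 cf cg ch fgh lf lg fy gy hy.
have inf0 (k : R^o -> R) : has_lbound (range k) ->
    inf (range (fun x => k x - inf (range k))) = 0 /\
    has_lbound (range (fun x => k x - inf (range k))).
  move=> lk.
  have lb0 : lbound (range (fun x => k x - inf (range k))) 0.
    by move=> _ [x _ <-]; rewrite subr_ge0; apply: ge_inf => //; exact: imageT.
  split; last by exists 0.
  apply/eqP; rewrite eq_le; apply/andP; split; last first.
    by apply: lb_le_inf => //; exists (k 0 - inf (range k)); exact: imageT.
  apply/ler_addgt0Pl => e e0.
  have [|_ [x _ <-] ke] := @inf_adherent _ (range k) e e0.
    by split => //; exists (k 0); exact: imageT.
  rewrite addr0; apply: (@le_trans _ _ (k x - inf (range k))).
    by apply: ge_inf; [exists 0|exact: imageT].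
  by rewrite lerBlDl ltW.
have [f0 lf'] := inf0 _ lf; have [g0 lg'] := inf0 _ lg.
set a := inf (range f) in f0 lf'; set b := inf (range g) in g0 lg'.
have mm (k : R^o -> R) : cvx k -> measurable_fun setT (k : R -> R).
  by move=> ck; apply: continuous_measurable_fun; exact: cvx_continuous.
have fgh' x y : h (t * x + (1 - t) * y) - (t * a + (1 - t) * b) <=
    t * (f x - a) + (1 - t) * (g y - b) by have := fgh x y; lra.
have := prekopa_normalized t01 (cvx_shift a cf) (cvx_shift b cg)
  (cvx_shift (t * a + (1 - t) * b) ch) fgh' f0 g0 lf' lg'.
rewrite (integral_expRN_shift a (mm _ cf)) (integral_expRN_shift b (mm _ cg)).
rewrite (integral_expRN_shift _ (mm _ ch)).
have pos (k : R^o -> R) : cvx k -> (\int[leb]_x (expR (- k x))%:E < +oo)%E ->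
  exists2 r : R, 0 < r & (\int[leb]_x (expR (- k x))%:E = r%:E)%E.
  move=> ck ky; have I0 : (0 < \int[leb]_x (expR (- k x))%:E)%E.
    apply: integral_pos_gt0; last exact: lebesgue_measureT_gt0.
      by apply/measurable_EFinP; do 2 apply: measurableT_comp => //; exact: mm.
    by move=> x; rewrite lte_fin expR_gt0.
  exists (fine (\int[leb]_x (expR (- k x))%:E)%E).
    by rewrite fine_gt0 // I0.
  by rewrite fineK // ge0_fin_numE // ltW.
have [F F0 ->] := pos _ cf fy; have [G G0 ->] := pos _ cg gy.
have [H H0 ->] := pos _ ch hy; rewrite /= -!EFinM lee_fin => key.
have := ln_concave t01 (mulr_gt0 (expR_gt0 a) F0) (mulr_gt0 (expR_gt0 b) G0).
have t0 : 0 < t by case/andP: t01.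
have t1 : 0 < 1 - t by case/andP: t01 => _; rewrite subr_gt0.
have p0 : 0 < t * (expR a * F) + (1 - t) * (expR b * G).
  by rewrite addr_gt0 // !mulr_gt0 // expR_gt0.
have : ln (t * (expR a * F) + (1 - t) * (expR b * G)) <=
    ln (expR (t * a + (1 - t) * b) * H).
  by rewrite ler_ln ?posrE // mulr_gt0 // expR_gt0.
rewrite !lnM ?posrE ?expR_gt0 // !expRK; lra.
Qed.

Lemma prekopa (E : lmodType R) (W : E -> R -> R) :
  (forall x x' (y y' : R) t, 0 < t < 1 ->
    W (t *: x + (1 - t) *: x') (t * y + (1 - t) * y') <=
    t * W x y + (1 - t) * W x' y') ->
  (forall x, has_lbound (range (W x))) ->
  (forall x, \int[leb]_y (expR (- W x y))%:E < +oo)%E ->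
  cvx (fun x => - ln (fine (\int[leb]_y (expR (- W x y))%:E)%E)).
Proof.
move=> cW lW iW x x' t t01.
have cv z : cvx (W z : R^o -> R).
  move=> y y' u u01; have := cW z z y y' u u01.
  by rewrite -scalerDl addrC subrK scale1r.
by apply: prekopa_one => // y y'; exact: cW.
Qed.

End Convexity.

(** * Integrals without measurability, and change of density *)

Section Density.
Context d (T : measurableType d) (R : realType).
Import HBNNSimple.
Local Open Scope ereal_scope.

(* The integral of a nonnegative function is a supremum over simple functions below it, so no
   measurability is needed. *)
Lemma ge0_le_integral_nonmeas (mu : {measure set T -> \bar R})
    (f g : T -> \bar R) : (forall x, 0 <= f x) -> (forall x, f x <= g x) ->
  \int[mu]_x f x <= \int[mu]_x g x.
Proof.
move=> f0 fg; rewrite !ge0_integralTE //; last first.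
  by move=> x; exact: le_trans (f0 x) (fg x).
apply: le_ereal_sup => _ [h hf <-]; exists h => // x.
exact: le_trans (hf x) (fg x).
Qed.

Lemma integral_cst_probability (P : probability T R) (c : R) :
  \int[P]_x c%:E = c%:E.
Proof. by rewrite integral_cst//= probability_setT mule1. Qed.

(** Scaling maps simple functions below [g] to simple functions below [c * g], which is one
    inequality; applied with [k^-1] it gives the other. *)
Lemma ge0_integralZl_nonmeas (mu : {measure set T -> \bar R})
    (f : T -> \bar R) (k : R) : (0 < k)%R -> (forall x, 0 <= f x) ->
  \int[mu]_x (k%:E * f x) = k%:E * \int[mu]_x f x.
Proof.
have half (c : R) (g : T -> \bar R) : (0 < c)%R -> (forall x, 0 <= g x) ->
    c%:E * \int[mu]_x g x <= \int[mu]_x (c%:E * g x).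
  move=> c0 g0; rewrite -lee_pdivlMl //.
  rewrite [X in X <= _]ge0_integralTE //; apply: ge_ereal_sup => _ [h hg <-].
  rewrite lee_pdivlMl // -sintegralrM ge0_integralTE; last first.
    by move=> x; rewrite mule_ge0 // lee_fin ltW.
  apply: ereal_sup_ubound; exists (scale_nnsfun h (ltW c0)) => //= x.
  by rewrite EFinM lee_pmul2l //= lte_fin.
move=> k0 f0; apply/eqP; rewrite eq_le; apply/andP; split; last exact: half.
rewrite -lee_pdivrMl //.
apply: le_trans (half _ _ _ _) _; first by rewrite invr_gt0.
  by move=> x; rewrite mule_ge0 // lee_fin ltW.
rewrite [leRHS](_ : _ = \int[mu]_x (k^-1%:E * (k%:E * f x))) //.
  by apply: eq_integral => x _; rewrite muleA -EFinM mulVf ?mul1e // gt_eqF.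
Qed.

(** Simple functions first, then monotone convergence. It serves both for the normal density and for
    the Gibbs weight. *)
Lemma integral_density (mu nu : {measure set T -> \bar R}) (p : T -> R)
    (f : T -> \bar R) :
  measurable_fun setT p -> (forall x, 0 <= p x)%R ->
  (forall E, measurable E -> nu E = \int[mu]_(x in E) (p x)%:E) ->
  measurable_fun setT f -> (forall x, 0 <= f x) ->
  \int[nu]_x f x = \int[mu]_x (f x * (p x)%:E).
Proof.
move=> /measurable_EFinP mp p0 nuE mf f0.
pose h := nnsfun_approx measurableT mf.
have key n : \int[nu]_x (h n x)%:E = \int[mu]_x ((h n x)%:E * (p x)%:E).
  under [LHS]eq_integral do rewrite fimfunE -fsumEFin//.
  rewrite [LHS]ge0_integral_fsum//; last 2 first.
  - by move=> r; exact/measurable_EFinP/measurableT_comp.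
  - by move=> r x _; rewrite EFinM nnfun_muleindic_ge0.
  transitivity (\int[mu]_x (\sum_(r \in range (h n))
      (r%:E * (\1_(h n @^-1` [set r]) x)%:E * (p x)%:E))); last first.
    apply: eq_integral => x _; rewrite [in RHS]fimfunE -fsumEFin//.
    rewrite ge0_mule_fsuml => [|r]; last exact: nnfun_muleindic_ge0.
    by apply: eq_fsbigr => r _; rewrite EFinM.
  rewrite [RHS]ge0_integral_fsum//; last 2 first.
  - by move=> r; apply: emeasurable_funM => //; apply: emeasurable_funM => //; exact/measurable_EFinP.
  - by move=> r x _; rewrite mule_ge0 ?nnfun_muleindic_ge0 // lee_fin.
  apply: eq_fsbigr => r _.
  under eq_integral do rewrite EFinM.
  rewrite integralZl_indic_nnsfun //= integral_indic // setIT nuE //.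
  (* A nonempty preimage shows that [r] is a value of [h n], hence nonnegative, as the extraction of
     the factor [r] requires. *)
  have [->|] := eqVneq (h n @^-1` [set r]) set0.
    rewrite integral_set0 mule0; apply/esym/integral0_eq => x _.
    by rewrite indic0 mule0 mul0e.
  move=> /set0P[x /= <-].
  under [RHS]eq_integral do rewrite -muleA.
  rewrite ge0_integralZl //=.
  - congr (_ * _); rewrite integral_mkcond /=; apply: eq_integral => y _.
    by rewrite patchE indicE; case: (_ \in _); rewrite ?mul1e ?mul0e.
  - by apply: emeasurable_funM => //; exact/measurable_EFinP.
  - by move=> y _; rewrite mule_ge0 // lee_fin.
  - by rewrite lee_fin.
transitivity (limn (fun n => \int[nu]_x (h n x)%:E)).
  rewrite -monotone_convergence //.
  - by apply: eq_integral => x _; apply/esym/cvg_lim => //; exact: cvg_nnsfun_approx.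
  - by move=> n; exact/measurable_EFinP.
  - by move=> n x _; rewrite lee_fin.
  - by move=> x _ m n mn; rewrite lee_fin; exact/lefP/nd_nnsfun_approx.
under eq_fun do rewrite key.
rewrite -monotone_convergence //.
- apply: eq_integral => x _; apply/cvg_lim => //.
  by apply: cvgeZr => //; exact: cvg_nnsfun_approx.
- by move=> n; apply: emeasurable_funM => //; exact/measurable_EFinP.
- by move=> n x _; rewrite mule_ge0 // lee_fin.
- move=> x _ m n mn; rewrite lee_wpmul2r ?lee_fin //; exact/lefP/nd_nnsfun_approx.
Qed.

End Density.

(** * Gaussian integrals of log-concave functions *)

Section IteratedGaussianIntegral.
Context {R : realType} {I : eqType}.
Implicit Types (s : seq I) (sg : I -> R).

Lemma integral_normal_prob (sg : R) (f : R -> \bar R) : sg != 0 ->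
  measurable_fun setT f -> (forall x, 0 <= f x)%E ->
  (\int[normal_prob 0 sg]_x f x =
   (normal_peak sg)%:E *
     \int[lebesgue_measure]_x (f x * (expR (- (x ^+ 2 / (2 * sg ^+ 2))))%:E))%E.
Proof.
move=> sg0 mf f0.
have mn : measurable_fun setT (fun x : R => expR (- (x ^+ 2 / (2 * sg ^+ 2)))).
  apply: measurableT_comp => //; apply: measurableT_comp => //.
  by apply: measurable_funM => //; exact: measurable_funX.
rewrite (@integral_density _ _ _ lebesgue_measure _ (normal_pdf 0 sg)) //.
- rewrite -ge0_integralZl //=; first last.
  + by rewrite lee_fin normal_peak_ge0.
  + by move=> x _; rewrite mule_ge0 // lee_fin expR_ge0.
  + by apply: emeasurable_funM => //; exact/measurable_EFinP.
  apply: eq_integral => x _; rewrite normal_pdfE // EFinM.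
  rewrite muleCA; congr (_ * (_ * _))%E; rewrite /normal_fun subr0.
  by rewrite mulr_natl mulNr.
- exact: measurable_normal_pdf.
- by move=> x; exact: normal_pdf_ge0.
Qed.

Definition upd (x : I -> R) (i : I) (y : R) : I -> R^o := fun k => if k == i then y else x k.

(** An iterated integral over the coordinates in [s], the others being frozen at [x]; this shape
    lets Prekopa be applied one variable at a time. *)
Fixpoint gint sg s (f : (I -> R) -> \bar R) (x : I -> R) : \bar R :=
  if s is i :: s' then (\int[normal_prob 0 (sg i)]_y gint sg s' f (upd x i y))%E
  else f x.

Lemma gint_ge0 sg s f x : (forall x, 0 <= f x)%E -> (0 <= gint sg s f x)%E.
Proof. by move=> f0; elim: s x => //= i s IH x; exact: integral_ge0. Qed.

Lemma eq_gint sg s f g x : f =1 g -> gint sg s f x = gint sg s g x.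
Proof. by move=> fg; elim: s x => //= i s IH x; apply: eq_integral => y _. Qed.

Lemma gint_le_cst sg s f x (c : R) : (forall x, 0 <= f x)%E ->
  (forall y, (forall i, i \notin s -> y i = x i) -> f y <= c%:E)%E ->
  (gint sg s f x <= c%:E)%E.
Proof.
move=> f0; elim: s x => [|i s IH] x fc /=; first exact: fc.
apply: (@le_trans _ _ (\int[normal_prob 0 (sg i)]_y c%:E)%E).
  apply: ge0_le_integral_nonmeas => y; first exact: gint_ge0.
  apply: IH => z zs; apply: fc => j; rewrite inE negb_or => /andP[ji js].
  by rewrite zs // /upd (negbTE ji).
by rewrite integral_cst_probability.
Qed.

Lemma gint_scale sg s (c : (I -> R) -> R) f x : (forall x, 0 < c x) ->
  (forall x i y, i \in s -> c (upd x i y) = c x) -> (forall x, 0 <= f x)%E ->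
  gint sg s (fun x => (c x)%:E * f x)%E x = ((c x)%:E * gint sg s f x)%E.
Proof.
move=> c0 + f0; elim: s x => [//|i s IH] x cs /=.
rewrite -ge0_integralZl_nonmeas //=; last by move=> y; exact: gint_ge0.
apply: eq_integral => y _; rewrite IH ?cs ?mem_head //.
by move=> z j u js; apply: cs; rewrite inE js orbT.
Qed.

Lemma upd_comb (x x' : I -> R) i (y y' t : R) :
  upd (t *: (x : I -> R^o) + (1 - t) *: (x' : I -> R^o)) i (t * y + (1 - t) * y') =
  t *: upd x i y + (1 - t) *: upd x' i y'.
Proof. by apply/funext => k; rewrite /upd !fctE; case: ifP. Qed.

Lemma cvx_upd (U : (I -> R^o) -> R) (x : I -> R) i : cvx U ->
  cvx (fun y : R^o => U (upd x i y)).
Proof.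
move=> cU y y' t t01; have := cU (upd x i y) (upd x i y') t t01.
by rewrite -upd_comb -scalerDl addrC subrK scale1r.
Qed.

(** Only [V] plus the Gaussian exponents has to be convex: each integration uses up the exponent of
    its own coordinate. The lower bounds on the fibres make all integrals finite. *)
Lemma cvx_gint sg s (V : (I -> R^o) -> R) : uniq s ->
  (forall i, i \in s -> 0 < sg i) ->
  cvx (fun x => V x + \sum_(i <- s) x i ^+ 2 / (2 * sg i ^+ 2)) ->
  (forall x, exists m, forall y, (forall i, i \notin s -> y i = x i) -> m <= V y) ->
  exists2 U : (I -> R^o) -> R, cvx U &
    forall x, gint sg s (fun x => (expR (- V x))%:E) x = (expR (- U x))%:E.
Proof.
elim: s V => [|i s IH] V /=.
  by move=> _ _ cV _; exists V => // x y t t01; have := cV x y t t01; rewrite !big_nil !addr0.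
move=> /andP[nis us] s0 cV lV.
have sgi : 0 < sg i by rewrite s0 // mem_head.
(* The exponent of coordinate [i] is moved into the potential so that the hypothesis has the right
   form for the tail [s]. *)
pose V' x := V x + x i ^+ 2 / (2 * sg i ^+ 2).
have VV' x : V x <= V' x.
  by rewrite lerDl divr_ge0 ?sqr_ge0 // mulr_ge0 // sqr_ge0.
have sub_fib x y : (forall j, j \notin s -> y j = x j) ->
    forall j, j \notin i :: s -> y j = x j.
  by move=> xy j; rewrite inE negb_or => /andP[_ /xy].
have [|||U' cU' U'E] := IH V' us.
- by move=> j js; rewrite s0 // inE js orbT.
- move=> x y t t01; have := cV x y t t01; rewrite !big_cons /V' !addrA.
  by [].
- move=> x; have [m mV] := lV x; exists m => y yx.
  by apply: le_trans (VV' _); apply: mV; exact: sub_fib.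
(* Coordinate [i] is frozen during the tail integration, so the borrowed exponent factors out; it
   will cancel against the normal density, leaving a Lebesgue integral of [expR (- U')]. *)
have EV x : gint sg s (fun x => (expR (- V x))%:E) x =
    ((expR (x i ^+ 2 / (2 * sg i ^+ 2)))%:E * (expR (- U' x))%:E)%E.
  rewrite -U'E -(@gint_scale sg s (fun x => expR (x i ^+ 2 / (2 * sg i ^+ 2)))).
  - apply: eq_gint => z; rewrite -EFinM -expRD /V' opprD addrCA subrr addr0 //.
  - by move=> z; exact: expR_gt0.
  - move=> z j y js; rewrite /upd; case: eqP => // ij.
    by move: nis; rewrite ij js.
  - by move=> z; rewrite lee_fin expR_ge0.
have mU x : measurable_fun setT (fun y : R => U' (upd x i y)).
  by apply: continuous_measurable_fun; apply: cvx_continuous; exact: cvx_upd.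
have EG x : gint sg (i :: s) (fun x => (expR (- V x))%:E) x =
    ((normal_peak (sg i))%:E *
      \int[lebesgue_measure]_y (expR (- U' (upd x i y)))%:E)%E.
  rewrite /=; under eq_integral do rewrite EV.
  rewrite integral_normal_prob ?gt_eqF //.
  - congr (_ * _)%E; apply: eq_integral => y _.
    rewrite muleAC -!EFinM -!expRD; congr (expR _)%:E.
    by rewrite /upd eqxx subrr add0r.
  - apply: emeasurable_funM; apply/measurable_EFinP.
      apply: measurableT_comp => //; rewrite /upd eqxx.
      by apply: measurable_funM => //; exact: measurable_funX.
    by apply: measurableT_comp => //; apply: measurableT_comp => //.
have lU' x m : (forall y, (forall j, j \notin i :: s -> y j = x j) -> m <= V y) ->
    forall y, m <= U' (upd x i y).
  move=> mV y; rewrite -lerN2 -ler_expR -lee_fin -U'E.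
  apply: gint_le_cst => [z|z zs]; first by rewrite lee_fin expR_ge0.
  rewrite lee_fin ler_expR lerN2; apply: le_trans (VV' _); apply: mV => j js.
  have := js; rewrite inE negb_or => /andP[ji jns].
  by rewrite zs // /upd (negbTE ji).
have pk0 : 0 < normal_peak (sg i) by rewrite normal_peak_gt0 // gt_eqF.
(* Up to the peak, this Lebesgue integral is the Gaussian integral of [expR (- V)], which is at most
   [expR (- m)]. *)
have fin x : (\int[lebesgue_measure]_y (expR (- U' (upd x i y)))%:E < +oo)%E.
  have [m mV] := lV x.
  rewrite -(@lte_pmul2l _ (normal_peak (sg i))%:E) ?lte_fin // -EG mulry gtr0_sg //.
  rewrite mul1e; apply: le_lt_trans (ltry (expR (- m))).
  apply: gint_le_cst => [z|z zs]; first by rewrite lee_fin expR_ge0.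
  by rewrite lee_fin ler_expR lerN2; exact: mV.
exists (fun x => - ln (fine (\int[lebesgue_measure]_y
    (expR (- U' (upd x i y)))%:E)%E) - ln (normal_peak (sg i))).
  apply: cvx_shift; apply: (prekopa (W := fun x y => U' (upd x i y))) => //.
  - by move=> x x' y y' t t01; rewrite upd_comb; exact: cU'.
  - move=> x; have [m mV] := lV x; exists m => _ [y _ <-].
    exact: lU'.
move=> x; have /= -> := EG x; rewrite -opprD opprK expRD !lnK ?posrE //.
- by rewrite mulrC EFinM fineK // ge0_fin_numE // integral_ge0 // => y _; rewrite lee_fin expR_ge0.
- rewrite fine_gt0 // fin andbT; apply: integral_pos_gt0; last exact: lebesgue_measureT_gt0.
    by apply/measurable_EFinP; do 2 apply: measurableT_comp => //; exact: mU.
  by move=> y; rewrite lte_fin expR_gt0.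
Qed.

End IteratedGaussianIntegral.

(** * Independence and expectations of functions of Gaussian variables *)

Section Freezing.
Context {R : realType} d (T : measurableType d).

(** Rounding [Y] down to multiples of [1 / (n + 1)] leaves countably many values, where
    measurability in [w] is enough; continuity in [y] passes to the limit. *)
Lemma measurable_fun_caratheodory (g : R -> T -> R) (Y : T -> R) :
  (forall w, continuous (g ^~ w)) -> (forall y, measurable_fun setT (g y)) ->
  measurable_fun setT Y -> measurable_fun setT (fun w => g (Y w) w).
Proof.
move=> cg mg mY.
pose a (n : nat) (w : T) : R := (Num.floor (Y w * n.+1%:R))%:~R / n.+1%:R.
have a_cvg w : a ^~ w @ \oo --> Y w.
  apply/cvgrPdist_le => /= e e0.
  near=> n.
  have n0 : 0 < n.+1%:R :> R by [].
  have /andP[f1 f2] := floor_itv (Y w * n.+1%:R).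
  rewrite intrD in f2.
  have {}f1 : a n w <= Y w by rewrite ler_pdivrMr.
  have {}f2 : Y w - a n w <= n.+1%:R^-1.
    rewrite lerBlDr -[X in _ <= X + _]mul1r -mulrDl ler_pdivlMr // addrC.
    exact: ltW.
  rewrite ger0_norm ?subr_ge0 //; apply: le_trans f2 _.
  by apply: ltW; near: n; exact: (near_infty_natSinv_lt (PosNum e0)).
apply: (@measurable_fun_cvg _ _ _ _ (fun n w => g (a n w) w)) => [n|w _]; last first.
  exact: (@continuous_cvg _ _ _ _ _ (fun n => a n w) (g ^~ w) _ (cg w _) (a_cvg w)).
move=> _ B mB; rewrite setTI.
have -> : (fun w => g (a n w) w) @^-1` B = \bigcup_(k : int)
    ([set w | Num.floor (Y w * n.+1%:R) = k] `&`
     (g (k%:~R / n.+1%:R) @^-1` B)).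
  apply/seteqP; split=> w /=; last by move=> [k _ [/= <-]].
  by move=> gB; exists (Num.floor (Y w * n.+1%:R)).
apply: countable_bigcupT_measurable => // k; apply: measurableI; last first.
  by rewrite -[X in measurable X]setTI; exact: mg.
have -> : [set w | Num.floor (Y w * n.+1%:R) = k] =
    (fun w => Y w * n.+1%:R) @^-1` `[k%:~R, (k + 1)%:~R[%classic.
  apply/seteqP; split=> w /=; rewrite in_itv /=.
    by move=> <-; exact: floor_itv.
  exact: floor_def.
rewrite -[X in measurable X]setTI.
by apply: (_ : measurable_fun setT (fun w => Y w * n.+1%:R)) => //; exact: measurable_funM.
Unshelve. all: by end_near. Qed.

(** Factorization on rectangles identifies the law of the pair with a product measure, and Tonelli
    then integrates over [w] with [x] frozen. *)
Lemma integral_independent (P : probability T R) d1 d2 (T1 : measurableType d1)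
    (T2 : measurableType d2) (X : T -> T1) (Y : T -> T2) (m1 : probability T1 R)
    (f : T1 * T2 -> \bar R) :
  measurable_fun setT X -> measurable_fun setT Y ->
  (forall A B, measurable A -> measurable B ->
    P (X @^-1` A `&` Y @^-1` B) = m1 A * P (Y @^-1` B))%E ->
  measurable_fun setT f -> (forall x, 0 <= f x)%E ->
  (\int[P]_w f (X w, Y w) = \int[m1]_x \int[P]_w f (x, Y w))%E.
Proof.
move=> mX mY ind mf f0.
pose Y' : {mfun T >-> T2} := mfun_Sub (mem_set mY).
have mXY : measurable_fun setT (fun w => (X w, Y w)) by exact/measurable_fun_pairP.
pose XY : {mfun T >-> (T1 * T2)%type} := mfun_Sub (mem_set mXY).
pose m2 := distribution P Y'.
have E : forall D, measurable D -> (m1 \x m2)%E D = distribution P XY D.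
  by apply: product_measure_unique => A B mA mB; rewrite -ind.
transitivity (\int[distribution P XY]_z f z)%E.
  by rewrite ge0_integral_distribution.
rewrite (eq_measure_integral (m1 \x m2)%E); last first.
  by move=> D mD _; apply/esym; exact: E.
rewrite fubini_tonelli1 //; apply: eq_integral => x _.
rewrite /fubini_F ge0_integral_distribution //.
exact: measurable_fun_pair2.
Qed.

Section GaussianLaw.
Context {I : eqType}.
Implicit Types (s : seq I) (sg : I -> R) (X : I -> T -> R).

Definition join X s (x : I -> R) (w : T) : I -> R^o :=
  fun i => if i \in s then X i w else x i.

Lemma join_cons X i s x w : i \notin s ->
  join X (i :: s) x w = join X s (upd x i (X i w)) w.
Proof.
move=> nis; apply/funext => k; rewrite /join /upd inE.
by case: eqVneq => // ->; rewrite (negbTE nis).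
Qed.

Lemma join_upd X i s x w y : i \notin s ->
  join X s (upd x i y) w = upd (join X s x w) i y.
Proof.
move=> nis; apply/funext => k; rewrite /join /upd.
by case: (eqVneq k i) => // ->; rewrite (negbTE nis).
Qed.

Definition gaussian_product (P : probability T R) X sg s : Prop :=
  forall B : I -> set R, (forall i, measurable (B i)) ->
    P (\big[setI/setT]_(i <- s) (X i @^-1` B i)) =
    (\prod_(i <- s) normal_prob 0 (sg i) (B i))%E.
End GaussianLaw.

End Freezing.

(** Separate continuity in each coordinate suffices, because the random coordinates are inserted one
    after the other. *)
Lemma measurable_join {R : realType} {I : eqType} d (T : measurableType d)
    (X : I -> T -> R) (s : seq I) (Y : T -> I -> R) (f : (I -> R) -> R) :
  uniq s -> (forall i, i \in s -> measurable_fun setT (X i)) ->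
  (forall x i, continuous (fun y : R => f (upd x i y))) ->
  (forall x, measurable_fun setT (fun w => f (join X s x w))) .
Proof.
move=> + + cf; elim: s => [|i s IH] /= us mX x.
  by apply: eq_measurable_fun (measurable_cst (f x)) => w _ /=.
case/andP: us => nis us.
under eq_fun do rewrite join_cons //.
apply: (@measurable_fun_caratheodory _ _ _ (fun y w => f (join X s (upd x i y) w))).
- by move=> w; under eq_fun do rewrite join_upd //; exact: cf.
- by move=> y; apply: IH => // j js; apply: mX; rewrite inE js orbT.
- by apply: mX; rewrite mem_head.
Qed.

(** Induction on [s]: the head variable is independent of everything determined by the tail, so it
    can be integrated out first. *)
Lemma integral_gaussian_product {R : realType} {I : eqType} d
    (T : measurableType d) (P : probability T R)
    (X : I -> T -> R) (sg : I -> R) (s : seq I) (f : (I -> R) -> R) x :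
  uniq s -> (forall i, i \in s -> measurable_fun setT (X i)) ->
  gaussian_product P X sg s ->
  (forall x i, continuous (fun y : R => f (upd x i y))) ->
  (forall x, 0 <= f x) ->
  (\int[P]_w (f (join X s x w))%:E = gint sg s (fun x => (f x)%:E) x)%E.
Proof.
move=> + + + cf f0; elim: s x => [|i s IH] x /= us mX gP.
  by rewrite -[RHS](integral_cst_probability P); apply: eq_integral => w _.
case/andP: us => nis us.
have mXs j : j \in s -> measurable_fun setT (X j).
  by move=> js; apply: mX; rewrite inE js orbT.
have mXi : measurable_fun setT (X i) by apply: mX; rewrite mem_head.
have gPs : gaussian_product P X sg s.
  move=> B mB; pose B' j := if j == i then setT else B j.
  have BB' (S : Type) (op : S -> S -> S) e (F : I -> set R -> S) :
      \big[op/e]_(j <- s) F j (B' j) = \big[op/e]_(j <- s) F j (B j).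
    apply: eq_big_seq => j js; rewrite /B'; case: eqP => // ji.
    by rewrite -ji js in nis.
  have := gP B'; rewrite !big_cons /B' eqxx preimage_setT setTI probability_setT mul1e -/B'.
  rewrite (BB' _ _ _ (fun j b => X j @^-1` b)) => -> .
    by rewrite (BB' _ _ _ (fun j b => normal_prob 0 (sg j) b)).
  by move=> j; case: eqP.
pose G : set (set T) := [set A | exists B : I -> set R,
  (forall j, measurable (B j)) /\ A = \big[setI/setT]_(j <- s) (X j @^-1` B j)].
have mG : G `<=` measurable.
  move=> _ [B [mB ->]]; elim: (s) mXs => [|j r IHr] mXr; first by rewrite big_nil.
  rewrite big_cons; apply: measurableI.
    by rewrite -[X in measurable X]setTI; apply: mXr => //; rewrite mem_head.
  by apply: IHr => k kr; apply: mXr; rewrite inE kr orbT.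
have boxE j (B : set R) : j \in s -> measurable B -> G (X j @^-1` B).
  move=> js mB; exists (fun k => if k == j then B else setT); split.
    by move=> k; case: eqP.
  rewrite (bigD1_seq j) //= eqxx big1 ?setIT // => k kj.
  by rewrite (negbTE kj) preimage_setT.
have GT : G setT.
  exists (fun=> setT); split => //.
  by rewrite big1 // => j _; rewrite preimage_setT.
have GI : setI_closed G.
  move=> _ _ [B [mB ->]] [B' [mB' ->]].
  exists (fun j => B j `&` B' j); split; first by move=> j; exact: measurableI.
  by rewrite -big_split; apply: eq_bigr => j _; rewrite preimage_setI.
(* [T'] is [T] with the sigma-algebra generated by the tail variables; the identity into [T'] plays
   the second variable of [integral_independent]. *)
pose T' := g_sigma_algebraType G.
have mid : measurable_fun setT (idfun : T -> T').
  move=> _ B mB; rewrite setTI preimage_id.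
  by move: B mB; apply: smallest_sub => //; exact: sigma_algebra_measurable.
have ind A B : measurable A -> measurable (B : set T') ->
    P (X i @^-1` A `&` (idfun : T -> T') @^-1` B) =
    (normal_prob 0 (sg i) A * P ((idfun : T -> T') @^-1` B))%E.
  move=> mA mB; rewrite preimage_id.
  have mXA : measurable (X i @^-1` A) by rewrite -[X in measurable X]setTI; exact: mXi.
  have pA : normal_prob 0 (sg i) A \is a fin_num by exact: fin_num_measure.
  have pA0 : 0 <= fine (normal_prob 0 (sg i) A) by exact: fine_ge0.
  (* Two finite measures that agree on the boxes, a family stable under intersection, hence on the
     sigma-algebra generated by it. *)
  pose m1 := mrestr P mXA; pose m2 := mscale (NngNum pA0) P.
  have : m1 B = m2 B.
    apply: (@g_sigma_algebra_measure_unique _ _ _ G mG (fun=> setT)) => //.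
    - by rewrite bigcup_const.
    - move=> _ [C [mC ->]]; apply: (_ : m1 _ = m2 _); rewrite /m1 /m2 /mrestr /mscale /= fineK //.
      rewrite gPs // setIC; pose C' j := if j == i then A else C j.
      have CC' (S : Type) (op : S -> S -> S) e (F : I -> set R -> S) :
          \big[op/e]_(j <- s) F j (C j) = \big[op/e]_(j <- s) F j (C' j).
        apply: eq_big_seq => j js; rewrite /C'; case: eqP => // ji.
        by rewrite -ji js in nis.
      have C'i : C' i = A by rewrite /C' eqxx.
      have := gP C'; rewrite !big_cons C'i.
      rewrite (CC' _ _ _ (fun j b => X j @^-1` b)).
      rewrite (CC' _ _ _ (fun j b => normal_prob 0 (sg j) b)); apply => j.
      by rewrite /C'; case: eqP.
    - move=> k; apply: (_ : (m1 _ < +oo)%E).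
      by rewrite /m1 /mrestr setTI ltey_eq fin_num_measure.
  by rewrite /m1 /m2 /mrestr /mscale /= fineK // setIC.
under eq_integral do rewrite join_cons //.
rewrite (@integral_independent _ _ _ P _ _ (measurableTypeR R) _ (X i) (idfun : T -> T')
  (normal_prob 0 (sg i)) (fun z => (f (join X s (upd x i z.1) z.2))%:E)) //.
- by apply: eq_integral => y _ /=; rewrite IH.
- apply/measurable_EFinP.
  apply: (@measurable_fun_caratheodory _ _ _
    (fun y (z : R * T') => f (join X s (upd x i y) z.2)) fst) => //.
  + by move=> z; under eq_fun do rewrite join_upd //; exact: cf.
  + move=> y; apply: (@measurableT_comp _ _ _ _ _ _
      (fun w : T' => f (join X s (upd x i y) w)) _ snd) => //.
    apply: (@measurable_join _ _ _ T') => // j js _ B mB; rewrite setTI.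
    by apply: sub_sigma_algebra; exact: boxE.
- by move=> z; rewrite lee_fin.
Qed.

Section GaussianConvexity.
Context {R : realType}.

Lemma cvxD (E : lmodType R) (f g : E -> R) : cvx f -> cvx g ->
  cvx (fun x => f x + g x).
Proof. by move=> cf cg x y t t01; have := cf x y t t01; have := cg x y t t01; lra. Qed.

Lemma cvx_max (E : lmodType R) (f : E -> R) (c : R) : cvx f ->
  cvx (fun x => Num.max (f x) c).
Proof.
move=> cf x y t t01; have := cf x y t t01; have /andP[t0 t1] := t01.
have := leP (f x) c; have := leP (f y) c; have := leP (f (t *: x + (1 - t) *: y)) c.
by case=> ?; case=> ?; case=> ? ?; nra.
Qed.

Lemma cvx_comp_aff (E F : lmodType R) (f : F -> R) (A : E -> F) : cvx f ->
  (forall x y t, A (t *: x + (1 - t) *: y) = t *: A x + (1 - t) *: A y) ->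
  cvx (fun x => f (A x)).
Proof. by move=> cf hA x y t t01; rewrite hA; exact: cf. Qed.

(* [G] is log-concave relative to the centered Gaussian of variance [1/k]. *)
Definition gcvx (k : R) (G : R -> R) : Prop :=
  cvx (fun x : R^o => - ln (G x) - k * x ^+ 2 / 2).

Lemma gcvx_scale (k c : R) (G : R -> R) : 0 < c -> (forall x, 0 < G x) ->
  gcvx k G -> gcvx k (fun x => c * G x).
Proof.
move=> c0 G0 cG x y t t01; have := cG x y t t01.
by rewrite !lnM ?posrE //; lra.
Qed.

Lemma gcvx_cvg (k : R) (G_ : nat -> R -> R) (G : R -> R) :
  (forall n, gcvx k (G_ n)) -> (forall x, 0 < G x) ->
  (forall x, (fun n => G_ n x) @ \oo --> G x) -> gcvx k G.
Proof.
move=> cG G0 GG x y t t01.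
have L z : (fun n => - ln (G_ n z) - k * z ^+ 2 / 2) @ \oo -->
    - ln (G z) - k * z ^+ 2 / 2.
  apply: cvgB; last exact: cvg_cst.
  apply: cvgN; apply: (@continuous_cvg _ _ _ _ _ (fun n => G_ n z) (@ln R)) => //.
  exact: continuous_ln.
apply: (ler_cvg_to (L _)); last by apply: nearW => n; exact: cG.
by apply: cvgD; apply: cvgMr; exact: L.
Qed.

End GaussianConvexity.

(** [V] may fail to be convex, but it is a convex function minus a continuous quadratic one, hence
    continuous in each coordinate; this is what permits passing from the expectation to [gint]. *)
Lemma cvx_gaussian_integral {R : realType} {I : eqType} d (T : measurableType d)
    (P : probability T R) (X : I -> T -> R) (sg : I -> R) (s : seq I)
    (V : (I -> R^o) -> R) :
  uniq s -> (forall i, i \in s -> 0 < sg i) ->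
  (forall i, i \in s -> measurable_fun setT (X i)) ->
  gaussian_product P X sg s ->
  cvx (fun x => V x + \sum_(i <- s) x i ^+ 2 / (2 * sg i ^+ 2)) ->
  (forall x, exists m, forall y, (forall i, i \notin s -> y i = x i) -> m <= V y) ->
  exists2 U : (I -> R^o) -> R, cvx U &
    forall x, (\int[P]_w (expR (- V (join X s x w)))%:E)%E = (expR (- U x))%:E.
Proof.
move=> us sg0 mX gX cV lV; have [U cU UE] := cvx_gint us sg0 cV lV.
exists U => // x; rewrite -UE.
apply: (integral_gaussian_product (f := fun x => expR (- V x))) => // {}x i.
pose Q (x : I -> R^o) := \sum_(i <- s) x i ^+ 2 / (2 * sg i ^+ 2).
have -> : (fun y => expR (- V (upd x i y))) =
    (fun y => expR (- ((V (upd x i y) + Q (upd x i y)) - Q (upd x i y)))).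
  by apply/funext => y; rewrite addrK.
move=> y; apply: continuous_comp; last exact: continuous_expR.
apply: cvgN; apply: cvgB.
  exact: (cvx_continuous (cvx_upd x i cV)).
rewrite /Q; elim: (s) => [|j r IH].
  by under eq_cvg do rewrite big_nil; rewrite big_nil; exact: cvg_cst.
under eq_cvg do rewrite big_cons; rewrite big_cons; apply: cvgD => //.
rewrite /upd; case: eqP => _; last exact: cvg_cst.
by apply: cvgMl; apply: (@exprn_continuous R 2).
Qed.

Lemma sqr_comb {R : comPzRingType} (t x y : R) :
  (t * x + (1 - t) * y) ^+ 2 =
  t * x ^+ 2 + (1 - t) * y ^+ 2 - t * (1 - t) * (x - y) ^+ 2.
Proof. by ring. Qed.

(** The centre [x] of the kernel is treated as one more variable: by Prekopa it suffices that the
    whole exponent, minus [k' * x ^+ 2 / 2], be jointly convex. The maximum with [M] bounds the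
    exponent below on fibres. The curvature satisfies [1 / k' = 1 / k + e^2] when [k > 0], as
    variances add under convolution. *)
Lemma gcvx_gaussian {R : realType} {I : eqType} d (T : measurableType d)
    (P : probability T R) (X : I -> T -> R) (sg : I -> R) (s : seq I)
    (h lin : (I -> R^o) -> R) (l0 M k e : R) :
  uniq s -> (forall i, i \in s -> 0 < sg i) ->
  (forall i, i \in s -> measurable_fun setT (X i)) ->
  gaussian_product P X sg s -> cvx h ->
  (forall a b x y, lin (a *: x + b *: y) = a * lin x + b * lin y) ->
  0 <= k -> (forall x, k * lin x ^+ 2 <= \sum_(i <- s) x i ^+ 2 / sg i ^+ 2) ->
  0 < e ->
  let G x := (\int[P]_w (expR (- Num.max (h (join X s (fun=> 0) w)) M) *
     expR (- ((lin (join X s (fun=> 0) w) + l0 - x) ^+ 2 / (2 * e ^+ 2))))%:E)%E in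
  (forall x, 0 < fine (G x)) /\ gcvx (k / (1 + k * e ^+ 2)) (fun x => fine (G x)).
Proof.
move=> us sg0 mX gX ch lin_lin k0 linP e0 G.
set k' := k / (1 + k * e ^+ 2).
have ke : 0 < 1 + k * e ^+ 2 by rewrite ltr_pwDl // mulr_ge0 // sqr_ge0.
(* The new index [None] carries [x]. It lies outside [s'], so it stays frozen while the other
   coordinates are integrated. *)
pose sg' (i : option I) := if i is Some j then sg j else 0.
pose X' (i : option I) := if i is Some j then X j else cst 0.
pose s' := map Some s.
have us' : uniq s' by rewrite map_inj_uniq // => ? ? [].
have sg0' i : i \in s' -> 0 < sg' i by move=> /mapP[j js ->]; exact: sg0.
have mX' i : i \in s' -> measurable_fun setT (X' i).
  by move=> /mapP[j js ->]; exact: mX.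
have gX' : gaussian_product P X' sg' s'.
  move=> B mB; rewrite !big_map /=; exact: (gX (fun i => B (Some i))).
pose r (z : option I -> R^o) : I -> R^o := fun i => z (Some i).
pose V (z : option I -> R^o) : R := Num.max (h (r z)) M +
  (lin (r z) + l0 - z None) ^+ 2 / (2 * e ^+ 2) - k' * z None ^+ 2 / 2.
have r_lin x y t : r (t *: x + (1 - t) *: y) = t *: r x + (1 - t) *: r y by [].
have cV : cvx (fun z => V z + \sum_(i <- s') z i ^+ 2 / (2 * sg' i ^+ 2)).
  pose B z := (lin (r z) + l0 - z None) ^+ 2 / (2 * e ^+ 2) -
    k' * z None ^+ 2 / 2 + \sum_(i <- s') z i ^+ 2 / (2 * sg' i ^+ 2).
  have -> : (fun z => V z + \sum_(i <- s') z i ^+ 2 / (2 * sg' i ^+ 2)) =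
      (fun z => Num.max (h (r z)) M + B z).
    by apply/funext => z; rewrite /V /B -!addrA.
  apply: cvxD; first by apply: cvx_max; exact: cvx_comp_aff.
  move=> x y t /andP[t0 t1].
  (* [D] is the homogeneous quadratic part of [B] at the difference of the two points. The convexity
     defect of [B] is exactly [t * (1 - t) * D], so all that matters is [0 <= D]. *)
  pose D := (lin (r x) - lin (r y) - (x None - y None)) ^+ 2 / (2 * e ^+ 2) -
    k' * (x None - y None) ^+ 2 / 2 +
    \sum_(i <- s') (x i - y i) ^+ 2 / (2 * sg' i ^+ 2).
  have D0 : 0 <= D.
    have half2 (a c : R) : a / c = a / (2 * c) * 2.
      by rewrite invfM -mulrA mulrAC mulVf ?mul1r // pnatr_eq0.
    have S : k * (lin (r x) - lin (r y)) ^+ 2 / 2 <=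
        \sum_(i <- s') (x i - y i) ^+ 2 / (2 * sg' i ^+ 2).
      have := linP (1 *: r x + (- 1) *: r y).
      rewrite lin_lin mul1r mulN1r ler_pdivrMr // => /le_trans; apply.
      rewrite big_map mulr_suml ler_sum // => i _; rewrite /= scale1r scaleN1r.
      rewrite !fctE /r le_eqVlt; apply/orP; left; apply/eqP.
      exact: half2.
    apply: le_trans (_ : _ <= (lin (r x) - lin (r y) - (x None - y None)) ^+ 2 / (2 * e ^+ 2) -
      k' * (x None - y None) ^+ 2 / 2 + k * (lin (r x) - lin (r y)) ^+ 2 / 2) _; last first.
      by rewrite /D lerD2l.
    set a := lin (r x) - lin (r y); set b := x None - y None.
    (* Completing the square in [a]: [k' * b ^+ 2 / 2] is the minimum over [a] of [k * a ^+ 2 / 2 +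
       (a - b) ^+ 2 / (2 * e ^+ 2)], so no larger [k'] would do. *)
    rewrite (_ : _ - _ + _ = ((1 + k * e ^+ 2) * a - b) ^+ 2 / (2 * e ^+ 2 * (1 + k * e ^+ 2))).
      by rewrite divr_ge0 ?sqr_ge0 // mulr_ge0 ?mulr_ge0 ?sqr_ge0 // ltW.
    by rewrite /k'; field; rewrite !gt_eqF.
  have -> : B (t *: x + (1 - t) *: y) = t * B x + (1 - t) * B y - t * (1 - t) * D.
    rewrite /B r_lin lin_lin !fctE /=.
    have -> : t * lin (r x) + (1 - t) * lin (r y) + l0 - (t *: x None + (1 - t) *: y None)
      = t * (lin (r x) + l0 - x None) + (1 - t) * (lin (r y) + l0 - y None).
      by rewrite /GRing.scale /=; ring.
    have -> : \sum_(i <- s') (t *: x i + (1 - t) *: y i) ^+ 2 / (2 * sg' i ^+ 2) =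
        t * (\sum_(i <- s') x i ^+ 2 / (2 * sg' i ^+ 2)) +
        (1 - t) * (\sum_(i <- s') y i ^+ 2 / (2 * sg' i ^+ 2)) -
        t * (1 - t) * \sum_(i <- s') (x i - y i) ^+ 2 / (2 * sg' i ^+ 2).
      rewrite !mulr_sumr -!big_split -sumrB /=; apply: eq_bigr => i _.
      by rewrite /GRing.scale /= sqr_comb; ring.
    by rewrite /D sqr_comb /GRing.scale /= sqr_comb; ring.
  by rewrite gerBl mulr_ge0 // mulr_ge0 ?(ltW t0) // subr_ge0 ltW.
have lV x : exists m, forall y, (forall i, i \notin s' -> y i = x i) -> m <= V y.
  exists (M - k' * x None ^+ 2 / 2) => y yx; rewrite /V yx.
    rewrite lerD2r; apply: ler_wpDr; last by rewrite le_max lexx orbT.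
    by rewrite divr_ge0 ?sqr_ge0 // mulr_ge0 // sqr_ge0.
  by apply/mapP => -[].
have [U cU UE] := cvx_gaussian_integral us' sg0' mX' gX' cV lV.
pose u x := U (upd (fun=> 0) None x).
have GE x : G x = (expR (- u x - k' * x ^+ 2 / 2))%:E.
  have V0 w : (0 <= (expR (- V (join X' s' (upd (fun=> 0) None x) w)))%:E)%E.
    by rewrite lee_fin expR_ge0.
  have := ge0_integralZl_nonmeas P (expR_gt0 (- (k' * x ^+ 2 / 2))) V0.
  rewrite UE -EFinM -expRD addrC => <-.
  apply: eq_integral => w _; rewrite -EFinM -!expRD; congr (expR _)%:E.
  rewrite /V.
  have -> : r (join X' s' (upd (fun=> 0) None x) w) = join X s (fun=> 0) w.
    apply/funext => i; rewrite /r /join /s' mem_map => [|? ? []//].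
    by [].
  have -> : join X' s' (upd (fun=> 0) None x) w None = x.
    by rewrite /join ifF //; apply/negbTE/mapP => -[].
  by ring.
split=> [x|]; first by rewrite GE expR_gt0.
rewrite /gcvx; under eq_fun do rewrite GE expRK opprB opprK addrAC subrr add0r.
exact: cvx_upd.
Qed.

(** * Brownian motion on a grid *)

Section Grid.
Context {R : realType}.

Lemma sum_indicator_telescope (g : nat -> R) (m N : nat) : (m <= N)%N ->
  \sum_(0 <= k < N) (k < m)%N%:R * (g k.+1 - g k) = g m - g 0%N.
Proof.
move=> mN; rewrite (big_cat_nat (leq0n m) mN) /= [X in _ + X]big1_seq ?addr0.
  rewrite -(telescope_sumr _ (leq0n m)); apply: eq_big_nat => k /andP[_ ->].
  by rewrite mul1r.
by move=> k; rewrite mem_index_iota => /andP[_ /andP[mk _]]; rewrite ltnNge mk mul0r.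
Qed.

(** Expand the nonnegative sum of [dl * (x / dl - l / D * c) ^+ 2]. Letting [D] merely dominate the
    weighted norm of [c] covers the bridge, whose increments have smaller variance. *)
Lemma cauchy_schwarz_weighted (N : nat) (c x dl : nat -> R) (D : R) :
  (forall k, (k < N)%N -> 0 < dl k) -> 0 < D ->
  \sum_(0 <= k < N) c k ^+ 2 * dl k <= D ->
  (\sum_(0 <= k < N) c k * x k) ^+ 2 / D <= \sum_(0 <= k < N) x k ^+ 2 / dl k.
Proof.
move=> dl0 D0 AD; set l := \sum_(0 <= k < N) c k * x k.
set A := \sum_(0 <= k < N) c k ^+ 2 * dl k in AD.
set E := \sum_(0 <= k < N) x k ^+ 2 / dl k.
have : 0 <= \sum_(0 <= k < N) dl k * (x k / dl k - l / D * c k) ^+ 2.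
  rewrite big_nat_cond sumr_ge0 // => k /andP[/andP[_ kN] _].
  by rewrite mulr_ge0 ?sqr_ge0 // ltW // dl0.
have -> : \sum_(0 <= k < N) dl k * (x k / dl k - l / D * c k) ^+ 2 =
    E - 2 * (l / D) * l + (l / D) ^+ 2 * A.
  rewrite {3}/l !mulr_sumr -sumrB -big_split /= big_nat_cond [RHS]big_nat_cond.
  apply: eq_bigr => k /andP[/andP[_ kN] _]; field.
  by rewrite !gt_eqF // dl0.
move=> H; have : (l / D) ^+ 2 * A <= l ^+ 2 / D.
  have -> : l ^+ 2 / D = (l / D) ^+ 2 * D by field; rewrite gt_eqF.
  by rewrite ler_wpM2l // sqr_ge0.
have E2 : 2 * (l / D) * l = l ^+ 2 / D + l ^+ 2 / D by field; rewrite gt_eqF.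
by rewrite E2 in H; move=> ?; lra.
Qed.

Lemma sigma_generatedI {d} {T : measurableType d} {I : Type} (D : set I)
    (X : I -> T -> R) (J : Type) (r : seq J) (F : J -> set T) :
  (forall j, sigma_generated D X (F j)) ->
  sigma_generated D X (\big[setI/setT]_(j <- r) F j).
Proof.
move=> XF; rewrite /sigma_generated.
pose G := [set S | exists i (B : set R), [/\ D i, measurable B & S = X i @^-1` B]].
elim: r => [|j r IH].
  by rewrite big_nil; exact: (@measurableT _ (g_sigma_algebraType G)).
by rewrite big_cons; apply: (@measurableI _ (g_sigma_algebraType G)) => //; exact: XF.
Qed.

Lemma sigma_generated_diff {d} {T : measurableType d} {I : Type} (D : set I)
    (X : I -> T -> R) (i j : I) (B : set R) : D i -> D j -> measurable B ->
  sigma_generated D X ((fun w => X i w - X j w) @^-1` B).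
Proof.
move=> Di Dj mB; rewrite /sigma_generated.
pose G := [set S | exists i (B : set R), [/\ D i, measurable B & S = X i @^-1` B]].
have mX k : D k -> measurable_fun setT (X k : g_sigma_algebraType G -> R).
  move=> Dk _ C mC; rewrite setTI; apply: sub_sigma_algebra.
  by exists k, C.
have m := measurable_funB (mX _ Di) (mX _ Dj).
by have := m measurableT _ mB; rewrite setTI.
Qed.

Lemma strict_grid (a b : R) (ts : seq R) : a < b -> (forall u, u \in ts -> a <= u <= b) ->
  exists (N : nat) (t : nat -> R) (idx : R -> nat),
  [/\ {homo t : i j / (i <= j)%N >-> i <= j}, (forall i, a <= t i <= b),
      t 0%N = a /\ idx b = N, (forall k, (k < N)%N -> t k < t k.+1)
    & forall u, (u \in ts) || (u == b) ->
      [/\ (idx u <= N)%N, t (idx u) = u &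
          forall v, (v \in ts) || (v == b) -> u <= v -> (idx u <= idx v)%N]].
Proof.
move=> ab tsab.
pose tau := sort <=%R (undup (a :: b :: ts)).
have stau : sorted <%R tau by rewrite sort_lt_sorted undup_uniq.
have mtau u : (u \in tau) = (u \in a :: b :: ts) by rewrite mem_sort mem_undup.
have tauab u : u \in tau -> a <= u <= b.
  rewrite mtau !inE => /or3P[/eqP->|/eqP->|/tsab //]; rewrite lexx ?(ltW ab) //.
have ain : a \in tau by rewrite mtau mem_head.
have bin : b \in tau by rewrite mtau !inE eqxx orbT.
have tau0 : (0 < size tau)%N by case: (tau) ain.
(* The default [b] prolongs the grid by a constant: Brownian increments are declared independent
   along monotone sequences of times indexed by all of [nat]. *)
pose t := nth b tau.
have tin i : a <= t i <= b.
  rewrite /t; have [i_s|i_s] := ltnP i (size tau); first by rewrite tauab // mem_nth.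
  by rewrite nth_default // lexx ltW.
have tlt i j : (i < j)%N -> (j < size tau)%N -> t i < t j.
  move=> ij js; rewrite /t.
  by apply: (sorted_ltn_nth lt_trans) => //; rewrite inE ?(ltn_trans ij).
have tidx u : u \in tau -> t (index u tau) = u by exact: nth_index.
have idxlt u : u \in tau -> (index u tau < size tau)%N by rewrite index_mem.
have idxle u v : u \in tau -> v \in tau -> u <= v -> (index u tau <= index v tau)%N.
  move=> ui vi uv; rewrite leqNgt; apply/negP => vu.
  by have := tlt _ _ vu (idxlt _ ui); rewrite !tidx // ltNge uv.
exists (size tau).-1, t, (index ^~ tau); split => //.
- move=> i j; rewrite leq_eqVlt => /predU1P[->//|ij].
  have [js|js] := ltnP j (size tau); first exact/ltW/tlt.
  by rewrite [t j]nth_default //; case/andP: (tin i).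
- split.
    apply/eqP; rewrite eq_le; have /andP[-> _] := tin 0%N; rewrite andbT.
    rewrite -[X in _ <= X](tidx _ ain) leNgt; apply/negP => /= lt0.
    case: (posnP (index a tau)) => [i0|i0]; first by rewrite i0 ltxx in lt0.
    by have := tlt _ _ i0 (idxlt _ ain); rewrite ltNge (ltW lt0).
  apply/eqP; rewrite eqn_leq -ltnS prednK // idxlt //= leqNgt; apply/negP => h.
  have := tlt _ _ h; rewrite prednK // leqnn => /(_ isT); rewrite tidx // ltNge.
  by case/andP: (tin (size tau).-1) => _ ->.
- by move=> k kN; apply: tlt => //; rewrite -ltn_predRL.
- move=> u ub; have H v : (v \in ts) || (v == b) -> v \in tau.
    by rewrite mtau !inE => /orP[->|->]; rewrite ?orbT.
  split; first by rewrite -ltnS prednK // idxlt // H.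
    exact/tidx/H.
  by move=> v vb uv; apply: idxle => //; exact: H.
Qed.

(** [X (j, k)] is the increment of line [j] over cell [k], and [pos j u] rebuilds the path at time
    [u] by summing the increments before [u]. The last clause is the energy inequality, where [be]
    switches the bridge correction on. *)
Lemma brownian_grid d (T : measurableType d) (P : probability T R) (n : nat)
    (W : 'I_n -> R -> T -> R) (a b : R) (ts : seq R) : a < b ->
  (forall u, u \in ts -> a <= u <= b) -> independent_brownian_motions P a b W ->
  exists (X : 'I_n * nat -> T -> R) (sg : 'I_n * nat -> R) (s : seq ('I_n * nat))
    (pos : 'I_n -> R -> ('I_n * nat -> R^o) -> R),
  [/\ uniq s, (forall i, i \in s -> 0 < sg i),
      (forall i, i \in s -> measurable_fun setT (X i)), gaussian_product P X sg s &
  [/\ (forall j u c e x y, pos j u (c *: x + e *: y) = c * pos j u x + e * pos j u y),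
      (forall j u w, (u \in ts) || (u == b) ->
        W j u w = pos j u (join X s (fun=> 0) w))
    & forall j (be : bool) u v x, (u \in ts) || (u == b) -> (v \in ts) || (v == b) ->
      u < v ->
      (pos j v x - pos j u x - be%:R * ((v - u) / (b - a)) * pos j b x) ^+ 2 / (v - u)
      <= \sum_(i <- s) x i ^+ 2 / sg i ^+ 2]].
Proof.
move=> ab tsab [bW iW].
have [N [t [idx [thomo tab [t0 idxb] tlt tidx]]]] := strict_grid ab tsab.
have tin k : t k \in `[a, b] by rewrite in_itv /= tab.
pose X (i : 'I_n * nat) (w : T) := W i.1 (t i.2.+1) w - W i.1 (t i.2) w.
pose sg (i : 'I_n * nat) := Num.sqrt (t i.2.+1 - t i.2).
pose s := [seq (j, k) | j <- enum 'I_n, k <- index_iota 0 N].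
pose pos (j : 'I_n) (u : R) (x : 'I_n * nat -> R^o) : R :=
  \sum_(0 <= k < N) (k < idx u)%N%:R * x (j, k).
have sP j k : ((j, k) \in s) = (k < N)%N.
  apply/allpairsP/idP => [[[j' k'] /= [_ + [_ ->]]]|kN]; first by rewrite mem_index_iota.
  by exists (j, k); rewrite /= mem_enum mem_index_iota.
have mW j k : measurable_fun setT (W j (t k)) by have [mW _ _ _ _] := bW j; exact: mW.
have mX i : measurable_fun setT (X i) by apply: measurable_funB.
exists X, sg, s, pos; split => //.
- apply: allpairs_uniq; [exact: enum_uniq|exact: iota_uniq|].
  by move=> [? ?] [? ?] _ _ [-> ->].
- by move=> [j k]; rewrite sP => kN; rewrite sqrtr_gt0 subr_gt0 tlt.
- move=> B mB; rewrite big_allpairs [RHS]big_allpairs.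
  have [_] := (iW, I); rewrite /independent_families.
  move=> _; have -> := iW (enum 'I_n)
    (fun j => \big[setI/setT]_(0 <= k < N) (X (j, k) @^-1` B (j, k))).
  + apply: eq_bigr => j _; have [_ _ _ gW incW] := bW j.
    have -> := incW t thomo tin (index_iota 0 N) (fun k => X (j, k) @^-1` B (j, k)).
    * apply: eq_big_nat => k /andP[_ kN].
      by apply: gW => //; [case/andP: (tab k)|exact: tlt|case/andP: (tab k.+1)].
    * exact: iota_uniq.
    * move=> k _; split => //; apply: sub_sigma_algebra.
      by exists tt, (B (j, k)).
  + exact: enum_uniq.
  + move=> j _; split => //; apply: sigma_generatedI => k.
    by apply: sigma_generated_diff => //=.
- split.
  + move=> j u c e x y; rewrite /pos !mulr_sumr -big_split; apply: eq_bigr => k _.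
    by rewrite !fctE /= /GRing.scale /=; ring.
  + move=> j u w /tidx[uN tu _]; have [_ W0 _ _ _] := bW j.
    have := sum_indicator_telescope (fun k => W j (t k) w) uN.
    rewrite tu t0 W0 subr0 => <-; apply: eq_big_nat => k /andP[_ kN].
    by rewrite /join sP kN.
  + move=> j be u v x /tidx[uN tu umono] hv uv; have [vN tv _] := tidx _ hv.
    have iuv : (idx u <= idx v)%N by apply: umono => //; exact: ltW.
    have [bN tb _] : [/\ (idx b <= N)%N, t (idx b) = b & True].
      by have [] := tidx b; rewrite ?eqxx ?orbT.
    set th := (v - u) / (b - a).
    have ba0 : 0 < b - a by rewrite subr_gt0.
    have th0 : 0 <= th by rewrite divr_ge0 ?(ltW ba0) // subr_ge0 ltW.
    (* A cell weighs 1 when it lies between [u] and [v]; the bridge correction subtracts [th] from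
       every weight. *)
    pose c k : R := (k < idx v)%N%:R - (k < idx u)%N%:R - be%:R * th.
    have -> : pos j v x - pos j u x - be%:R * th * pos j b x =
        \sum_(0 <= k < N) c k * x (j, k).
      rewrite /pos mulr_sumr -!sumrB; apply: eq_big_nat => k /andP[_ kN].
      by rewrite idxb kN mul1r /c !mulrBl.
    have dl0 k : (k < N)%N -> 0 < t k.+1 - t k by move=> kN; rewrite subr_gt0 tlt.
    (* The sum equals [(v - u) * (1 - be * th)], the variance of the increment of the Brownian
       motion or of the bridge. *)
    have cA : \sum_(0 <= k < N) c k ^+ 2 * (t k.+1 - t k) <= v - u.
      have -> : \sum_(0 <= k < N) c k ^+ 2 * (t k.+1 - t k) =
          (1 - 2 * be%:R * th) * (\sum_(0 <= k < N) (k < idx v)%N%:R * (t k.+1 - t k)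
            - \sum_(0 <= k < N) (k < idx u)%N%:R * (t k.+1 - t k))
          + (be%:R * th ^+ 2) * \sum_(0 <= k < N) (k < N)%N%:R * (t k.+1 - t k).
        rewrite -sumrB !mulr_sumr -big_split; apply: eq_big_nat => k /andP[_ kN].
        rewrite kN /c {c}; have [ku|ku] := ltnP k (idx u).
          rewrite (leq_trans ku iuv); by case: be => /=; ring.
        by case: (k < idx v)%N; case: be => /=; ring.
      have tN : t N = b by rewrite -idxb.
      rewrite !sum_indicator_telescope // tN tv tu t0.
      have -> : v - a - (u - a) = v - u by ring.
      have E : th * (b - a) = v - u by rewrite /th divfK // gt_eqF.
      case: be {c}; rewrite /= ?mul0r ?mulr0 ?mul0r ?subr0 ?mul1r ?addr0 //.
      have := subr_gt0 u v; rewrite uv => vu.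
      by rewrite mulr1 expr2 -mulrA E; nra.
    apply: (le_trans (cauchy_schwarz_weighted _ dl0 _ cA)); first by rewrite subr_gt0.
    rewrite big_allpairs /= (bigD1_seq j) ?enum_uniq ?mem_enum //=.
    rewrite -[leLHS]addr0 lerD //.
      rewrite le_eqVlt; apply/orP; left; apply/eqP; apply: eq_big_nat => k /andP[_ kN].
      by rewrite /sg sqr_sqrtr // ltW // dl0.
    by apply: sumr_ge0 => i _; apply: sumr_ge0 => k _; rewrite divr_ge0 ?sqr_ge0.
Qed.

End Grid.

(** * The path space and Riemann sums *)

Section PathSpace.
Context {R : realType}.
Implicit Types A K : set (int * R).

Lemma linevalE A (z : cspace A) j t (jtA : (j, t) \in A) :
  lineval z j t = (z : set_type A -> R) (SigSub jtA).
Proof.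
rewrite /lineval; have := @valLK _ _ 0 A (z : set_type A -> R) => /(congr1 (fun f => f (SigSub jtA))).
by rewrite sigLE.
Qed.

Lemma lineval_continuous A j t : A (j, t) ->
  continuous (fun z : cspace A => lineval z j t).
Proof.
move=> /mem_set jtA.
under eq_fun do rewrite (linevalE _ jtA).
apply/continuousP => O oO.
have := @compact_open_open (set_type A) R [set SigSub jtA] O (@compact_set1 _ _) oO.
move=> oO'.
have := @initial_continuous _ _ (fun z : cspace A => (z : set_type A -> R) : {compact-open, set_type A -> R}).
move=> /continuousP /(_ _ oO').
congr open; apply/seteqP; split=> z /=.
  by move=> h; apply: h; exists (SigSub jtA).
by move=> h _ [_ -> <-].
Qed.

Lemma cspace_continuous_measurable A (f : cspace A -> R) : continuous f ->
  measurable_fun setT (f : cborel A -> R).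
Proof.
move=> /continuousP cf; apply: (measurability _ (measurable_realfun.RGenOpens.measurableE R)).
move=> _ [_ [a [b ->] <-]]; rewrite setTI; apply: sub_sigma_algebra.
exact/cf/interval_open.
Qed.

Lemma lineval_measurable A j t : A (j, t) ->
  measurable_fun setT (fun z : cborel A => lineval z j t).
Proof. by move=> jtA; apply: cspace_continuous_measurable; exact: lineval_continuous. Qed.

Lemma restr_lineval A K (z : cspace A) j t : K `<=` A -> K (j, t) ->
  lineval (restr K z) j t = lineval z j t.
Proof.
move=> KA Kjt; rewrite /restr; case: pselect => // KA'.
by rewrite (linevalE _ (mem_set Kjt)).
Qed.

(** Restriction is composition with the inclusion of [K] in [A], and an inclusion carries compact
    sets to compact sets, as the compact-open topology demands. *)
Lemma restr_cspace_continuous A K : K `<=` A ->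
  continuous (restr K : cspace A -> cspace K).
Proof.
move=> KA; pose incl (x : set_type K) : set_type A :=
  SigSub (mem_set (KA _ (set_mem (valP x)))).
have cincl : continuous incl.
  by apply: continuous_comp_initial; exact: initial_continuous.
have restrE (z : cspace A) (x : set_type K) :
    (restr K z : set_type K -> R) x = (z : set_type A -> R) (incl x).
  rewrite /restr; case: pselect => // KA'.
  have /= := @valLK _ _ 0 A (z : set_type A -> R) => /(congr1 (fun f => f (incl x))).
  by [].
apply: continuous_comp_initial => z.
apply: (iffRL (@compact_open_cvgP _ _ _ _ _)); first by apply: fmap_filter; exact: nbhs_filter.
move=> K' O cK' oO zK'.
have cK'' : compact (incl @` K').
  by apply: continuous_compact => //; exact: continuous_subspaceT.
have := @compact_open_open (set_type A) R _ O cK'' oO => oO'.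
have /continuousP /(_ _ oO') := @initial_continuous _ _ (fun z : cspace A =>
  (z : set_type A -> R) : {compact-open, set_type A -> R}).
move=> oZ; have : nbhs z ((fun z : cspace A =>
   (z : set_type A -> R) : {compact-open, set_type A -> R}) @^-1`
     [set g | [set g x | x in [set incl x | x in K']] `<=` O]).
  apply: open_nbhs_nbhs; split => //= y [_ [x K'x <-] <-].
  by rewrite -restrE; apply: zK'; exists x.
apply: filterS => z' /= h y [x K'x <-] /=.
by rewrite restrE; apply: h; exists (incl x) => //; exists x.
Qed.

Lemma restr_measurable A K : K `<=` A ->
  measurable_fun setT (restr K : cborel A -> cborel K).
Proof.
move=> KA; apply: (@measurability _ _ (cborel A) (cborel K) _ _ (@open (cspace K))) => // _ [U oU <-].
rewrite setTI; apply: sub_sigma_algebra.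
by have /continuousP := restr_cspace_continuous KA; apply.
Qed.

Lemma lineval_path_continuous (Lam : set int) (I : set R)
    (z : cspace (Lam `*` I)) j : Lam j -> {within I, continuous (lineval z j)}.
Proof.
move=> Lamj.
have /subspace_valL_continuousP' cz : continuous (z : set_type (Lam `*` I) -> R).
  exact: (@cts_fun _ _ z).
have {}cz := cz 0.
apply/subspace_sigL_continuousP => t.
pose jt (t : set_type I) : set_type (Lam `*` I) :=
  SigSub (mem_set (conj Lamj (set_mem (valP t)) : (Lam `*` I) (j, val t))).
have cjt : continuous jt.
  apply: continuous_comp_initial => u.
  have FF : Filter (nbhs u) := nbhs_filter u.
  have h1 : (fun _ : set_type I => j) @ u --> j by exact: cvg_cst.
  have h2 : (fun v : set_type I => val v) @ u --> val u.
    exact: (@initial_continuous _ _ (set_val : set_type I -> R)).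
  exact: cvg_pair h1 h2.
have -> : sigL I (lineval z j) = (z : set_type (Lam `*` I) -> R) \o jt.
  apply/funext => u; rewrite /sigL /= /set_val /=.
  rewrite (linevalE _ (valP (jt u))).
  by congr (_ _); apply: val_inj.
apply: continuous_comp; first exact: cjt.
exact: (@cts_fun _ _ z).
Qed.

End PathSpace.

Section RiemannSums.
Context {R : realType}.
Notation leb := (@lebesgue_measure R).

Lemma uniformly_continuous_segment (a b : R) (g : R -> R) : continuous g ->
  forall e, 0 < e -> exists2 d, 0 < d &
    forall x y, a <= x <= b -> `|x - y| <= d -> `|g x - g y| <= e.
Proof.
move=> cg e e0.
have /compact_near_coveringP/near_covering_withinP cov := @segment_compact R a b.
pose P (d x : R) := forall y, `|x - y| <= d -> `|g x - g y| <= e.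
have dP : \forall d \near (0:R)^'+, `[a, b] `<=` P d.
  apply: cov => x _.
  have e2 : 0 < e / 2 by rewrite divr_gt0.
  have /cvgrPdist_le /(_ _ e2) /nbhs_ballP[r /= r0 rg] := cg x.
  have r2 : 0 < r / 2 by rewrite divr_gt0.
  near=> x' d => /= _ y xy.
  have xx' : `|x - x'| < r / 2 by near: x'; exact: nbhsx_ballx.
  have dr : d < r / 2 by near: d; exact: nbhs_right_lt.
  have h1 : `|g x - g x'| <= e / 2.
    by apply: rg; rewrite /ball /=; apply: lt_trans xx' _; lra.
  have h2 : `|g x - g y| <= e / 2.
    apply: rg; rewrite /ball /= -(subrKA x').
    apply: le_lt_trans (ler_normD _ _) _; lra.
  rewrite -(subrKA (g x)); apply: le_trans (ler_normD _ _) _.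
  by rewrite [X in X + _]distrC; lra.
near (0:R)^'+ => d.
exists d => // x y xab xy.
have : `[a, b] `<=` P d by near: d.
by apply => //=; rewrite in_itv.
Unshelve. all: by end_near. Qed.

(** The integral telescopes over the cells of the primitive [G]; the mean value theorem writes each
    term as [h] times a value of [g] in the cell, close to the value at the left node by uniform
    continuity. *)
Lemma riemann_sum_cvg_continuous (a b : R) (g : R -> R) : a < b -> continuous g ->
  (fun n => \sum_(0 <= k < n.+1) (b - a) / n.+1%:R * g (a + k%:R * ((b - a) / n.+1%:R)))
    @ \oo --> \int[leb]_(s in `[a, b]) g s.
Proof.
move=> ab cg.
have ba0 : 0 < b - a by rewrite subr_gt0.
have ig u v : leb.-integrable `[u, v] (EFin \o g).
  apply: continuous_compact_integrable; first exact: segment_compact.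
  exact: continuous_subspaceT.
pose G x := \int[leb]_(s in `[a, x]) g s.
have dG x : a < x -> is_derive x 1 G (g x).
  move=> ax; have [] := @continuous_FTC1_closed R g a x (x + 1) _ (ig _ _) ax (cg x).
    by rewrite ltrDl.
  by rewrite derive1E => dG <-; exact: derivableP.
have cG : {within `[a, b], continuous G}.
  by apply: parameterized_integral_continuous => //; exact: ltW.
have mvt u v : a <= u -> u < v -> v <= b ->
    exists2 c, u <= c <= v & G v - G u = g c * (v - u).
  move=> au uv vb; have [| |c cuv ->] := @MVT _ G g u v uv.
  - move=> x; rewrite in_itv /= => /andP[ux xv]; apply: dG.
    exact: le_lt_trans ux.
  - apply: continuous_subspaceW cG => z /=; rewrite !in_itv /= => /andP[uz zv].
    by rewrite (le_trans au uz) (le_trans zv vb).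
  - exists c => //; move: cuv; rewrite in_itv /= => /andP[? ?].
    by rewrite !ltW.
apply/cvgrPdist_le => e e0.
have [d d0 gd] := uniformly_continuous_segment a b cg (divr_gt0 e0 ba0).
have := @near_infty_natSinv_lt R (PosNum (divr_gt0 d0 ba0)).
apply: filterS => n /= nd.
set h := (b - a) / n.+1%:R.
have h0 : 0 < h by rewrite divr_gt0.
have hd : h <= d.
  by move: nd; rewrite ltr_pdivlMr // mulrC => /ltW.
pose s (k : nat) := a + k%:R * h.
have sS k : s k.+1 - s k = h by rewrite /s -natr1; ring.
have as_ k : a <= s k by rewrite lerDl mulr_ge0 // ltW.
have sb k : (k <= n.+1)%N -> s k <= b.
  move=> kn; rewrite /s -lerBrDl /h mulrCA ler_piMr ?(ltW ba0) //.
  by rewrite ler_pdivrMr // mul1r ler_nat.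
have -> : \int[leb]_(s in `[a, b]) g s = \sum_(0 <= k < n.+1) (G (s k.+1) - G (s k)).
  rewrite telescope_sumr // {2}/s mul0r addr0 {2}/G set_itv1 Rintegral_set1 subr0.
  by rewrite /s /h mulrC divfK ?pnatr_eq0 // subrKC.
rewrite -sumrB; apply: le_trans (ler_norm_sum _ _ _) _.
apply: (@le_trans _ _ (\sum_(0 <= k < n.+1) h * (e / (b - a)))); last first.
  rewrite sumr_const_nat subn0 -[X in X <= _]mulr_natr /h.
  rewrite le_eqVlt; apply/orP; left; apply/eqP; field.
  by rewrite (gt_eqF ba0) /= nat1r pnatr_eq0.
apply: ler_sum_nat => k /andP[_ kn].
have [c /andP[sc cs] ->] : exists2 c, s k <= c <= s k.+1 & G (s k.+1) - G (s k) = g c * (s k.+1 - s k).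
  by apply: mvt => //; [rewrite -subr_gt0 sS|exact: sb].
rewrite sS mulrC -mulrBr normrM (gtr0_norm h0) ler_pM2l //.
apply: gd; first by rewrite (le_trans (as_ _) sc) (le_trans cs) // sb.
rewrite ger0_norm ?subr_ge0 //; apply: le_trans hd.
by move: (sS k) sc cs; rewrite -/(s k); lra.
Qed.

Lemma riemann_sum_cvg (a b : R) (g : R -> R) : a < b ->
  {within `[a, b], continuous g} ->
  (fun n => \sum_(0 <= k < n.+1) (b - a) / n.+1%:R * g (a + k%:R * ((b - a) / n.+1%:R)))
    @ \oo --> \int[leb]_(s in `[a, b]) g s.
Proof.
move=> ab cg.
(* Clamping to the segment extends [g] to a continuous function on the line without changing the
   nodes or the integral. *)
pose c (x : R) := Num.max a (Num.min b x).
have cc x : a <= c x <= b.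
  by rewrite /c le_max lexx /= ge_max (ltW ab) ge_min lexx.
have cE x : a <= x <= b -> c x = x.
  by move=> /andP[ax xb]; rewrite /c min_r // max_r.
have ct : continuous (g \o c).
  have cvgc (q : R) : {for q, continuous c}.
    apply: (@continuous_max _ _ (cst a) (fun x => Num.min b x)); first exact: cst_continuous.
    by apply: (@continuous_min _ _ (cst b) id); [exact: cst_continuous|exact: cvg_id].
  move=> x; apply/cvgrPdist_le => e e0.
  have /subspace_continuousP/(_ (c x)) := cg; rewrite /= in_itv /= cc => /(_ isT).
  move=> /cvgrPdist_le /(_ _ e0) /= H.
  have H2 : \forall y \near x, `[a, b]%classic (c y) -> `|g (c x) - g (c y)| <= e.
    exact: (cvgc x _ H).
  by apply: filterS H2 => y; apply; rewrite /= in_itv /= cc.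
have -> : \int[leb]_(s in `[a, b]) g s = \int[leb]_(s in `[a, b]) (g \o c) s.
  by apply: eq_Rintegral => x; rewrite inE /= in_itv /= => xab; rewrite /= cE.
apply: cvg_trans (riemann_sum_cvg_continuous ab ct).
apply: near_eq_cvg; apply: nearW => n; apply: eq_big_nat => k /andP[_ kn].
have ba0 : 0 < b - a by rewrite subr_gt0.
rewrite /= cE // lerDl mulr_ge0 ?divr_ge0 ?(ltW ba0) //= -lerBrDl mulrCA.
rewrite ler_piMr ?(ltW ba0) // ler_pdivrMr // mul1r ler_nat ltnW //.
Qed.

End RiemannSums.

(** * Log-concavity for Gibbs measures and their limits *)

Section ConvexFunctionals.
Context {R : realType}.

Lemma convex_function_cvx (E : lmodType R) (f : E -> R) :
  convex_function (setT : set (convex_lmodType E)) f -> cvx f.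
Proof.
move=> cf x y t /andP[t0 t1].
have := cf (Itv01 (ltW t0) (ltW t1)) x y (mem_setT _) (mem_setT _).
by [].
Qed.

Lemma cvx_sum (E : lmodType R) (J : Type) (r : seq J) (P : pred J) (f : J -> E -> R) :
  (forall j, P j -> cvx (f j)) -> cvx (fun x => \sum_(j <- r | P j) f j x).
Proof.
move=> cf; elim: r => [|j r IH].
  by move=> x y t _; rewrite !big_nil !mulr0 addr0.
move=> x y t t01; rewrite !big_cons; case: ifP => Pj; last exact: IH.
by have := IH x y t t01; have := cf j Pj x y t t01; lra.
Qed.

Lemma cvxZ (E : lmodType R) (c : R) (f : E -> R) : 0 <= c -> cvx f ->
  cvx (fun x => c * f x).
Proof.
move=> c0 cf x y t t01; have := cf x y t t01.
move=> /(ler_wpM2l c0) /le_trans; apply.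
by rewrite mulrDr !mulrA ![c * _]mulrC.
Qed.

Lemma cvg_row {T : Type} {F : set_system T} {FF : Filter F} (n : nat)
    (f : 'I_n -> T -> R) (v : 'I_n -> R) :
  (forall i, f i @ F --> v i) -> (fun x => \row_i f i x) @ F --> \row_i v i.
Proof.
move=> fv A [P PM sub].
have : \forall x \near F, forall i, P 0 i (f i x).
  by apply: filter_forall => i; apply: fv; have := PM 0 i; rewrite mxE.
rewrite nbhs_simpl /=.
by apply: filterS => x H; apply: sub => i j; rewrite ord1 mxE.
Qed.

(** Convexity gives continuity in each coordinate separately, which [measurable_join] turns into
    measurability. *)
Lemma measurable_cvx_row d (T : measurableType d) (n : nat) (f : 'rV[R]_n -> R)
    (Y : 'I_n -> T -> R) : cvx f -> (forall i, measurable_fun setT (Y i)) ->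
  measurable_fun setT (fun w => f (\row_i Y i w)).
Proof.
move=> cf mY.
have cf' : cvx (fun x : 'I_n -> R^o => f (\row_i x i)).
  apply: (@cvx_comp_aff _ ('I_n -> R^o) _ f (fun x => \row_i x i) cf) => x y t.
  by apply/rowP => i; rewrite !mxE.
have := @measurable_join R 'I_n d T Y (enum 'I_n) (fun=> cst 0)
  (fun x => f (\row_i x i)) (enum_uniq _) (fun i _ => mY i).
move=> /(_ (fun x i => cvx_continuous (cvx_upd x i cf')) (fun=> 0)).
apply: eq_measurable_fun => w _; congr f; apply/rowP => i.
by rewrite !mxE /join mem_enum.
Qed.

End ConvexFunctionals.

Section Functionals.
Context {R : realType} (r : rectangle R).
Let a := tleft r.
Let b := tright r.
Let ab : a < b := tleft_lt_tright r.

Lemma rset_line (i : 'I_(height r).+1) (t : R) : a <= t <= b -> rset r (line i, t).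
Proof.
move=> tab; split; rewrite /= in_itv /=; last exact: tab.
by rewrite /line lerDl /= lerD2l lez_nat -ltnS ltn_ord.
Qed.

Lemma lineval_line_measurable (i : 'I_(height r).+1) (t : R) : a <= t <= b ->
  measurable_fun setT (fun z : cborel (rset r) => lineval z (line i) t).
Proof. by move=> tab; apply: lineval_measurable; exact: rset_line. Qed.

Lemma slice_within_continuous (z : cspace (rset r)) :
  {within `[a, b], continuous (slice z)}.
Proof.
apply/subspace_continuousP => t tab; apply: cvg_row => i.
have tab' : a <= t <= b by move: tab; rewrite /= in_itv.
have ri : [set` `[line0 r, line0 r + (height r)%:Z]] (line i).
  by have [] := rset_line i tab'.
have /subspace_continuousP/(_ t tab) := @lineval_path_continuous R _ _ z (line i) ri.
exact.
Qed.

Variables (m : nat) (ts : 'I_m -> R) (f : 'I_m -> vecJ r -> R) (F : R -> vecJ r -> R).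
Hypotheses (tsab : forall i, a <= ts i <= b)
  (cf : forall i, cvx (f i))
  (contF : {within `[a, b] `*` setT, continuous (fun p : R * vecJ r => F p.1 p.2)})
  (cF : forall s, a <= s <= b -> cvx (F s)).

Definition node (n k : nat) : R := a + k%:R * ((b - a) / n.+1%:R).

Lemma node_itv n k : (k < n.+1)%N -> a <= node n k <= b.
Proof.
move=> kn; have ba0 : 0 < b - a by rewrite subr_gt0.
rewrite /node lerDl mulr_ge0 ?divr_ge0 ?(ltW ba0) //= -lerBrDl mulrCA.
by rewrite ler_piMr ?(ltW ba0) // ler_pdivrMr // mul1r ler_nat ltnW.
Qed.

Definition discretized (g : R -> vecJ r) (n : nat) : R :=
  \sum_(i < m) f i (g (ts i)) +
  \sum_(0 <= k < n.+1) (b - a) / n.+1%:R * F (node n k) (g (node n k)).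

Lemma discretized_cvg (z : cspace (rset r)) : discretized (slice z) @ \oo -->
  \sum_(i < m) f i (slice z (ts i)) +
  \int[lebesgue_measure]_(s in `[a, b]) F s (slice z s).
Proof.
apply: cvgD; first exact: cvg_cst.
apply: (@riemann_sum_cvg R a b (fun s => F s (slice z s)) ab).
apply/subspace_continuousP => t tab.
have /subspace_continuousP/(_ (t, slice z t)) := contF.
move=> /(_ (conj tab I)) /= H.
have /subspace_continuousP/(_ t tab) cs := @slice_within_continuous z.
apply: (@cvg_comp _ _ _ (fun s => (s, slice z s)) (fun p : R * vecJ r => F p.1 p.2)
  _ _ _ _ H).
move=> U /= [[U1 U2] /= [nU1 nU2] sU].
have h1 := cs _ nU2.
rewrite /nbhs /= /within /=.
near=> s => sab.
apply: sU => //=; split => /=; first by near: s.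
move: sab; near: s; exact: h1.
Unshelve. all: by end_near. Qed.

Lemma discretized_measurable n :
  measurable_fun setT (fun z : cborel (rset r) => discretized (slice z) n).
Proof.
have mslice (g : vecJ r -> R) t : cvx g -> a <= t <= b ->
    measurable_fun setT (fun z : cborel (rset r) => g (slice z t)).
  by move=> cg tab; apply: measurable_cvx_row => // i; exact: lineval_line_measurable.
apply: measurable_funD.
  by apply: measurable_sum => i; exact: mslice.
have -> : (fun z : cborel (rset r) => \sum_(0 <= k < n.+1)
    (b - a) / n.+1%:R * F (node n k) (slice z (node n k))) =
  (fun z => \sum_(k < n.+1) (b - a) / n.+1%:R * F (node n k) (slice z (node n k))).
  by apply/funext => z; rewrite big_mkord.
apply: measurable_sum => k; apply: measurable_funM => //.
by apply: mslice; [apply: cF|]; exact: node_itv.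
Qed.

End Functionals.

Section Prelimit.
Context {R : realType} (r : rectangle R).
Let a := tleft r.
Let b := tright r.
Let ab : a < b := tleft_lt_tright r.

(* The free case is [be = false] and the bridge case is [be = true]. *)
Definition affine_brownian d (T : measurableType d) (P : probability T R)
    (Z : T -> cspace (rset r)) : Prop :=
  exists (W : 'I_(height r).+1 -> R -> T -> R) (be : bool)
    (D : 'I_(height r).+1 -> R -> R),
  independent_brownian_motions P a b W /\
  forall w i t, a <= t <= b -> lineval (Z w) (line i) t =
    W i t w - be%:R * ((t - a) / (b - a)) * W i b w + D i t.

(** Two cases share this statement: [k = 0] needs no energy and gives plain log-concavity, in
    particular for a single value ([c = false]), while [c = true] with [k = (t - u)^-1] is the
    increment. *)
Lemma gcvx_discretized d (T : measurableType d) (P : probability T R)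
    (Z : T -> cspace (rset r)) (m : nat) (ts : 'I_m -> R)
    (f : 'I_m -> vecJ r -> R) (F : R -> vecJ r -> R) (n : nat)
    (i : 'I_(height r).+1) (c : bool) (t u k M e : R) :
  affine_brownian P Z -> (forall i, a <= ts i <= b) -> (forall i, cvx (f i)) ->
  (forall s, a <= s <= b -> cvx (F s)) -> a <= t <= b -> a <= u <= b -> 0 < e ->
  (k = 0 \/ [/\ c, u < t & k = (t - u)^-1]) ->
  let L (z : cspace (rset r)) := lineval z (line i) t - c%:R * lineval z (line i) u in
  let G x := (\int[P]_w (expR (- Num.max (discretized ts f F (slice (Z w)) n) M) *
     expR (- ((L (Z w) - x) ^+ 2 / (2 * e ^+ 2))))%:E)%E in
  (forall x, 0 < fine (G x)) /\ gcvx (k / (1 + k * e ^+ 2)) (fun x => fine (G x)).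
Proof.
move=> [W [be [D [bW ZE]]]] tsab cf cF tab uab e0 kcond L G.
(* One grid holds both observation times, the sample times of [H] and the Riemann nodes, so
   everything is affine in finitely many independent Gaussian increments. *)
pose gts := t :: u :: [seq ts i | i <- enum 'I_m] ++ [seq node r n k | k <- index_iota 0 n.+1].
have gtsab v : v \in gts -> a <= v <= b.
  rewrite !inE mem_cat => /or4P[/eqP->//|/eqP->//|/mapP[j _ ->]//|/mapP[l]].
  by rewrite mem_index_iota => /andP[_ ln] ->; exact: node_itv.
have [X [sg [s [pos [us sg0 mX gX [posl posW energy]]]]]] := brownian_grid ab gtsab bW.
pose bpos j v x := pos j v x - be%:R * ((v - a) / (b - a)) * pos j b x.
have bposl j v c1 c2 x y : bpos j v (c1 *: x + c2 *: y) = c1 * bpos j v x + c2 * bpos j v y.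
  by rewrite /bpos !posl; ring.
have bposZ j v w : v \in gts ->
    lineval (Z w) (line j) v = bpos j v (join X s (fun=> 0) w) + D j v.
  move=> vg; rewrite ZE ?gtsab // /bpos -posW ?vg // -posW // eqxx orbT //.
pose path (x : 'I_(height r).+1 * nat -> R^o) v : vecJ r := \row_j (bpos j v x + D j v).
have pathZ w v : v \in gts -> slice (Z w) v = path (join X s (fun=> 0) w) v.
  by move=> vg; apply/rowP => j; rewrite !mxE bposZ.
have path_aff v x y c1 : path (c1 *: x + (1 - c1) *: y) v =
    c1 *: path x v + (1 - c1) *: path y v.
  by apply/rowP => j; rewrite !mxE bposl; ring.
have tin : t \in gts by rewrite mem_head.
have uin : u \in gts by rewrite !inE eqxx orbT.
pose h x := discretized ts f F (path x) n.
have ch : cvx h.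
  apply: cvxD.
    by apply: cvx_sum => j _; apply: (cvx_comp_aff (cf j)) => x y c1; exact: path_aff.
  under eq_fun do rewrite big_mkord.
  apply: cvx_sum => l _; apply: cvxZ; first by rewrite divr_ge0 // subr_ge0 ltW.
  apply: cvx_comp_aff; last by move=> x y c1; exact: path_aff.
  by apply: cF; exact: node_itv.
have hE w : h (join X s (fun=> 0) w) = discretized ts f F (slice (Z w)) n.
  congr (_ + _); first apply: eq_bigr => j _.
    by rewrite pathZ // !inE mem_cat map_f ?mem_enum ?orbT.
  apply: eq_big_nat => l /andP[_ ln]; rewrite pathZ // !inE mem_cat.
  apply/or4P; apply: Or44; apply: map_f.
  by rewrite mem_index_iota.
pose lin x := bpos i t x - c%:R * bpos i u x.
have linl c1 c2 x y : lin (c1 *: x + c2 *: y) = c1 * lin x + c2 * lin y.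
  by rewrite /lin !bposl; ring.
have k0 : 0 <= k.
  by case: kcond => [->//|[_ ut ->]]; rewrite invr_ge0 subr_ge0 ltW.
(* The deterministic drift [D] drops out of the linear part, and the two bridge corrections combine
   into the single one of [energy]. *)
have linP x : k * lin x ^+ 2 <= \sum_(i <- s) x i ^+ 2 / sg i ^+ 2.
  case: kcond => [->|[c1 ut ->]].
    by rewrite mul0r sumr_ge0 // => j _; rewrite divr_ge0 ?sqr_ge0.
  rewrite mulrC; have := energy i be u t x; rewrite uin tin => /(_ isT isT ut).
  congr (_ ^+ 2 / _ <= _); rewrite /lin c1 /bpos.
  have ba0 : b - a != 0 by rewrite gt_eqF // subr_gt0.
  by rewrite /= mul1r; field.
have := gcvx_gaussian (D i t - c%:R * D i u) M us sg0 mX gX ch linl k0 linP e0.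
have -> // : (fun x => (\int[P]_w (expR (- Num.max (h (join X s (fun=> 0) w)) M) *
   expR (- ((lin (join X s (fun=> 0) w) + (D i t - c%:R * D i u) - x) ^+ 2 / (2 * e ^+ 2))))%:E)%E)
   = G.
have LE w : lin (join X s (fun=> 0) w) + (D i t - c%:R * D i u) = L (Z w).
  by rewrite /L !bposZ // /lin; ring.
by apply/funext => x; apply: eq_integral => w _; rewrite hE LE.
Qed.

Lemma free_bridge_affine (gamma : probability (cborel (rset r)) R) :
  (exists x eta, C0 eta /\ free_law x eta gamma) \/
  (exists x y eta, C00 eta /\ bridge_law x y eta gamma) ->
  exists d (T : measurableType d) (P : probability T R) (Z : {RV P >-> cborel (rset r)}),
    affine_brownian P Z /\ forall E, measurable E -> gamma E = distribution P Z E.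
Proof.
case=> [[x [eta [_ [d [T [P [W [Z [bW ZE gE]]]]]]]]]|[x [y [eta [_ [d [T [P [W [Z [bW ZE gE]]]]]]]]]]].
- exists d, T, P, Z; split => //; exists W, false, (fun i t => x 0 i + lineval eta (line i) t).
  split => // w i t tab; rewrite ZE; last by rewrite in_itv.
  by rewrite !mul0r subr0 addrA.
- exists d, T, P, Z; split => //; exists W, true, (fun i t =>
    ((b - t) * x 0 i + (t - a) * y 0 i) / (b - a) + lineval eta (line i) t).
  split => // w i t tab; rewrite ZE; last by rewrite in_itv.
  by rewrite /brownian_bridge mul1r addrA.
Qed.

End Prelimit.

Section PrelimitLaw.
Context {R : realType}.

(** Used twice: for Riemann sums of a functional cut at [-N], dominated by the constant [expR N],
    and for the removal of the cut, dominated by [expR (- H)]. *)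
Lemma gcvx_dominated d (T : measurableType d) (P : probability T R)
    (fn : nat -> T -> R) (f g : T -> R) (psi : R -> T -> R) (k : R) :
  (forall n, measurable_fun setT (fn n)) ->
  (forall x, measurable_fun setT (psi x)) ->
  (forall x w, 0 < psi x w <= 1) -> (forall n w, 0 <= fn n w <= g w) ->
  P.-integrable setT (EFin \o g) -> (forall w, 0 < f w) ->
  (forall w, fn ^~ w @ \oo --> f w) ->
  (forall n, gcvx k (fun x => fine (\int[P]_w (fn n w * psi x w)%:E)%E)) ->
  gcvx k (fun x => fine (\int[P]_w (f w * psi x w)%:E)%E).
Proof.
move=> mfn mpsi psi01 fng ig f0 fnf cG.
have mf : measurable_fun setT f.
  by apply: (measurable_fun_cvg mfn) => w _; exact: fnf.
have g0 w : 0 <= g w by have /andP[h1 h2] := fng 0%N w; exact: le_trans h2.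
have fg w : f w <= g w.
  apply: (ler_cvg_to (fnf w) (cvg_cst _)).
  by apply: nearW => n; case/andP: (fng n w).
have cv x : (fun n => \int[P]_w (fn n w * psi x w)%:E)%E @ \oo -->
    (\int[P]_w (f w * psi x w)%:E)%E.
  apply: (@dominated_cvg _ _ _ P setT measurableT _ _ (EFin \o g)) => //.
  - by move=> n; apply/measurable_EFinP; exact: measurable_funM.
  - move=> w _; apply: cvg_EFin; first exact: nearW.
    by apply: cvgMl; exact: fnf.
  - move=> n w _; rewrite /= lee_fin; have /andP[h1 h2] := fng n w.
    have /andP[p0 p1] := psi01 x w.
    rewrite ger0_norm ?mulr_ge0 ?(ltW p0) //; apply: le_trans h2.
    by rewrite ler_piMr.
have fin x : (\int[P]_w (f w * psi x w)%:E)%E \is a fin_num.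
  apply: integrable_fin_num => //; apply: le_integrable ig => //.
    by apply/measurable_EFinP; exact: measurable_funM.
  move=> w _ /=; rewrite lee_fin; have /andP[p0 p1] := psi01 x w.
  rewrite !ger0_norm ?mulr_ge0 ?(ltW (f0 w)) ?(ltW p0) //.
  by apply: le_trans (fg w); rewrite ler_piMr // ltW.
apply: gcvx_cvg cG _ _ => x.
  rewrite fine_gt0 // ltey_eq fin andbT; apply: integral_pos_gt0.
  - by apply/measurable_EFinP; exact: measurable_funM.
  - by move=> w; rewrite lte_fin mulr_gt0 //; case/andP: (psi01 x w).
  - by rewrite [X in (_ < X)%E](_ : _ = 1%E) ?lte01 //; exact: probability_setT.
by apply: fine_cvg; rewrite fineK.
Qed.

(** Left unnormalized so that its values lie in (0, 1], which makes it a bounded continuous test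
    function. *)
Definition gauss_kernel (e x y : R) : R := expR (- ((y - x) ^+ 2 / (2 * e ^+ 2))).

Lemma gauss_kernel_itv e x y : 0 < gauss_kernel e x y <= 1.
Proof.
rewrite expR_gt0 /= -expR0 ler_expR oppr_le0 divr_ge0 ?sqr_ge0 //.
by rewrite mulr_ge0 // sqr_ge0.
Qed.

Lemma gauss_kernel_gt0 e x y : 0 < gauss_kernel e x y.
Proof. by case/andP: (gauss_kernel_itv e x y). Qed.

Lemma gauss_kernel_ge0 e x y : 0 <= gauss_kernel e x y.
Proof. exact/ltW/gauss_kernel_gt0. Qed.

Lemma gauss_kernel_le1 e x y : gauss_kernel e x y <= 1.
Proof. by case/andP: (gauss_kernel_itv e x y). Qed.

Lemma continuous_gauss_kernel e x : continuous (gauss_kernel e x).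
Proof.
move=> y; apply: continuous_comp; last exact: continuous_expR.
apply: cvgN; apply: cvgMl; apply: (@continuous_comp _ _ _ (fun y => y - x) (fun y => y ^+ 2)).
  by apply: cvgB; [exact: cvg_id|exact: cvg_cst].
exact: exprn_continuous.
Qed.

Lemma measurable_gauss_kernel e x : measurable_fun setT (gauss_kernel e x).
Proof. by apply: continuous_measurable_fun; exact: continuous_gauss_kernel. Qed.

Lemma prelimit_gcvx (r : rectangle R) (mu : probability (cborel (rset r)) R)
    (i : 'I_(height r).+1) (c : bool) (t u k e : R) :
  prelimit_LC mu -> tleft r <= t <= tright r -> tleft r <= u <= tright r -> 0 < e ->
  (k = 0 \/ [/\ c, u < t & k = (t - u)^-1]) ->
  gcvx (k / (1 + k * e ^+ 2)) (fun x => fine (\int[mu]_z (gauss_kernel e x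
    (lineval z (line i) t - c%:R * lineval z (line i) u))%:E)%E).
Proof.
move=> [gamma [H [gammaE [m [ts [f [F [tsab cf contF cF HE]]]]] [c0 c0_gt0 muE]]]].
have [d [T [P [Z [affZ gZ]]]]] := free_bridge_affine gammaE.
move=> tab uab e0 kcond.
have tsab' j : tleft r <= ts j <= tright r by have := tsab j; rewrite in_itv.
have cf' j : cvx (f j) by exact: convex_function_cvx.
have cF' s : tleft r <= s <= tright r -> cvx (F s).
  by move=> sab; apply: convex_function_cvx; apply: cF; rewrite in_itv.
pose Hn n (z : cborel (rset r)) := discretized ts f F (slice z) n.
have HnH z : Hn ^~ z @ \oo --> H z by rewrite HE; exact: discretized_cvg.
have mHn n : measurable_fun setT (Hn n) by exact: discretized_measurable.
have mH : measurable_fun setT (H : cborel (rset r) -> R).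
  by apply: (measurable_fun_cvg mHn) => z _; exact: HnH.
pose L (z : cborel (rset r)) := lineval z (line i) t - c%:R * lineval z (line i) u.
have mL : measurable_fun setT L.
  apply: measurable_funB; first exact: lineval_line_measurable.
  by apply: measurable_funM => //; exact: lineval_line_measurable.
have mpsi x : measurable_fun setT (fun z => gauss_kernel e x (L z)).
  by apply: measurableT_comp => //; exact: measurable_gauss_kernel.
have meH : measurable_fun setT (fun z : cborel (rset r) => expR (- H z)).
  by apply: measurableT_comp => //; exact: measurableT_comp.
have toP (phi : cborel (rset r) -> \bar R) : measurable_fun setT phi ->
    (forall z, 0 <= phi z)%E -> (\int[gamma]_z phi z = \int[P]_w phi (Z w))%E.
  move=> mphi phi0; rewrite -ge0_integral_distribution //.
  by apply: eq_measure_integral => E mE _; exact: gZ.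
(* Integrals against the Gibbs measure become weighted expectations on the space carrying the
   Brownian motions. *)
have muint (phi : cborel (rset r) -> R) : measurable_fun setT phi ->
    (forall z, 0 <= phi z) -> (\int[mu]_z (phi z)%:E =
      c0%:E * \int[P]_w (expR (- H (Z w)) * phi (Z w))%:E)%E.
  move=> mphi phi0.
  rewrite (@integral_density _ _ _ gamma _ (fun z => c0 * expR (- H z))) //.
  - rewrite toP; last by move=> z; rewrite -EFinM lee_fin !mulr_ge0 ?expR_ge0 // ltW.
      rewrite -ge0_integralZl_nonmeas //; last first.
        by move=> w; rewrite lee_fin mulr_ge0 ?expR_ge0.
      by apply: eq_integral => w _; rewrite -!EFinM; congr (_ %:E); ring.
    by apply: emeasurable_funM; apply/measurable_EFinP => //; exact: measurable_funM.
  - exact: measurable_funM.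
  - by move=> z; rewrite mulr_ge0 ?expR_ge0 // ltW.
  - move=> E mE; apply: (eq_trans (muE E mE)).
    under [RHS]eq_integral do rewrite EFinM.
    rewrite ge0_integralZl //=.
    + by apply/measurable_EFinP; exact: measurable_funTS.
    + by rewrite lee_fin ltW.
  - exact/measurable_EFinP.
(* Finiteness of the partition function comes from [mu] having total mass 1, by testing [muint] on
   the constant 1. *)
have fin : (\int[P]_w (expR (- H (Z w)))%:E < +oo)%E.
  have := muint (fun=> 1) (measurable_cst _) (fun=> ler01).
  rewrite integral_cst_probability => E1.
  have : (c0%:E * \int[P]_w (expR (- H (Z w)) * 1)%:E < +oo)%E by rewrite -E1 ltry.
  under eq_integral do rewrite mulr1.
  by move: (integral _ _ _) => [x||] // ; rewrite ?ltry // mulry gtr0_sg // mul1e.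
have mHZ : measurable_fun setT (fun w => H (Z w)) by exact: measurableT_comp.
have mpsiZ x : measurable_fun setT (fun w => gauss_kernel e x (L (Z w))).
  by apply: (measurableT_comp (mpsi x)).
(* Refining the Riemann sums with the cut at [- N%:R] held fixed. *)
have GM (N : nat) : gcvx (k / (1 + k * e ^+ 2)) (fun x => fine (\int[P]_w
    (expR (- Num.max (H (Z w)) (- N%:R)) * gauss_kernel e x (L (Z w)))%:E)%E).
  apply: (@gcvx_dominated _ _ P (fun n w => expR (- Num.max (Hn n (Z w)) (- N%:R))) _
    (fun=> expR N%:R)) => //.
  - move=> n; apply: measurableT_comp => //; apply: measurableT_comp => //.
    by apply: measurable_maxr => //; exact: measurableT_comp.
  - by move=> x w; exact: gauss_kernel_itv.
  - move=> n w; rewrite expR_ge0 ler_expR lerNl le_max lexx orbT //.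
  - exact: finite_measure_integrable_cst.
  - by move=> w; exact: expR_gt0.
  - move=> w; apply: continuous_cvg; first exact: continuous_expR.
    have cmax : {for H (Z w), continuous (fun y : R => Num.max y (- N%:R) : R)}.
      by apply: (@continuous_max _ _ id (cst _)); [exact: cvg_id|exact: cst_continuous].
    by apply: cvgN; apply: (cvg_comp _ _ (HnH (Z w)) cmax).
  - move=> n.
    by have [] := gcvx_discretized n i (- N%:R) affZ tsab' cf' cF' tab uab e0 kcond.
(* Removing the cut: at each [w] the maximum equals [H (Z w)] once [N] is large. *)
have G : gcvx (k / (1 + k * e ^+ 2)) (fun x => fine (\int[P]_w
    (expR (- H (Z w)) * gauss_kernel e x (L (Z w)))%:E)%E).
  apply: (@gcvx_dominated _ _ P (fun N w => expR (- Num.max (H (Z w)) (- N%:R))) _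
    (fun w => expR (- H (Z w)))) => //.
  - move=> n; apply: measurableT_comp => //; apply: measurableT_comp => //.
    by apply: measurable_maxr.
  - by move=> x w; exact: gauss_kernel_itv.
  - by move=> n w; rewrite expR_ge0 ler_expR lerN2 le_max lexx.
  - apply/integrableP; split; first by apply/measurable_EFinP; apply: measurableT_comp => //; exact: measurableT_comp.
    by under eq_integral do rewrite gee0_abs ?lee_fin ?expR_ge0 //.
  - by move=> w; exact: expR_gt0.
  - move=> w; apply: cvg_near_cst.
    near=> N; congr (expR (- _)); apply/max_idPl; rewrite lerNl.
    near: N; exact: nbhs_infty_ger.
have mI x : measurable_fun setT
    (fun w => (expR (- H (Z w)) * gauss_kernel e x (L (Z w)))%:E).
  apply/measurable_EFinP; apply: measurable_funM => //.
  by do 2 apply: measurableT_comp => //.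
have I0 x w : (0 < (expR (- H (Z w)) * gauss_kernel e x (L (Z w)))%:E)%E.
  by rewrite lte_fin mulr_gt0 ?expR_gt0.
have Ifin x : (\int[P]_w (expR (- H (Z w)) * gauss_kernel e x (L (Z w)))%:E < +oo)%E.
  apply: le_lt_trans fin; apply: ge0_le_integral_nonmeas => w; first exact: ltW.
  rewrite lee_fin ler_piMr ?expR_ge0 //.
  by case/andP: (gauss_kernel_itv e x (L (Z w))).
have Igt0 x : (0 < \int[P]_w (expR (- H (Z w)) * gauss_kernel e x (L (Z w)))%:E)%E.
  apply: integral_pos_gt0 => //.
  by rewrite [X in (_ < X)%E](_ : _ = 1%E) ?lte01 //; exact: probability_setT.
rewrite (_ : (fun x => _) = (fun x => c0 * fine (\int[P]_w
    (expR (- H (Z w)) * gauss_kernel e x (L (Z w)))%:E)%E)); last first.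
  apply/funext => x; rewrite (muint (fun z => gauss_kernel e x (L z))) //.
    by rewrite fineM // ge0_fin_numE // ltW.
  by move=> z; case/andP: (gauss_kernel_itv e x (L z)) => /ltW.
by apply: gcvx_scale => // x; rewrite fine_gt0 // Igt0 Ifin.
Unshelve. all: by end_near. Qed.

End PrelimitLaw.

Section LimitLaw.
Context {R : realType}.

Lemma rset_lineP (r : rectangle R) j t : rset r (j, t) ->
  (exists i : 'I_(height r).+1, line i = j) /\ tleft r <= t <= tright r.
Proof.
move=> [] /=; rewrite !in_itv /= => /andP[lj jl] tab; split => //.
have jl0 : 0 <= j - line0 r by rewrite subr_ge0.
have jn : (absz (j - line0 r) < (height r).+1)%N.
  by rewrite ltnS -lez_nat gez0_abs // lerBlDl.
by exists (Ordinal jn); rewrite /line /= gez0_abs // subrKC.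
Qed.

Lemma integral_marginal (A K : set (int * R)) (mu : probability (cborel A) R)
    (phi : cspace K -> R) : K `<=` A -> continuous phi -> (forall z, 0 <= phi z) ->
  (\int[@marginal R A K mu]_z (phi z)%:E = \int[mu]_z (phi (restr K z))%:E)%E.
Proof.
move=> KA cphi phi0.
rewrite (@ge0_integral_pushforward _ _ _ _ R _ (restr_measurable KA) mu setT
  (fun z => (phi z)%:E)) //.
- by apply/measurable_EFinP; exact: cspace_continuous_measurable.
- by move=> z _; rewrite lee_fin.
Qed.

(** Two points of one line form a compact set [K], and the kernel of the increment is bounded and
    continuous on C(K), so locally weak convergence gives pointwise convergence of the smoothed
    functions, under which [gcvx] is closed. *)
Lemma class_gcvx d (T : measurableType d) (P : probability T R) (Lam : set int)
    (I : set R) (L : {RV P >-> cborel (Lam `*` I)}) (j : int) (c : bool)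
    (t u k e : R) : class_LC L -> Lam j -> I t -> I u -> 0 < e ->
  (k = 0 \/ [/\ c, u < t & k = (t - u)^-1]) ->
  gcvx (k / (1 + k * e ^+ 2)) (fun x => fine (\int[P]_w (gauss_kernel e x
    (lineval (L w) j t - c%:R * lineval (L w) j u))%:E)%E).
Proof.
move=> [r_ [mu_ [preL [_ cvgL]]]] Lj It Iu e0 kcond.
pose K : set (int * R) := [set (j, t); (j, u)].
have Kt : K (j, t) by left.
have Ku : K (j, u) by right.
have cK : compact K by apply: finite_compact; exact: finite_set2.
have KA : K `<=` Lam `*` I by move=> p [->|->].
have [Knear Kcvg] := cvgL K cK KA.
pose phi x (z : cspace K) := gauss_kernel e x (lineval z j t - c%:R * lineval z j u).
have cphi x : continuous (phi x).
  move=> z.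
  have c1 v : K (j, v) -> (fun z : cspace K => lineval z j v) @ z --> lineval z j v.
    by move=> Kv; exact: (lineval_continuous Kv).
  apply: (@continuous_comp _ _ _
    (fun z : cspace K => lineval z j t - c%:R * lineval z j u) (gauss_kernel e x)).
    exact: (cvgB (c1 _ Kt) (cvgMr (c1 _ Ku))).
  exact: continuous_gauss_kernel.
have phi01 x z : 0 < phi x z <= 1 := gauss_kernel_itv _ _ _.
have phi0 x z : 0 <= phi x z by case/andP: (phi01 x z) => /ltW.
have phiE x (A : set (int * R)) (z : cspace A) : K `<=` A -> phi x (restr K z) =
    gauss_kernel e x (lineval z j t - c%:R * lineval z j u).
  by move=> KA'; rewrite /phi !restr_lineval.
have limE x : (\int[@marginal R (Lam `*` I) K (distribution P L)]_z (phi x z)%:E =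
    \int[P]_w (gauss_kernel e x (lineval (L w) j t - c%:R * lineval (L w) j u))%:E)%E.
  rewrite integral_marginal //.
  rewrite (@ge0_integral_distribution _ _ _ _ _ P L (fun z => (phi x (restr K z))%:E)).
  - by apply: eq_integral => w _; rewrite /= phiE.
  - apply/measurable_EFinP; apply: (@measurableT_comp _ _ _ _ _ _ (phi x : cborel K -> R)).
      exact: cspace_continuous_measurable.
    exact: restr_measurable.
  - by move=> z; rewrite lee_fin.
(* The shift by [N] drops the finitely many indices whose rectangle may fail to contain [K]. *)
have [N _ KN] := Knear.
have KrN n : K `<=` rset (r_ (n + N)%N) by apply: KN; rewrite /= leq_addl.
pose G n x := fine (\int[mu_ (n + N)%N]_z (gauss_kernel e x
  (lineval z j t - c%:R * lineval z j u))%:E)%E.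
apply: (@gcvx_cvg _ _ G).
- move=> n; have [[i ij] tab] := rset_lineP (KrN n _ Kt).
  have [_ uab] := rset_lineP (KrN n _ Ku).
  rewrite /G -ij; exact: prelimit_gcvx.
- move=> x; rewrite -limE.
  have I0 : (0 < \int[@marginal R (Lam `*` I) K (distribution P L)]_z (phi x z)%:E)%E.
    rewrite limE; apply: integral_pos_gt0.
    + apply/measurable_EFinP; apply: measurableT_comp; first exact: measurable_gauss_kernel.
      apply: measurable_funB.
        by apply: (measurableT_comp (lineval_measurable _)) => //; exact: KA.
      apply: measurable_funM => //.
      by apply: (measurableT_comp (lineval_measurable _)) => //; exact: KA.
    + by move=> w; rewrite lte_fin gauss_kernel_gt0.
    + by rewrite [X in (_ < X)%E](_ : _ = 1%E) ?lte01 //; exact: probability_setT.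
  rewrite fine_gt0 // I0 limE (@le_lt_trans _ _ 1%:E) ?ltry //.
  rewrite -(integral_cst_probability P 1); apply: ge0_le_integral_nonmeas => w.
    by rewrite lee_fin gauss_kernel_ge0.
  by rewrite lee_fin gauss_kernel_le1.
- move=> x; have bphi : exists M : R, forall z, `|phi x z| <= M.
    by exists 1 => z; rewrite ger0_norm //; case/andP: (phi01 x z).
  have := Kcvg (phi x) (cphi x) bphi; rewrite limE -(cvg_shiftn N) => cv.
  have fin : (\int[P]_w (gauss_kernel e x (lineval (L w) j t - c%:R * lineval (L w) j u))%:E)%E
      \is a fin_num.
    rewrite ge0_fin_numE; last by apply: integral_ge0 => w _; rewrite lee_fin gauss_kernel_ge0.
    rewrite (@le_lt_trans _ _ 1%:E) ?ltry //.
    rewrite -(integral_cst_probability P 1); apply: ge0_le_integral_nonmeas => w.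
      by rewrite lee_fin gauss_kernel_ge0.
    by rewrite lee_fin gauss_kernel_le1.
  rewrite /G; apply: fine_cvg; rewrite fineK //.
  apply: cvg_trans cv; apply: near_eq_cvg; apply: nearW => n.
  rewrite /= (integral_marginal (mu_ (n + N)%N) (KrN n) (cphi x) (phi0 x)).
  by apply: eq_integral => z _; rewrite phiE.
Qed.

End LimitLaw.

(** * Existence of the means *)

Lemma cvx_linear_growth (R : realType) (u : R^o -> R) (N : R) : cvx u ->
  (forall x, 0 <= u x) -> 0 < N -> u 0 + 1 <= u N -> forall x, x / N - 1 <= u x.
Proof.
move=> cu u0 N0 uN x; case: (lerP x N) => xN.
  by apply: le_trans (u0 x); rewrite subr_le0 ler_pdivrMr // mul1r.
have x0 : 0 < x by exact: lt_trans xN.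
have t01 : 0 < N / x < 1 by rewrite divr_gt0 // ltr_pdivrMr // mul1r.
have := cu x 0 _ t01.
rewrite scaler0 addr0 [_ *: _](_ : _ = N); last by rewrite /GRing.scale /= divfK // gt_eqF.
move: (u0 0) uN; move: (u x) (u 0) (u N) => a b c b0 uN H.
have : 1 <= N / x * (a - b) by move: uN H; lra.
rewrite mulrAC ler_pdivlMr // mul1r => H'.
have : x / N <= a - b by rewrite ler_pdivrMr // mulrC.
by move: b0; lra.
Qed.

Lemma gcvx0_cvx (R : realType) (G : R -> R) : gcvx 0 G -> cvx (fun x : R^o => - ln (G x)).
Proof. by move=> cG x y t t01; have := cG x y t t01; rewrite !mul0r !subr0. Qed.

Lemma cvxN (R : realType) (E : lmodType R) (f : E -> R) : cvx f -> cvx (fun x => f (- x)).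
Proof.
by move=> cf x y t t01; have := cf (- x) (- y) t t01; rewrite !scalerN -opprD.
Qed.

Lemma gcvxN (R : realType) k (G : R -> R) : gcvx k G -> gcvx k (fun x => G (- x)).
Proof.
move=> /cvxN cG; rewrite /gcvx.
under eq_fun => x do rewrite -(sqrrN (x : R)).
exact: cG.
Qed.

Section GaussianSmoothing.
Context d (T : measurableType d) (R : realType) (P : probability T R).
Implicit Type Y : T -> R.

(** Up to the factor [normal_peak e], this is the density at [x] of [Y] plus an independent centered
    normal of standard deviation [e]. *)
Definition smooth Y (e x : R) : R := fine (\int[P]_w (gauss_kernel e x (Y w))%:E)%E.

Lemma smoothE Y e x : measurable_fun setT Y ->
  ((smooth Y e x)%:E = \int[P]_w (gauss_kernel e x (Y w))%:E)%E.
Proof.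
move=> mY; rewrite fineK // ge0_fin_numE; last first.
  by apply: integral_ge0 => w _; rewrite lee_fin gauss_kernel_ge0.
rewrite (@le_lt_trans _ _ 1%:E) ?ltry //.
rewrite -(integral_cst_probability P 1); apply: ge0_le_integral_nonmeas => w.
  by rewrite lee_fin gauss_kernel_ge0.
by rewrite lee_fin gauss_kernel_le1.
Qed.

Lemma measurable_gauss_kernel_comp Y e x : measurable_fun setT Y ->
  measurable_fun setT (fun w => (gauss_kernel e x (Y w))%:E).
Proof.
move=> mY; apply/measurable_EFinP; apply: measurableT_comp => //.
exact: measurable_gauss_kernel.
Qed.

Lemma smooth_gt0 Y e x : measurable_fun setT Y -> 0 < smooth Y e x.
Proof.
move=> mY; rewrite -lte_fin smoothE //; apply: integral_pos_gt0.
- exact: measurable_gauss_kernel_comp.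
- by move=> w; rewrite lte_fin gauss_kernel_gt0.
- by rewrite [X in (_ < X)%E](_ : _ = 1%E) ?lte01 //; exact: probability_setT.
Qed.

Lemma smooth_le1 Y e x : measurable_fun setT Y -> smooth Y e x <= 1.
Proof.
move=> mY; rewrite -lee_fin smoothE // -(integral_cst_probability P 1).
by apply: ge0_le_integral_nonmeas => w; rewrite lee_fin ?gauss_kernel_ge0 ?gauss_kernel_le1.
Qed.

Lemma smooth_cvg0 Y : measurable_fun setT Y -> (fun n : nat => smooth Y 1 n%:R) @ \oo --> 0.
Proof.
move=> mY; apply: fine_cvg; rewrite -[X in _ --> X](integral_cst_probability P 0).
apply: (@dominated_cvg _ _ _ P setT _ _ _ (cst 1%E)) => //.
- by move=> n; exact: measurable_gauss_kernel_comp.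
- move=> w _; apply: cvg_EFin; first exact: nearW.
  rewrite /comp /= /gauss_kernel; apply: (cvg_comp _ (fun x => expR (- x))); last exact: cvgr_expR.
  apply/cvgryPge => A; near=> n.
  have n1 : Y w + 1 + `|A| * 2 <= n%:R by near: n; exact: nbhs_infty_ger.
  have := ler_norm A; have := normr_ge0 A; rewrite expr1n mulr1 ler_pdivlMr ?ltr0n // expr2; nra.
- exact: finite_measure_integrable_cst.
- by move=> n w _; rewrite /= lee_fin ger0_norm ?gauss_kernel_le1 // gauss_kernel_ge0.
Unshelve. all: by end_near. Qed.

(* Convexity of [- ln (smooth Y 1)] and its growth to infinity force a linear lower bound. *)
Lemma smooth_exp_decay Y : measurable_fun setT Y -> gcvx 0 (smooth Y 1) ->
  exists2 q : R, 0 < q < 1 & forall n : nat, smooth Y 1 n%:R <= expR 1 * q ^+ n.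
Proof.
move=> mY cY.
have := smooth_cvg0 mY => /cvgrPdist_lt /(_ (smooth Y 1 0 * expR (- 1))).
rewrite mulr_gt0 ?expR_gt0 ?smooth_gt0 // => /(_ isT) [N0 _ HN].
pose N := N0.+1.
have gN : smooth Y 1 N%:R < smooth Y 1 0 * expR (- 1).
  by have := HN N (leqnSn _); rewrite /= sub0r normrN gtr0_norm // smooth_gt0.
have N0R : 0 < N%:R :> R by rewrite ltr0n.
have uN : - ln (smooth Y 1 0) + 1 <= - ln (smooth Y 1 N%:R).
  have : ln (smooth Y 1 N%:R) <= ln (smooth Y 1 0 * expR (- 1)).
    by rewrite ler_ln ?posrE ?mulr_gt0 ?expR_gt0 ?smooth_gt0 // ltW.
  by rewrite lnM ?posrE ?expR_gt0 ?smooth_gt0 // expRK => h; rewrite lerNr opprD opprK.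
have cu : cvx (fun x : R^o => - ln (smooth Y 1 x)).
  exact: gcvx0_cvx.
have u0 x : 0 <= - ln (smooth Y 1 x) by rewrite oppr_ge0 ln_le0 // smooth_le1.
exists (expR (- N%:R^-1)); first by rewrite expR_gt0 expR_lt1 oppr_lt0 invr_gt0.
move=> n; rewrite -expRM_natl -expRD -[leLHS]lnK ?posrE ?smooth_gt0 // ler_expR.
rewrite -[leLHS]opprK lerNl opprD mulrN opprK addrC.
exact: (cvx_linear_growth cu u0).
Qed.

Lemma sum_geometric_nat (q : R) (n : nat) : 0 <= q < 1 ->
  \sum_(i < n) i%:R * q ^+ i <= q / (1 - q) ^+ 2.
Proof.
move=> /andP[q0 q1]; have d0 : 0 < 1 - q by rewrite subr_gt0.
have -> : \sum_(i < n) i%:R * q ^+ i =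
    q / (1 - q) ^+ 2 - q ^+ n * (n%:R / (1 - q) + q / (1 - q) ^+ 2).
  elim: n => [|n IH]; first by rewrite big_ord0; field; rewrite gt_eqF.
  by rewrite big_ord_recr /= IH (exprS q n) -natr1; field; rewrite gt_eqF.
rewrite gerBl mulr_ge0 ?exprn_ge0 // addr_ge0 ?divr_ge0 ?sqr_ge0 //; exact: ltW.
Qed.

(** For [Y > 0] and [n] its floor, the kernel at [n] is at least [expR (- 2^-1)], so the positive
    part is at most 1 plus a multiple of the sum of [n] times the kernel at [n]. The geometric decay
    of [smooth Y 1 n] makes this sum integrable. *)
Lemma pos_part_integral_lty Y : measurable_fun setT Y -> gcvx 0 (smooth Y 1) ->
  (\int[P]_w (Num.max (Y w) 0)%:E < +oo)%E.
Proof.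
move=> mY cY; have [q /andP[q0 q1] gq] := smooth_exp_decay mY cY.
pose f (n : nat) w := (n%:R * gauss_kernel 1 n%:R (Y w))%:E.
have f0 n w : (0 <= f n w)%E by rewrite lee_fin mulr_ge0 // gauss_kernel_ge0.
have mf n : measurable_fun setT (f n).
  apply/measurable_EFinP; apply: measurable_funM => //; apply/measurable_EFinP.
  exact: measurable_gauss_kernel_comp.
have bY w : ((Num.max (Y w) 0)%:E <= 1 + (expR 2^-1)%:E * \sum_(0 <= n <oo) f n w)%E.
  case: (leP (Y w) 0) => Y0.
    by rewrite adde_ge0 // mule_ge0 ?lee_fin ?expR_ge0 // nneseries_ge0.
  pose n := `|Num.floor (Y w)|%N.
  have nE : n%:R = (Num.floor (Y w))%:~R :> R.
    by rewrite /n -[in RHS](@gez0_abs (Num.floor (Y w))) // floor_ge0 ltW.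
  have nY : n%:R <= Y w < n%:R + 1 by rewrite nE ge_floor /= -[1]/(1%:~R) -intrD floorD1_gt.
  apply: (@le_trans _ _ (1 + (expR 2^-1)%:E * f n w)%E); last first.
    apply: leeD => //; apply: lee_pmul => //; rewrite ?lee_fin ?expR_ge0 //.
    apply: le_trans (nneseries_lim_ge n.+1 _) => //.
    by rewrite big_nat_recr //= leeDr // sume_ge0.
  rewrite /f -EFinM -EFinD lee_fin.
  have : 1 <= expR 2^-1 * gauss_kernel 1 n%:R (Y w).
    rewrite /gauss_kernel -expRD -expR0 ler_expR expR0 expr1n mulr1.
    by move: nY; move: (n%:R : R) => m; nra.
  have : 0 <= n%:R :> R by [].
  by move: nY; rewrite mulrCA; nra.
apply: (@le_lt_trans _ _ (1 + (expR 2^-1)%:E * (expR 1 * (q / (1 - q) ^+ 2))%:E)%E); last first.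
  by rewrite -EFinM -EFinD ltry.
apply: (@le_trans _ _ (\int[P]_w (1 + (expR 2^-1)%:E * \sum_(0 <= n <oo) f n w))%E).
  by apply: ge0_le_integral_nonmeas => // w; rewrite lee_fin le_max lexx orbT.
have mS : measurable_fun setT (fun w => \sum_(0 <= n <oo) f n w)%E.
  exact: ge0_emeasurable_sum.
have S0 w : (0 <= \sum_(0 <= n <oo) f n w)%E by exact: nneseries_ge0.
rewrite ge0_integralD //; last 2 first.
- by move=> w _; rewrite mule_ge0 // lee_fin expR_ge0.
- exact: measurable_funeM.
rewrite integral_cst_probability leeD2l // ge0_integralZl_nonmeas ?expR_gt0 //.
rewrite lee_pmul2l ?lte_fin ?expR_gt0 // integral_nneseries //.
apply: lime_le; first by apply: is_cvg_nneseries => n _ _; apply: integral_ge0 => w _; exact: f0.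
apply: nearW => n.
rewrite (@le_trans _ _ (\sum_(0 <= i < n) (i%:R * (expR 1 * q ^+ i))%:E)%E) //.
  apply: lee_sum => i _; case: i => [|i].
    by rewrite mul0r integral0_eq // => w _; rewrite /f mul0r.
  rewrite /f; under eq_integral do rewrite EFinM.
  rewrite ge0_integralZl_nonmeas ?ltr0n //; last by move=> w; rewrite lee_fin gauss_kernel_ge0.
  by rewrite -smoothE // -EFinM lee_fin ler_pM2l ?ltr0n.
rewrite sumEFin lee_fin big_mkord.
under eq_bigr do rewrite mulrCA.
by rewrite -mulr_sumr ler_pM2l ?expR_gt0 // sum_geometric_nat // ltW.
Qed.

Lemma smoothN Y e x : smooth (fun w => - Y w) e x = smooth Y e (- x).
Proof.
rewrite /smooth; congr fine; apply: eq_integral => w _.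
by rewrite /gauss_kernel -opprD opprK sqrrN.
Qed.

Lemma gcvx_integrable Y : measurable_fun setT Y -> gcvx 0 (smooth Y 1) ->
  P.-integrable setT (EFin \o Y).
Proof.
move=> mY cY; have mNY : measurable_fun setT (fun w => - Y w) by exact: measurableT_comp.
have cNY : gcvx 0 (smooth (fun w => - Y w) 1).
  by rewrite (funext (smoothN Y 1)); exact: gcvxN.
apply/integrableP; split; first exact/measurable_EFinP.
apply: (@le_lt_trans _ _ (\int[P]_w ((Num.max (Y w) 0)%:E + (Num.max (- Y w) 0)%:E))%E).
  apply: ge0_le_integral_nonmeas => // w; rewrite /= -EFinD lee_fin.
  by case: (ler0P (Y w)) => h; case: (lerP (- Y w) 0) => h'; lra.
have mm (X : T -> R) : measurable_fun setT X -> measurable_fun setT (fun w => (Num.max (X w) 0)%:E).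
  by move=> mX; apply/measurable_EFinP; apply: measurable_funTS; exact: measurable_maxr.
rewrite ge0_integralD //; try exact: mm.
- by rewrite lte_add_pinfty //; exact: pos_part_integral_lty.
- by move=> w _; rewrite lee_fin le_max lexx orbT.
- by move=> w _; rewrite lee_fin le_max lexx orbT.
Qed.

End GaussianSmoothing.

(** * Integrals against the standard normal law *)

Section NormalIntegral.
Context {R : realType}.
Implicit Types (m s : R) (G : R -> R).

Lemma normal_peak_scale s : 0 < s -> normal_peak s * s = normal_peak 1.
Proof.
move=> s0; rewrite /normal_peak -[in LHS]mulrnAr sqrtrM ?sqr_ge0 // sqrtr_sqr gtr0_norm //.
by rewrite invfM mulrAC mulVf ?gt_eqF // expr1n !mul1r.
Qed.

Lemma normal_std_integral m s G : 0 < s -> continuous G -> (forall x, 0 <= G x) ->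
  (\int[lebesgue_measure]_x (G x * normal_pdf m s x)%:E =
   \int[normal_prob 0 1]_x (G (m + s * x))%:E)%E.
Proof.
move=> s0 cG G0; have s0' : s != 0 by rewrite gt_eqF.
have cA : continuous (fun x : R => m + s * x).
  by move=> x; apply: cvgD; [exact: cvg_cst|apply: cvgMr; exact: cvg_id].
have mGA : measurable_fun setT (fun x => G (m + s * x)).
  by apply: continuous_measurable_fun => x; exact: (continuous_comp (cA x) (cG _)).
have dA (x : R^o) : is_derive x (1 : R^o) (fun x : R^o => m + s * x : R^o) s.
  have := is_deriveD (is_derive_cst (m : R^o) x 1) (is_deriveZ s (is_derive_id x (1 : R^o))).
  by move/is_derive_eq; apply; rewrite add0r /GRing.scale /= mulr1.
have A'E : (fun x : R => m + s * x : R^o)^`()%classic = cst s.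
  by apply/funext => x; rewrite derive1E derive_val.
rewrite (@increasing_ge0_integration_by_substitutionT _ (fun x => m + s * x)) //.
- rewrite [RHS](@integral_density _ _ _ lebesgue_measure _ (normal_pdf 0 1)) //.
  + apply: eq_integral => x _; rewrite A'E -EFinM; congr EFin.
    rewrite -[LHS]/(G (m + s * x) * normal_pdf m s (m + s * x) * s).
    rewrite !normal_pdfE ?oner_neq0 //= -mulrA; congr (_ * _).
    rewrite mulrAC; congr (_ * _).
      exact: normal_peak_scale.
    rewrite /normal_fun addrC addKr subr0 expr1n exprMn; congr expR.
    by rewrite -(mulr_natr (s ^+ 2)); field.
  + exact: measurable_normal_pdf.
  + by move=> x; exact: normal_pdf_ge0.
  + exact/measurable_EFinP.
  + by move=> x; rewrite lee_fin.
- by move=> x y xy; rewrite ltrD2l ltr_pM2l.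
- by rewrite A'E => ?; exact: cvg_cst.
- by rewrite A'E; exact: is_cvg_cst.
- by rewrite A'E; exact: is_cvg_cst.
- apply: (cvg_comp _ (fun x => m + x)); last exact: cvg_addrl_Ny.
  by apply: gt0_cvgMrNy => //; exact: cvg_id.
- apply: (cvg_comp _ (fun x => m + x)); last exact: cvg_addrl.
  by apply: gt0_cvgMry => //; exact: cvg_id.
- move=> x; apply: cvgM; first exact: cG.
  exact: continuous_normal_pdf.
- by move=> x; rewrite mulr_ge0 // normal_pdf_ge0.
Qed.

Lemma normal_prob_opp (f : R -> \bar R) : measurable_fun setT f -> (forall x, 0 <= f x)%E ->
  (\int[normal_prob 0 1]_x f (- x)%R = \int[normal_prob 0 1]_x f x)%E.
Proof.
move=> mf f0; have mN : measurable_fun setT (-%R : R -> measurableTypeR R) by [].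
have mfN : measurable_fun setT (fun x : R => f (- x)) by exact: measurableT_comp.
rewrite !integral_normal_prob ?oner_neq0 //; congr (_ * _)%E.
pose h (x : R) := (f x * (expR (- (x ^+ 2 / (2 * 1 ^+ 2))))%:E)%E.
transitivity (\int[lebesgue_measure]_(x in (-%R : R -> measurableTypeR R) @^-1` setT)
    (h \o -%R) x)%E.
  by rewrite preimage_setT; apply: eq_integral => x _; rewrite /h /= sqrrN.
have mh : measurable_fun setT h.
  apply: emeasurable_funM => //; apply/measurable_EFinP; apply: measurableT_comp => //.
  by apply: measurableT_comp => //; apply: measurable_funM => //; exact: measurable_funX.
rewrite -ge0_integral_pushforward //=.
  by apply: eq_measure_integral => A mA _; exact: lebesgue_measureN.
by move=> x _; rewrite mule_ge0 // lee_fin expR_ge0.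
Qed.

(** The integrand times the standard density is [Num.sqrt 2] times the normal density of variance
    2. *)
Lemma normal_prob_expR_sqr :
  (\int[normal_prob 0 1]_x (expR (x ^+ 2 / 4))%:E = (Num.sqrt 2 : R)%:E)%E.
Proof.
have m4 : measurable_fun setT (fun x : R => (expR (x ^+ 2 / 4))%:E).
  apply/measurable_EFinP; apply: measurableT_comp => //.
  by apply: measurable_funM => //; exact: measurable_funX.
rewrite [LHS](@integral_density _ _ _ lebesgue_measure _ (normal_pdf 0 1)) //; last 2 first.
- exact: measurable_normal_pdf.
- by move=> x; exact: normal_pdf_ge0.
transitivity (\int[lebesgue_measure]_x
    ((Num.sqrt 2)%:E * (normal_pdf 0 (Num.sqrt 2 : R) x)%:E))%E; last first.
  rewrite ge0_integralZl_nonmeas ?sqrtr_gt0 //; last by move=> x; rewrite lee_fin normal_pdf_ge0.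
  by rewrite integral_normal_pdf mule1.
apply: eq_integral => x _; rewrite -!EFinM !normal_pdfE ?oner_neq0 //; congr EFin.
rewrite -(@normal_peak_scale (Num.sqrt 2)) ?sqrtr_gt0 // [LHS]mulrCA [RHS]mulrCA -!mulrA; congr (_ * (_ * _)).
rewrite /normal_fun !subr0 -expRD expr1n sqr_sqrtr //; congr expR; by field.
Qed.

(** Domination: [|x| <= 1 + x ^+ 2 / 4 <= expR (x ^+ 2 / 4)]. *)
Lemma normal_prob_abs_lty : (\int[normal_prob 0 1]_x (`|x : R|)%:E < +oo)%E.
Proof.
apply: (@le_lt_trans _ _ (Num.sqrt 2 : R)%:E); last exact: ltry.
rewrite -normal_prob_expR_sqr; apply: ge0_le_integral_nonmeas => x; rewrite lee_fin //.
apply: le_trans (expR_ge1Dx _); rewrite -[x ^+ 2]real_normK ?num_real //.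
have H (y : R) : y <= 1 + y ^+ 2 / 4 by have := sqr_ge0 (y / 2 - 1); rewrite !expr2; lra.
exact: H.
Qed.

Lemma normal_prob_linear_integrable c s :
  (normal_prob 0 1 : probability (measurableTypeR R) R).-integrable setT
    (fun x : R => (c + s * x)%:E).
Proof.
under eq_fun do rewrite EFinD EFinM.
apply: integrableD => //; first exact: finite_measure_integrable_cst.
apply: integrableZl => //; apply/integrableP; split; first exact/measurable_EFinP.
exact: normal_prob_abs_lty.
Qed.

Lemma normal_prob_linear c s :
  (\int[normal_prob 0 1]_x (c + s * x)%:E = c%:E)%E.
Proof.
have i1 := normal_prob_linear_integrable 0 1.
pose N := (normal_prob 0 1 : probability (measurableTypeR R) R).
under eq_integral do rewrite EFinD EFinM.
rewrite integralD //; last 2 first.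
- exact: finite_measure_integrable_cst.
- by apply: integrableZl => //; move: i1; under eq_fun do rewrite add0r mul1r.
rewrite integralZl //; last by move: i1; under eq_fun do rewrite add0r mul1r.
rewrite (integral_cst_probability N) [X in (_ * X)%E](_ : _ = 0%E) ?mule0 ?adde0 //.
have mp : measurable_fun setT (fun x : R => (Num.max x 0)%:E).
  by apply/measurable_EFinP; exact: measurable_maxr.
rewrite integralE /= (_ : (fun x : R => x%:E)^\+%E = (fun x => (Num.max x 0)%:E)); last first.
  by apply/funext => x; rewrite funeposE -EFin_max.
rewrite (_ : (fun x : R => x%:E)^\-%E = (fun x => (Num.max (- x) 0)%:E)); last first.
  by apply/funext => x; rewrite funenegE -EFin_max.
rewrite (normal_prob_opp mp); last by move=> x; rewrite lee_fin le_max lexx orbT.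
rewrite subee // ge0_fin_numE; last by apply: integral_ge0 => x _; rewrite lee_fin le_max lexx orbT.
apply: le_lt_trans normal_prob_abs_lty; apply: ge0_le_integral_nonmeas => x; rewrite lee_fin.
  by rewrite le_max lexx orbT.
by rewrite ge_max ler_norm normr_ge0.
Qed.

End NormalIntegral.

(** * Convex comparison with the Gaussian *)

Section ConvexCrossing.
Context {R : realType}.
Implicit Type f v : R^o -> R.

Lemma cvx_three_points f (x y z : R) : cvx f -> x < y < z ->
  (z - x) * f y <= (z - y) * f x + (y - x) * f z.
Proof.
move=> cf /andP[xy yz]; have zx0 : 0 < z - x by rewrite subr_gt0 (lt_trans xy).
have t01 : 0 < (z - y) / (z - x) < 1.
  by rewrite divr_gt0 //= ?subr_gt0 ?ltr_pdivrMr ?mul1r //; lra.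
have := cf x z _ t01; rewrite [X in f X](_ : _ = y); last first.
  by rewrite /GRing.scale /=; field; rewrite gt_eqF.
rewrite -(ler_pM2l zx0) => /le_trans; apply; rewrite le_eqVlt; apply/orP; left; apply/eqP.
by field; rewrite gt_eqF.
Qed.

(** By the three-point inequality at 0, 1 and [x], a convex function decreases at most linearly, so
    the parabola wins far from the origin. *)
Lemma cvx_add_sqr_ge0 v (delta : R) : cvx v -> 0 < delta ->
  exists B : R, forall x : R, B <= `|x| -> 0 <= v x + delta * x ^+ 2 / 2.
Proof.
have half u : cvx u -> 0 < delta ->
    exists2 B : R, 0 <= B & forall x : R, B <= x -> 0 <= u x + delta * x ^+ 2 / 2.
  move=> cu d0; pose M := `|u 0| + `|u 1|.
  have M0 : 0 <= M by rewrite addr_ge0.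
  exists (2 + 2 * M / delta); first by rewrite addr_ge0 // divr_ge0 ?mulr_ge0 // ltW.
  move=> x xB; have D0 : 0 <= 2 * M / delta by rewrite divr_ge0 ?mulr_ge0 // ltW.
  have x1 : 1 < x by move: xB D0; lra.
  have MD : 2 * M <= x * delta by rewrite -ler_pdivrMr //; move: xB; lra.
  have := @cvx_three_points u 0 1 x cu; rewrite ltr01 x1 => /(_ isT).
  have := ler_norm (u 0); have := ler_norm (- u 1); rewrite normrN.
  have := normr_ge0 (u 0); rewrite /M in M0 MD *.
  move: (u 0) (u 1) (u x) M0 MD => a b c.
  move: `|a| `|b| => A B M0 MD A0 bB aA; rewrite !subr0 mul1r => H.
  have xB' : x * (- b) <= x * B by apply: ler_wpM2l => //; apply: ltW; exact: lt_trans ltr01 _.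
  have xA' : (x - 1) * a <= (x - 1) * A by apply: ler_wpM2l => //; rewrite subr_ge0 ltW.
  have xM' : x * (2 * (A + B)) <= x * (x * delta).
    by apply: ler_wpM2l => //; apply: ltW; exact: lt_trans ltr01 _.
  by rewrite expr2; lra.
move=> cv d0; have [B1 B10 H1] := half v cv d0.
have [B2 B20 H2] := half _ (cvxN cv) d0.
exists (Num.max B1 B2) => x; rewrite ge_max => /andP[x1 x2].
case: (ler0P x) x1 x2 => x0 x1 x2; last exact: H1.
by have := H2 _ x2; rewrite opprK sqrrN.
Qed.

Lemma cvx_secant f (a b : R) : cvx f -> a < b -> exists c s : R,
  (forall x, a <= x <= b -> f x <= c + s * x) /\
  (forall x, x <= a \/ b <= x -> c + s * x <= f x).
Proof.
move=> cf ab; have ba0 : 0 < b - a by rewrite subr_gt0.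
pose s := (f b - f a) / (b - a); exists (f a - s * a), s.
have sE : s * (b - a) = f b - f a by rewrite divfK // gt_eqF.
have E x : (f a - s * a + s * x) * (b - a) = (b - x) * f a + (x - a) * f b.
  have fbE : f b = s * (b - a) + f a by rewrite sE subrK.
  by rewrite fbE; ring.
split=> x.
  move=> /andP[]; rewrite le_eqVlt => /orP[/eqP <- _|ax].
    by rewrite -(ler_pM2r ba0) E; lra.
  rewrite le_eqVlt => /orP[/eqP ->|xb]; first by rewrite -(ler_pM2r ba0) E; lra.
  rewrite -(ler_pM2r ba0) E mulrC; apply: cvx_three_points => //.
  by rewrite ax.
case; rewrite le_eqVlt => /orP[/eqP xE|xab]; rewrite -(ler_pM2r ba0) E ?xE; try lra.
- have := @cvx_three_points f x a b cf; rewrite xab ab => /(_ isT).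
  by move: (f a) (f b) (f x) => ? ? ?; lra.
- have := @cvx_three_points f a b x cf; rewrite xab ab => /(_ isT).
  by move: (f a) (f b) (f x) => ? ? ?; lra.
Qed.

Lemma cvx_sqr : cvx (fun x : R^o => (x : R) ^+ 2).
Proof.
have H (x y t : R) : 0 < t < 1 ->
    (t * x + (1 - t) * y) ^+ 2 <= t * x ^+ 2 + (1 - t) * y ^+ 2.
  move=> /andP[t0 t1]; rewrite sqr_comb gerBl mulr_ge0 ?sqr_ge0 // mulr_ge0 ?(ltW t0) //.
  by rewrite subr_ge0 ltW.
by move=> x y t; exact: H.
Qed.

(* A function more convex than a parabola is negative exactly on a bounded interval; the
   secant of [f] through its end points is then above [f] inside and below [f] outside. *)
Lemma cvx_crossing f v (delta : R) : cvx f -> cvx v -> 0 < delta ->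
  (forall x : R, 0 <= v x + delta * x ^+ 2 / 2) \/
  exists c s : R, forall x : R,
    (v x + delta * x ^+ 2 / 2 <= 0 /\ f x <= c + s * x) \/
    (0 <= v x + delta * x ^+ 2 / 2 /\ c + s * x <= f x).
Proof.
move=> cf cv d0; have [B HB] := cvx_add_sqr_ge0 cv d0.
pose w (x : R) := v x + delta * x ^+ 2 / 2; pose W := [set x | w x < 0].
have cw : cvx (w : R^o -> R).
  apply: cvxD => //; under eq_fun do rewrite mulrAC.
  by apply: cvxZ cvx_sqr; rewrite divr_ge0 // ltW.
have [[x0 Wx0]|noW] := pselect (exists x, W x); last first.
  by left => x; rewrite leNgt; apply/negP => wx; apply: noW; exists x.
right; have WB x : W x -> `|x| < B by rewrite /W /= ltNge => h; rewrite ltNge; apply: contra h; exact: HB.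
have Wub : has_ubound W by exists B => x /WB /(le_lt_trans (ler_norm _)) /ltW.
have Wlb : has_lbound W.
  by exists (- B) => x /WB; rewrite ltr_norml => /andP[/ltW].
have [x1 Wx1 x01] : exists2 x1, W x1 & x0 < x1.
  case: (ltP (w (x0 + 1)) 0) => w1; first by exists (x0 + 1) => //; rewrite ltrDl.
  have wx0 : w x0 < 0 := Wx0.
  (* For this [t] the chord from [x0] to [x0 + 1] has height [w x0 / 2 < 0] at [x0 + t]. A second
     point of [W] is needed for the secant to have distinct end points. *)
  pose t := - w x0 / (2 * (w (x0 + 1) - w x0)).
  have D0 : 0 < w (x0 + 1) - w x0 by lra.
  have tE : t * (w (x0 + 1) - w x0) = - w x0 / 2 by rewrite /t; field; rewrite gt_eqF.
  have t0 : 0 < t by rewrite divr_gt0 ?mulr_gt0 // oppr_gt0.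
  have t1 : t < 1 by rewrite ltr_pdivrMr ?mulr_gt0 // mul1r; lra.
  exists (x0 + t); last by rewrite ltrDl.
  have := cw (x0 + 1) x0 t; rewrite t0 t1 => /(_ isT).
  rewrite [X in w X](_ : _ = x0 + t); last by rewrite /GRing.scale /=; lra.
  by rewrite /W /=; move: (w (x0 + 1)) (w x0) (w (x0 + t)) tE wx0 => p q r; lra.
have ab : inf W < sup W.
  apply: (@le_lt_trans _ _ x0); first exact: inf_lbound.
  by apply: (lt_le_trans x01); exact: ub_le_sup.
have [c [s [Hin Hout]]] := cvx_secant cf ab; exists c, s => x.
case: (ltP (w x) 0) => wx; [left|right]; split => //.
- exact: ltW.
- by apply: Hin; rewrite inf_lbound //= ub_le_sup.
- apply: Hout; case: (leP x (inf W)) => xa; [by left|right].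
  rewrite leNgt; apply/negP => xb.
  have [y Wy yx] := @inf_lt _ W x (ex_intro _ x0 Wx0) xa.
  have [z Wz xz] := @sup_gt _ W x (ex_intro _ x0 Wx0) xb.
  have := @cvx_three_points _ y x z cw; rewrite yx xz => /(_ isT).
  by move: Wy Wz wx yx xz; rewrite /W /=; move: (w x) (w y) (w z) => p q r; nra.
Qed.

End ConvexCrossing.

Lemma continuous_affine_max (R : realType) (c s : R) :
  continuous (fun x : R => Num.max (c + s * x) 0).
Proof.
move=> x; apply: (@continuous_max _ _ (fun x => c + s * x) (cst 0)); last exact: cvg_cst.
by apply: cvgD; [exact: cvg_cst|apply: cvgMr; exact: cvg_id].
Qed.

Section ConvexOrder.
Context d (T : measurableType d) (R : realType) (P : probability T R).
Implicit Types (Y : T -> R) (G : R -> R).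

Lemma normal_pdf_kernel (y e x : R) : e != 0 ->
  normal_pdf y e x = normal_peak e * gauss_kernel e x y.
Proof.
move=> e0; rewrite normal_pdfE // /normal_fun /gauss_kernel; congr (_ * expR _).
by rewrite mulNr -(sqrrN (x - y)) opprB mulr_natl.
Qed.

Lemma measurable_normal_pdf_comp Y e G : measurable_fun setT Y -> e != 0 ->
  measurable_fun setT G ->
  measurable_fun setT (fun p : T * R => (G p.2 * normal_pdf (Y p.1) e p.2)%:E).
Proof.
move=> mY e0 mG; under eq_fun do rewrite normal_pdf_kernel //.
apply/measurable_EFinP; apply: measurable_funM; first exact: measurableT_comp.
apply: measurable_funM => //; apply: measurableT_comp => //; apply: measurableT_comp => //.
apply: measurable_funM => //; apply: measurable_funX; apply: measurable_funB => //.
exact: measurableT_comp.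
Qed.

Lemma smooth_density Y e G : measurable_fun setT Y -> 0 < e -> continuous G ->
  (forall x, 0 <= G x) ->
  (\int[lebesgue_measure]_x (G x * (normal_peak e * smooth P Y e x))%:E =
   \int[P]_w \int[normal_prob 0 1]_x (G (Y w + e * x))%:E)%E.
Proof.
move=> mY e0 cG G0; have e0' : e != 0 by rewrite gt_eqF.
have mG : measurable_fun setT G by exact: continuous_measurable_fun.
under [RHS]eq_integral do rewrite -normal_std_integral //.
pose F (p : T * R) := (G p.2 * normal_pdf (Y p.1) e p.2)%:E.
have F0 p : (0 <= F p)%E by rewrite lee_fin mulr_ge0 // normal_pdf_ge0.
rewrite (@fubini_tonelli _ _ _ _ _ P lebesgue_measure F) //; last first.
  exact: measurable_normal_pdf_comp.
apply: eq_integral => x _; rewrite /F /=.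
under eq_integral do rewrite normal_pdf_kernel // mulrA EFinM.
rewrite ge0_integralZl //; last 3 first.
- exact: measurable_gauss_kernel_comp.
- by move=> w _; rewrite lee_fin gauss_kernel_ge0.
- by rewrite lee_fin mulr_ge0 // normal_peak_ge0.
by rewrite -smoothE // -EFinM mulrA.
Qed.

Lemma measurable_normal_shift Y e G : measurable_fun setT Y -> 0 < e -> continuous G ->
  (forall x, 0 <= G x) ->
  measurable_fun setT (fun w => \int[normal_prob 0 1]_x (G (Y w + e * x))%:E)%E.
Proof.
move=> mY e0 cG G0; under eq_fun do rewrite -normal_std_integral //.
apply: (@measurable_fun_fubini_tonelli_F _ _ _ _ _ lebesgue_measure
  (fun p : T * R => (G p.2 * normal_pdf (Y p.1) e p.2)%:E)).
  by apply: measurable_normal_pdf_comp; rewrite ?gt_eqF //; exact: continuous_measurable_fun.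
by move=> p; rewrite lee_fin mulr_ge0 // normal_pdf_ge0.
Qed.

(** The comparison works with integrals of nonnegative functions, so the secant is split into its
    two parts; their integrals are finite and differ by the mean [c]. The explicit bound on [b]
    provides integrability when [c] becomes random. *)
Lemma normal_prob_pos_neg (c s : R) :
  let b := fine (\int[normal_prob 0 1]_x (Num.max (- (c + s * x)) 0)%:E)%E in
  [/\ (\int[normal_prob 0 1]_x (Num.max (c + s * x) 0)%:E = (c + b)%:E)%E,
      (\int[normal_prob 0 1]_x (Num.max (- (c + s * x)) 0)%:E = b%:E)%E &
      0 <= b <= `|c| + `|s| * fine (\int[normal_prob 0 1]_x `|x : R|%:E)].
Proof.
move=> b; pose N := (normal_prob 0 1 : probability (measurableTypeR R) R).
have iN := normal_prob_linear_integrable c s.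
have mx : measurable_fun setT (fun x : R => c + s * x).
  by apply: measurable_funD => //; exact: measurable_funM.
have mabs : measurable_fun setT (fun x : R => `|x|%:E).
  by apply/measurable_EFinP; exact: normr_measurable.
have b0 : (0 <= \int[N]_x (Num.max (- (c + s * x)) 0)%:E)%E.
  by apply: integral_ge0 => x _; rewrite lee_fin le_max lexx orbT.
have ble : (\int[N]_x (Num.max (- (c + s * x)) 0)%:E <=
    (`|c| + `|s| * fine (\int[N]_x `|x : R|%:E))%:E)%E.
  rewrite EFinD EFinM fineK; last first.
    rewrite ge0_fin_numE; first exact: normal_prob_abs_lty.
    by apply: integral_ge0 => x _.
  rewrite -(integral_cst_probability N) -ge0_integralZl //.
  rewrite -ge0_integralD //; last first.
    exact: measurable_funeM.
  apply: ge0_le_integral_nonmeas => x; first by rewrite lee_fin le_max lexx orbT.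
  rewrite -EFinM -EFinD lee_fin ge_max addr_ge0 ?mulr_ge0 // andbT -normrM.
  apply: le_trans (ler_norm _) _; rewrite normrN; exact: ler_normD.
have bE : (b%:E = \int[N]_x (Num.max (- (c + s * x)) 0)%:E)%E.
  by rewrite fineK // ge0_fin_numE // (le_lt_trans ble) // ltry.
split => //; last by rewrite -!lee_fin bE b0.
have mn : measurable_fun setT (fun x : R => Num.max (- (c + s * x)) 0).
  by apply: measurable_maxr => //; exact: measurableT_comp.
have ib : N.-integrable setT (fun x : R => (Num.max (- (c + s * x)) 0)%:E).
  apply/integrableP; split; first exact/measurable_EFinP.
  rewrite (_ : (fun x => _) = (fun x : R => (Num.max (- (c + s * x)) 0)%:E)).
    by rewrite -bE ltry.
  by apply/funext => x /=; rewrite ger0_norm // le_max lexx orbT.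
rewrite EFinD bE -(normal_prob_linear c s) -integralD //.
apply: eq_integral => x _; rewrite -EFinD; congr EFin.
by case: (lerP (c + s * x) 0) => h1; case: (lerP (- (c + s * x)) 0) => h2; lra.
Qed.


(** The difference of the two integrals depends on the law of [Y] only through its mean, hence
    agrees with that of the Gaussian centered at [m]. *)
Lemma smooth_pos_neg Y (m e c s : R) : measurable_fun setT Y ->
  P.-integrable setT (EFin \o Y) -> (\int[P]_w (Y w)%:E = m%:E)%E -> 0 < e ->
  let E1 G := (\int[P]_w \int[normal_prob 0 1]_x (G (Y w + e * x))%:E)%E in
  exists2 b : R, E1 (fun x => Num.max (- (c + s * x)) 0) = b%:E &
    E1 (fun x => Num.max (c + s * x) 0) = (c + s * m + b)%:E.
Proof.
move=> mY iY mE e0 E1.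
pose b w := fine (\int[normal_prob 0 1]_x (Num.max (- (c + s * (Y w + e * x))) 0)%:E)%E.
pose C := fine (\int[normal_prob 0 1]_x `|x : R|%:E).
have H w : [/\ (\int[normal_prob 0 1]_x (Num.max (c + s * (Y w + e * x)) 0)%:E
      = (c + s * Y w + b w)%:E)%E,
    (\int[normal_prob 0 1]_x (Num.max (- (c + s * (Y w + e * x))) 0)%:E = (b w)%:E)%E &
    0 <= b w <= `|c + s * Y w| + `|s * e| * C].
  have := normal_prob_pos_neg (c + s * Y w) (s * e); rewrite /b.
  have E x : c + s * (Y w + e * x) = c + s * Y w + s * e * x by rewrite mulrDr mulrA addrA.
  have -> : (fun x : R => (Num.max (c + s * (Y w + e * x)) 0)%:E) =
      (fun x => (Num.max (c + s * Y w + s * e * x) 0)%:E) by apply/funext => x; rewrite E.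
  have -> : (fun x : R => (Num.max (- (c + s * (Y w + e * x))) 0)%:E) =
      (fun x => (Num.max (- (c + s * Y w + s * e * x)) 0)%:E) by apply/funext => x; rewrite E.
  by [].
have mb : measurable_fun setT b.
  apply/measurable_EFinP; rewrite (_ : EFin \o b = fun w =>
    \int[normal_prob 0 1]_x (Num.max (- (c + s * (Y w + e * x))) 0)%:E)%E; last first.
    by apply/funext => w; have [_ -> _] := H w.
  apply: (@measurable_normal_shift Y e (fun x => Num.max (- (c + s * x)) 0)) => //.
    by under eq_fun do rewrite opprD -mulNr; exact: continuous_affine_max.
  by move=> x; rewrite le_max lexx orbT.
have ics : P.-integrable setT (fun w => (c + s * Y w)%:E).
  under eq_fun do rewrite EFinD EFinM.
  by apply: integrableD => //; [exact: finite_measure_integrable_cst|exact: integrableZl].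
have ib : P.-integrable setT (EFin \o b).
  apply: (@le_integrable _ _ _ P _ _ _ (fun w => (`|c + s * Y w|%:E + (`|s * e| * C)%:E)%E)) => //.
  - exact/measurable_EFinP.
  - move=> w _; have [_ _ /andP[b0 bC]] := H w.
    by rewrite /= lee_fin ger0_norm // (le_trans bC) // ler_norm.
  - apply: integrableD => //; last exact: finite_measure_integrable_cst.
    exact: (integrable_abse ics).
exists (fine (\int[P]_w (b w)%:E)%E).
  rewrite fineK; last exact: integrable_fin_num.
  by apply: eq_integral => w _; have [_ -> _] := H w.
rewrite EFinD fineK; last exact: integrable_fin_num.
transitivity (\int[P]_w ((c + s * Y w)%:E + (b w)%:E))%E.
  by apply: eq_integral => w _; have [-> _ _] := H w.
rewrite integralD //; congr (_ + _)%E.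
under eq_integral do rewrite EFinD EFinM.
rewrite integralD //; [|exact: finite_measure_integrable_cst|exact: integrableZl].
by rewrite integral_cst_probability integralZl // mE.
Qed.

(** The noise is symmetric, and convexity bounds [f y] by the average of [f] at [y + e * x] and
    [y - e * x]. Hence smoothing [Y] can only raise the expectation to be bounded. *)
Lemma normal_prob_jensen (f : R^o -> R) (y e : R) : cvx f -> (forall x, 0 <= f x) ->
  ((f y)%:E <= \int[normal_prob 0 1]_x (f (y + e * x))%:E)%E.
Proof.
move=> cf f0; pose N := (normal_prob 0 1 : probability (measurableTypeR R) R).
have contf : continuous (f : R -> R) by exact: cvx_continuous.
have cA r : continuous (fun x : R => f (y + r * x)).
  move=> x; apply: (@continuous_comp _ _ _ (fun x : R => y + r * x) (f : R -> R)); last exact: contf.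
  by apply: cvgD; [exact: cvg_cst|apply: cvgMr; exact: cvg_id].
have mA r : measurable_fun setT (fun x : R => (f (y + r * x))%:E).
  by apply/measurable_EFinP; exact: continuous_measurable_fun.
rewrite -(@lee_pmul2l _ 2%:E) // -[X in (_ <= X)%E]ge0_integralZl_nonmeas //; last first.
  by move=> x; rewrite lee_fin.
have -> : (\int[normal_prob 0 1]_x (2%:E * (f (y + e * x))%:E) =
    \int[normal_prob 0 1]_x ((f (y + e * x))%:E + (f (y + e * - x))%:E))%E.
  have mAN : measurable_fun setT (fun x : R => (f (y + e * - x))%:E).
    by under eq_fun do rewrite mulrN -mulNr; exact: mA.
  rewrite ge0_integralD //; try by [exact: mA|move=> x _; rewrite lee_fin].
  rewrite (normal_prob_opp (mA e)); last by move=> x; rewrite lee_fin.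
  rewrite ge0_integralZl_nonmeas //; last by move=> x; rewrite lee_fin.
  by rewrite mule_natl mule2n.
rewrite -EFinM -(integral_cst_probability N); apply: ge0_le_integral_nonmeas => x.
  by rewrite lee_fin mulr_ge0.
rewrite -EFinD lee_fin; have h01 : 0 < (2^-1 : R) < 1 by rewrite invr_gt0 ltr0n invf_lt1 // ltr1n.
have := cf (y + e * x) (y + e * - x) 2^-1 h01.
rewrite [X in f X](_ : _ = y); first lra.
by rewrite /GRing.scale /=; field.
Qed.

(* The log-concavity of the smoothed density [rho] relative to the Gaussian density [p] makes
   [p - rho] negative on an interval only, so that [int f rho <= int f p] reduces to the secant
   of [f] over this interval, whose integrals are equal because the means are. *)
Lemma convex_order Y (m k sg : R) (f : R^o -> R) : measurable_fun setT Y ->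
  P.-integrable setT (EFin \o Y) -> (\int[P]_w (Y w)%:E = m%:E)%E ->
  0 < k -> (forall e, 0 < e -> gcvx (k / (1 + k * e ^+ 2)) (smooth P Y e)) ->
  0 < sg -> k^-1 < sg ^+ 2 -> cvx f -> (forall x, 0 <= f x) ->
  (\int[P]_w (f (Y w - m))%:E <= \int[normal_prob 0 1]_x (f (sg * x)%R)%:E)%E.
Proof.
move=> mY iY mE k0 gY sg0 ksg cf f0.
(* Half of the gap goes to the smoothing, so [k^-1 + e ^+ 2] is still below [sg ^+ 2] and
   [delta > 0] remains. *)
pose e := Num.sqrt ((sg ^+ 2 - k^-1) / 2).
have d0 : 0 < sg ^+ 2 - k^-1 by rewrite subr_gt0.
have e2 : e ^+ 2 = (sg ^+ 2 - k^-1) / 2 by rewrite sqr_sqrtr // divr_ge0 // ltW.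
have e0 : 0 < e by rewrite sqrtr_gt0 divr_gt0.
have e0' : e != 0 by rewrite gt_eqF.
have sg0' : sg != 0 by rewrite gt_eqF.
pose k' := k / (1 + k * e ^+ 2).
have k'E : k' = (k^-1 + e ^+ 2)^-1.
  rewrite /k'; have -> : 1 + k * e ^+ 2 = k * (k^-1 + e ^+ 2) by rewrite mulrDr mulfV ?gt_eqF.
  by rewrite invfM mulrA mulfV ?mul1r // gt_eqF.
pose delta := k' - (sg ^+ 2)^-1.
have delta0 : 0 < delta.
  have k1 : 0 < k^-1 by rewrite invr_gt0.
  have s1 : 0 < k^-1 + e ^+ 2 by rewrite addr_gt0 // exprn_gt0.
  by rewrite subr_gt0 k'E ltf_pV2 ?posrE ?exprn_gt0 // e2; move: d0; lra.
pose Phi (x : R) := f (x - m); have Phi0 x : 0 <= Phi x by exact: f0.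
have cPhi : cvx (Phi : R^o -> R).
  have affm (x y t : R) : t * x + (1 - t) * y - m = t * (x - m) + (1 - t) * (y - m) by ring.
  by apply: (cvx_comp_aff (A := fun x : R^o => x - m : R^o) cf) => x y t; exact: affm.
have contPhi : continuous Phi by exact: cvx_continuous.
pose E1 G := (\int[P]_w \int[normal_prob 0 1]_x (G (Y w + e * x))%:E)%E.
pose E2 G := (\int[normal_prob 0 1]_x (G (m + sg * x)%R)%:E)%E.
pose rho x := normal_peak e * smooth P Y e x.
pose p := normal_pdf m sg.
have rho0 x : 0 < rho x by rewrite mulr_gt0 ?normal_peak_gt0 ?smooth_gt0.
have p0 x : 0 < p x.
  by rewrite /p normal_pdf_kernel // mulr_gt0 ?normal_peak_gt0 ?gauss_kernel_gt0.
have E1E G : continuous G -> (forall x, 0 <= G x) ->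
    E1 G = (\int[lebesgue_measure]_x (G x * rho x)%:E)%E.
  by move=> cG G0; rewrite /E1 -smooth_density.
have E2E G : continuous G -> (forall x, 0 <= G x) ->
    E2 G = (\int[lebesgue_measure]_x (G x * p x)%:E)%E.
  by move=> cG G0; rewrite /E2 -normal_std_integral.
have -> : (\int[normal_prob 0 1]_x (f (sg * x)%R)%:E)%E = E2 Phi.
  by apply: eq_integral => x _; rewrite /Phi addrC addKr.
apply: (@le_trans _ _ (E1 Phi)).
  apply: ge0_le_integral_nonmeas => w; first by rewrite lee_fin.
  exact: (@normal_prob_jensen Phi).
(* [ln p - ln rho] is [v] plus the parabola [delta * x ^+ 2 / 2]: the curvature [k'] of the smoothed
   law exceeds that of [p] by [delta], so [v] alone is already convex. *)
pose v (x : R) := (- ln (smooth P Y e x) - k' * x ^+ 2 / 2) + (m / sg ^+ 2 * x +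
  (ln (normal_peak sg) - ln (normal_peak e) - m ^+ 2 / (2 * sg ^+ 2))).
have vE x : v x + delta * x ^+ 2 / 2 = ln (p x) - ln (rho x).
  rewrite /p normal_pdf_kernel // !lnM ?posrE ?normal_peak_gt0 ?smooth_gt0 ?gauss_kernel_gt0 //.
  by rewrite /gauss_kernel expRK /v /delta; field.
have cv : cvx (v : R^o -> R).
  apply: cvxD; first exact: (gY e e0).
  by move=> x y t _; rewrite le_eqVlt; apply/orP; left; apply/eqP; rewrite /GRing.scale /=; ring.
have le_p x : (0 <= v x + delta * x ^+ 2 / 2) = (rho x <= p x).
  by rewrite vE subr_ge0 ler_ln ?posrE.
have ge_p x : (v x + delta * x ^+ 2 / 2 <= 0) = (p x <= rho x).
  by rewrite vE subr_le0 ler_ln ?posrE.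
case: (cvx_crossing cPhi cv delta0) => [vge0|[c [s cs]]].
  rewrite E1E // E2E //; apply: ge0_le_integral_nonmeas => x.
    by rewrite lee_fin mulr_ge0 // ltW.
  by rewrite lee_fin ler_wpM2l // -le_p.
pose hp (x : R) := Num.max (c + s * x) 0; pose hn (x : R) := Num.max (- (c + s * x)) 0.
have hp0 x : 0 <= hp x by rewrite le_max lexx orbT.
have hn0 x : 0 <= hn x by rewrite le_max lexx orbT.
have chp : continuous hp by exact: continuous_affine_max.
have chn : continuous hn.
  rewrite /hn; under eq_fun do rewrite opprD -mulNr; exact: continuous_affine_max.
have [b E1n E1p] := smooth_pos_neg c s mY iY mE e0.
have [E2p E2n _] := normal_prob_pos_neg (c + s * m) (s * sg).
have E2' x : c + s * (m + sg * x) = c + s * m + s * sg * x by rewrite mulrDr mulrA addrA.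
set b' := fine _ in E2p E2n.
have {}E2p : E2 hp = (c + s * m + b')%:E.
  by rewrite -E2p; apply: eq_integral => x _; rewrite /hp E2'.
have {}E2n : E2 hn = b'%:E.
  by rewrite -E2n; apply: eq_integral => x _; rewrite /hn E2'.
have mp : measurable_fun setT p by exact: measurable_normal_pdf.
have mrho : measurable_fun setT rho.
  have mU := continuous_measurable_fun (cvx_continuous (gY e e0)).
  apply: measurable_funM => //.
  rewrite (_ : smooth P Y e = fun x =>
    expR (- ((- ln (smooth P Y e x) - k' * x ^+ 2 / 2) + k' * x ^+ 2 / 2))); last first.
    by apply/funext => x; rewrite subrK opprK lnK // posrE smooth_gt0.
  apply: measurableT_comp => //; apply: measurableT_comp => //; apply: measurable_funD => //.
  by apply: measurable_funM => //; apply: measurable_funM => //; exact: measurable_funX.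
have mprod G q : continuous G -> measurable_fun setT q ->
    measurable_fun setT (fun x : R => G x * q x).
  by move=> cG mq; apply: measurable_funM => //; exact: continuous_measurable_fun.
have sum3 (u1 u2 u3 : R -> R) : measurable_fun setT u1 -> measurable_fun setT u2 ->
    measurable_fun setT u3 -> (forall x, 0 <= u1 x) -> (forall x, 0 <= u2 x) ->
    (forall x, 0 <= u3 x) ->
    (\int[lebesgue_measure]_x (u1 x)%:E + (\int[lebesgue_measure]_x (u2 x)%:E +
     \int[lebesgue_measure]_x (u3 x)%:E) =
     \int[lebesgue_measure]_x (u1 x + (u2 x + u3 x))%:E)%E.
  move=> m1 m2 m3 u1_0 u2_0 u3_0.
  rewrite -ge0_integralD //; try by [exact/measurable_EFinP|move=> x _; rewrite lee_fin].
  rewrite -ge0_integralD //; try by [exact/measurable_EFinP|move=> x _; rewrite ?lee_fin ?addr_ge0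
    |apply: emeasurable_funD; exact/measurable_EFinP].
have q0 (G q : R -> R) x : (forall x, 0 <= G x) -> (forall x, 0 < q x) -> 0 <= G x * q x.
  by move=> G0 q0; rewrite mulr_ge0 // ltW.
(* All terms are placed on the side where they are nonnegative, so no infinite integral is
   subtracted; pointwise the difference is [(Phi - secant) * (p - rho)], whose factors have the same
   sign. *)
have key : (E1 Phi + (E2 hp + E1 hn) <= E2 Phi + (E1 hp + E2 hn))%E.
  rewrite !E1E // !E2E // !sum3 //; try by [exact: mprod|move=> x; exact: q0].
  apply: ge0_le_integral_nonmeas => x.
    by rewrite lee_fin !addr_ge0 // q0.
  rewrite lee_fin -subr_ge0.
  have -> : Phi x * p x + (hp x * rho x + hn x * p x) -
      (Phi x * rho x + (hp x * p x + hn x * rho x)) = (Phi x - (hp x - hn x)) * (p x - rho x).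
    by ring.
  have -> : hp x - hn x = c + s * x.
    by rewrite /hp /hn; case: (lerP (c + s * x) 0) => h1; case: (lerP (- (c + s * x)) 0) => h2; lra.
  case: (cs x) => -[]; rewrite ?le_p ?ge_p => h1 h2; last by rewrite mulr_ge0 // subr_ge0.
  by rewrite -mulrNN mulr_ge0 // oppr_ge0 subr_le0.
move: key; rewrite -/hp -/hn in E1n E1p; rewrite E2p E2n /E1 E1n E1p -/(E1 Phi).
rewrite -!EFinD [X in (_ <= _ + X%:E)%E](_ : _ = c + s * m + b' + b); last ring.
by rewrite leeD2rE.
Qed.

End ConvexOrder.

Section ConvexExamples.
Context {R : realType}.

Lemma cvx_powR_norm (p : R) : 1 <= p -> cvx (fun x : R^o => `|x : R| `^ p).
Proof.
move=> p1; have H (x y t : R) : 0 < t < 1 ->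
    `|t * x + (1 - t) * y| `^ p <= t * `|x| `^ p + (1 - t) * `|y| `^ p.
  move=> /andP[t0 t1]; have t1' : 0 <= 1 - t by rewrite subr_ge0 ltW.
  have := @convex_powR R p p1 (Itv01 (ltW t0) (ltW t1)) `|x| `|y|.
  rewrite !inE /= !in_itv /= !normr_ge0 => /(_ isT isT); apply: le_trans.
  apply: ge0_ler_powR; rewrite ?nnegrE //; first by rewrite (le_trans ler01).
    by rewrite addr_ge0 // mulr_ge0 // ltW.
  apply: le_trans (ler_normD _ _) _.
  by rewrite !normrM (gtr0_norm t0) (ger0_norm t1').
by move=> x y t; exact: H.
Qed.

Lemma cvx_expR_sqr (c : R) : 0 <= c -> cvx (fun x : R^o => expR (c * (x : R) ^+ 2)).
Proof.
move=> c0 x y t /andP[t0 t1].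
have := convex_expR (Itv01 (ltW t0) (ltW t1)) (c * (x : R) ^+ 2) (c * (y : R) ^+ 2).
apply: le_trans; rewrite ler_expR.
by have := cvxZ c0 (@cvx_sqr R) x y; apply; rewrite t0.
Qed.

End ConvexExamples.

(** * Moments of centered increments *)

Section GaussianIncrement.
Context d (T : measurableType d) (R : realType) (P : probability T R).
Variables (Y : T -> R) (m h : R).
Hypotheses (mY : measurable_fun setT Y) (iY : P.-integrable setT (EFin \o Y)).
Hypotheses (mE : (\int[P]_w (Y w)%:E = m%:E)%E) (h0 : 0 < h).
Hypothesis gY : forall e, 0 < e -> gcvx (h^-1 / (1 + h^-1 * e ^+ 2)) (smooth P Y e).

Lemma increment_moment (p : R) : 1 <= p ->
  (\int[P]_w (`|Y w - m| `^ p)%:E <= normal_abs_moment p * (h `^ (p / 2))%:E)%E.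
Proof.
move=> p1; have p0 : 0 < p by rewrite (lt_le_trans _ p1).
have H (r : R) : 1 < r ->
    (\int[P]_w (`|Y w - m| `^ p)%:E <= r%:E * (normal_abs_moment p * (h `^ (p / 2))%:E))%E.
  move=> r1; have r0 : 0 < r by rewrite (lt_trans _ r1).
  (* With this choice [sg] to the power [p] is [r] times [h] to the power [p / 2]: the strict gap
     above [h] costs only a factor [r], arbitrarily close to 1. *)
  pose sg := Num.sqrt h * r `^ p^-1.
  have sg0 : 0 < sg by rewrite mulr_gt0 ?sqrtr_gt0 ?powR_gt0.
  have sgh : h^-1^-1 < sg ^+ 2.
    rewrite invrK exprMn sqr_sqrtr ?(ltW h0) // ltr_pMr // exprn_egt1 //.
    by rewrite /powR gt_eqF // expR_gt1 mulr_gt0 ?invr_gt0 // ln_gt0.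
  have := @convex_order _ _ _ P Y m h^-1 sg _ mY iY mE _ gY sg0 sgh (cvx_powR_norm p1).
  rewrite invr_gt0 => /(_ h0 (fun=> powR_ge0 _ _)) /le_trans; apply.
  have sgp : sg `^ p = r * h `^ (p / 2).
    rewrite powRM ?sqrtr_ge0 ?powR_ge0 // -powR12_sqrt ?(ltW h0) // -!powRrM.
    by rewrite mulVf ?gt_eqF // powRr1 ?(ltW r0) // mulrC (mulrC p).
  under eq_integral do rewrite normrM (gtr0_norm sg0) powRM ?(ltW sg0) // EFinM.
  rewrite ge0_integralZl_nonmeas ?powR_gt0 //.
  by rewrite sgp EFinM -muleA [(normal_abs_moment p * _)%E]muleC.
have hp : 0 < h `^ (p / 2) by rewrite powR_gt0.
have N0 : (0 <= normal_abs_moment p)%E by apply: integral_ge0 => x _; rewrite lee_fin powR_ge0.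
(* An infinite Gaussian moment would make the bound trivial; for a finite one the excess [r - 1] is
   absorbed by an arbitrary [eps]. *)
case: (normal_abs_moment p) N0 H => [M|_ _|//]; last by rewrite gt0_mulye ?lte_fin // leey.
rewrite lee_fin => M0 H; apply/lee_addgt0Pr => eps e0.
pose a := M * h `^ (p / 2); have a0 : 0 <= a by rewrite mulr_ge0 // ltW.
have a1 : 0 < a + 1 by rewrite ltr_wpDl.
apply: le_trans (H (1 + eps / (a + 1)) _) _; first by rewrite ltrDl divr_gt0.
rewrite -!EFinM -EFinD lee_fin -/a mulrDl mul1r lerD2l mulrAC ler_pdivrMr //.
by rewrite ler_wpM2l ?(ltW e0) // lerDl.
Qed.

Lemma increment_expR_sqr : (\int[P]_w (expR ((Y w - m) ^+ 2 / (8 * h)))%:E <= 2%:E)%E.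
Proof.
(* The variance [2 * h] lies strictly above [h] and turns the exponent into [x ^+ 2 / 4], whose
   Gaussian integral is known. *)
pose sg := Num.sqrt (2 * h); have h2 : 0 < 2 * h by rewrite mulr_gt0.
have sg0 : 0 < sg by rewrite sqrtr_gt0.
have sgh : h^-1^-1 < sg ^+ 2 by rewrite invrK sqr_sqrtr ?(ltW h2) // mulr_natl mulr2n ltrDl.
have c0 : 0 <= (8 * h)^-1 by rewrite invr_ge0 mulr_ge0 // ltW.
have := @convex_order _ _ _ P Y m h^-1 sg _ mY iY mE _ gY sg0 sgh (cvx_expR_sqr c0).
rewrite invr_gt0 => /(_ h0 (fun=> expR_ge0 _)).
under eq_integral do rewrite mulrC.
move=> /le_trans; apply; apply: (@le_trans _ _ (Num.sqrt 2 : R)%:E).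
  rewrite -normal_prob_expR_sqr le_eqVlt; apply/orP; left; apply/eqP.
  apply: eq_integral => x _; congr (expR _)%:E.
  by rewrite exprMn sqr_sqrtr ?(ltW h2) //; field; rewrite gt_eqF.
rewrite lee_fin -[leRHS]gtr0_norm // -sqrtr_sqr ler_sqrt ?exprn_ge0 //.
by rewrite expr2 mulr_natl mulr2n lerDl.
Qed.

End GaussianIncrement.

Section ClassIncrements.
Context d (T : measurableType d) (R : realType) (P : probability T R).
Variables (Lam : set int) (I : set R) (L : {RV P >-> cborel (Lam `*` I)}) (j : int).
Hypotheses (LC : class_LC L) (Lj : Lam j).

Lemma lineval_RV_measurable t : I t -> measurable_fun setT (fun w => lineval (L w) j t).
Proof. by move=> It; apply: (measurableT_comp (lineval_measurable _)). Qed.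

(** The case [c = false], [k = 0], [e = 1] of [class_gcvx]: log-concavity of the smoothed law of a
    single value. *)
Lemma lineval_integrable t : I t -> P.-integrable setT (fun w => (lineval (L w) j t)%:E).
Proof.
move=> It; apply: gcvx_integrable; first exact: lineval_RV_measurable.
have := @class_gcvx _ _ _ P Lam I L j false t t 0 1 LC Lj It It ltr01 (or_introl erefl).
rewrite mul0r /smooth; under eq_fun do under eq_integral do rewrite mul0r subr0.
by [].
Qed.

Lemma line_meanE t : I t -> (\int[P]_w (lineval (L w) j t)%:E = (line_mean L j t)%:E)%E.
Proof.
move=> It; rewrite /line_mean unlock fineK //; apply: integrable_fin_num => //.
exact: lineval_integrable.
Qed.

Section Increment.
Variables (t u : R).
Hypotheses (It : I t) (Iu : I u) (ut : u < t).
Let Y w := lineval (L w) j t - lineval (L w) j u.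
Let m := line_mean L j t - line_mean L j u.

Let mY : measurable_fun setT Y.
Proof. by apply: measurable_funB; exact: lineval_RV_measurable. Qed.

Let iY : P.-integrable setT (EFin \o Y).
Proof.
rewrite (_ : EFin \o Y = fun w => ((lineval (L w) j t)%:E - (lineval (L w) j u)%:E)%E); last first.
  by apply/funext => w; rewrite /= EFinB.
by apply: integrableB => //; exact: lineval_integrable.
Qed.

Let mE : (\int[P]_w (Y w)%:E = m%:E)%E.
Proof.
under eq_integral do rewrite EFinB.
by rewrite integralB //; try exact: lineval_integrable; rewrite !line_meanE.
Qed.

Let gY e : 0 < e -> gcvx ((t - u)^-1 / (1 + (t - u)^-1 * e ^+ 2)) (smooth P Y e).
Proof.
move=> e0; have := @class_gcvx _ _ _ P Lam I L j true t u (t - u)^-1 e LC Lj It Iu e0.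
rewrite /smooth /Y; under eq_fun do under eq_integral do rewrite mul1r.
by apply; right.
Qed.

Let centeredE w : centered L j t w - centered L j u w = Y w - m.
Proof. by rewrite /centered /Y /m opprD opprK addrACA opprD opprK. Qed.

Lemma centered_increment_moment (p : R) : 1 <= p ->
  (\int[P]_w (`|centered L j t w - centered L j u w| `^ p)%:E <=
   normal_abs_moment p * ((t - u) `^ (p / 2))%:E)%E.
Proof.
move=> p1; under eq_integral do rewrite centeredE.
by apply: increment_moment => //; rewrite subr_gt0.
Qed.

Lemma centered_increment_expR_sqr :
  (\int[P]_w (expR ((centered L j t w - centered L j u w) ^+ 2 / (8 * (t - u))))%:E
   <= 2%:E)%E.
Proof.
under eq_integral do rewrite centeredE.
by apply: increment_expR_sqr => //; rewrite subr_gt0.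
Qed.

End Increment.

Lemma centered_moment t s (p : R) : I t -> I s -> 1 <= p ->
  (\int[P]_w (`|centered L j t w - centered L j s w| `^ p)%:E <=
   normal_abs_moment p * (`|t - s| `^ (p / 2))%:E)%E.
Proof.
move=> It Is p1; case: (ltrgtP t s) => [ts|st|->].
- under eq_integral do rewrite distrC.
  exact: centered_increment_moment.
- exact: centered_increment_moment.
- have p0 : 0 < p by rewrite (lt_le_trans _ p1).
  rewrite integral0_eq; first by rewrite mule_ge0 ?lee_fin ?powR_ge0 //;
    apply: integral_ge0 => x _; rewrite lee_fin powR_ge0.
  by move=> w _; rewrite subrr normr0 powR0 // gt_eqF.
Qed.

End ClassIncrements.

(** * Chaining *)

Section DyadicPoints.
Context {R : realType} (a b : R).
Hypothesis ab : a < b.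

Definition dyadic (n k : nat) : R := a + (b - a) * (k%:R / 2 ^+ n).

Definition dyadic_index (n : nat) (t : R) : nat := Num.truncn (2 ^+ n * ((t - a) / (b - a))).

Definition dyadic_floor (n : nat) (t : R) : R := dyadic n (dyadic_index n t).

Let D0 : 0 < b - a. Proof. by rewrite subr_gt0. Qed.

Lemma dyadic_index_itv n t : a <= t ->
  (dyadic_index n t)%:R <= 2 ^+ n * ((t - a) / (b - a)) < (dyadic_index n t).+1%:R.
Proof.
move=> ta; apply: truncn_itv; rewrite mulr_ge0 ?exprn_ge0 // divr_ge0 ?subr_ge0 //.
exact: ltW.
Qed.

Lemma dyadic_index_le n t : a <= t <= b -> (dyadic_index n t <= 2 ^ n)%N.
Proof.
move=> /andP[ta tb]; have /andP[h _] := dyadic_index_itv n ta.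
rewrite -(ler_nat R) natrX (le_trans h) // -[leRHS]mulr1 ler_wpM2l ?exprn_ge0 //.
by rewrite ler_pdivrMr // mul1r lerB.
Qed.

Lemma dyadic_itv n k : (k <= 2 ^ n)%N -> a <= dyadic n k <= b.
Proof.
move=> kn; have k0 : 0 <= k%:R / 2 ^+ n :> R by rewrite divr_ge0 // exprn_ge0.
have k1 : k%:R / 2 ^+ n <= 1 :> R by rewrite ler_pdivrMr ?exprn_gt0 // mul1r -natrX ler_nat.
rewrite lerDl mulr_ge0 ?(ltW D0) //= -lerBrDl -[leRHS]mulr1 ler_wpM2l //; exact: ltW.
Qed.

Lemma dyadic_floor_itv n t : a <= t <= b -> a <= dyadic_floor n t <= b.
Proof. by move=> tab; apply/dyadic_itv/dyadic_index_le. Qed.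

Lemma dyadic_double n k : dyadic n.+1 k.*2 = dyadic n k.
Proof. by rewrite /dyadic -muln2 natrM exprS; field; rewrite expf_neq0. Qed.

Lemma dyadic_floor_dist n t : a <= t -> `|dyadic_floor n t - t| <= (b - a) / 2 ^+ n.
Proof.
move=> ta; have /andP[h1 h2] := dyadic_index_itv n ta.
have n0 : 0 < 2 ^+ n :> R by rewrite exprn_gt0.
have tE : t = a + (b - a) * ((2 ^+ n * ((t - a) / (b - a))) / 2 ^+ n).
  by field; rewrite !gt_eqF.
rewrite [X in _ - X]tE /dyadic_floor /dyadic opprD addrACA subrr add0r -mulrBr -mulrBl.
rewrite normrM (gtr0_norm D0) ler_wpM2l ?(ltW D0) // normrM (gtr0_norm (x := _^-1)) ?invr_gt0 //.
rewrite -[leRHS]mul1r ler_wpM2r ?invr_ge0 ?(ltW n0) // ler0_norm ?subr_le0 // opprB.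
by rewrite lerBlDl natr1 ltW.
Qed.

Lemma dyadic_floor_cvg t : a <= t -> dyadic_floor n t @[n --> \oo] --> t.
Proof.
move=> ta; apply/cvgrPdist_le => e e0.
have h2 : `|2^-1 : R| < 1 by rewrite ger0_norm ?invr_ge0 // invf_lt1 // ltr1n.
have /cvgrPdist_le/(_ e e0) := cvg_geometric (b - a) h2.
apply: filterS => n; rewrite sub0r normrN /geometric /= exprVn ger0_norm; last first.
  by rewrite mulr_ge0 ?invr_ge0 ?exprn_ge0 // ltW.
by rewrite distrC; apply: le_trans; exact: dyadic_floor_dist.
Qed.

End DyadicPoints.

Section Chaining.
Context {R : realType}.
Implicit Types (a b : R).

(* Up to a constant, [rate n] bounds the increments at level [n] and decays geometrically, so
   the chain from level [n] on is dominated by its first term. *)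
Let rate (n : nat) : R := Num.sqrt (n.+1%:R / 2 ^+ n).

Let rate0 n : 0 <= rate n. Proof. exact: sqrtr_ge0. Qed.

Let rate_sqr n : rate n ^+ 2 = n.+1%:R / 2 ^+ n.
Proof. by rewrite sqr_sqrtr // divr_ge0 // exprn_ge0. Qed.

Let rateS n : rate n.+1 <= rate n.
Proof.
rewrite ler_sqrt ?divr_ge0 ?exprn_ge0 // exprS invfM mulrA ler_wpM2r ?invr_ge0 ?exprn_ge0 //.
by rewrite ler_pdivrMr // -natrM ler_nat muln2 -addnn addnS ltnS leq_addr.
Qed.

(** The squared ratio is [(n + 3) / (2 * (n + 2)) <= 3 / 4 < (7 / 8) ^ 2]. The decay starts at level
    1 because [rate 0 = rate 1]. *)
Let rateSS n : rate n.+2 <= 7 / 8 * rate n.+1.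
Proof.
rewrite -ler_sqr ?nnegrE ?mulr_ge0 // exprMn !rate_sqr exprS invfM !mulrA.
rewrite ler_wpM2r ?invr_ge0 ?exprn_ge0 //.
have : 0 <= n%:R :> R by [].
by rewrite -(natr1 n.+2) -(natr1 n.+1) -(natr1 n); lra.
Qed.

Lemma dyadic_scale (h : R) : 0 < h -> h <= 1 ->
  exists n : nat, (2 ^+ n.+1)^-1 < h <= (2 ^+ n)^-1.
Proof.
move=> h0 h1; have ex : exists n, (2 ^+ n.+1)^-1 < h.
  exists (Num.truncn h^-1); rewrite invf_plt ?posrE ?exprn_gt0 //.
  apply: lt_le_trans (truncnS_gt _) _; rewrite -natrX ler_nat; exact/ltnW/ltn_expl.
case: (ex_minnP ex) => n nh nmin; exists n; rewrite nh /=.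
case: n nh nmin => [|n] nh nmin; first by rewrite expr0 invr1.
by rewrite leNgt; apply/negP => /nmin; rewrite ltnn.
Qed.

Lemma ln2_itv : 2^-1 <= ln (2 : R) <= 1.
Proof.
apply/andP; split; last by apply: (le_trans (le_ln1Dx (x := 1) _)).
have := @le_ln1Dx R (- 2^-1); rewrite ltrN2 invf_lt1 ?ltr1n // => /(_ isT).
by rewrite (_ : 1 - 2^-1 = 2^-1 :> R) ?lnV ?posrE // ?lerN2 //; lra.
Qed.

Section Increments.
Variables (a b : R) (z : R -> R) (Z : R).
Hypotheses (ab : a < b) (Z1 : 1 <= Z).
Hypothesis zZ : forall n k, (k < 2 ^ n)%N ->
  expR ((z (dyadic a b n k.+1) - z (dyadic a b n k)) ^+ 2 * 2 ^+ n / (8 * (b - a)))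
  <= 4 ^+ n * Z.
Hypothesis zcvg : forall t, a <= t <= b -> z (dyadic_floor a b n t) @[n --> \oo] --> z t.

Let D0 : 0 < b - a. Proof. by rewrite subr_gt0. Qed.
Let lam := 1 + ln Z.
Let lam1 : 1 <= lam. Proof. by rewrite lerDl ln_ge0. Qed.
Let A := Num.sqrt (16 * (b - a) * lam).
Let A2 : A ^+ 2 = 16 * (b - a) * lam.
Proof. by rewrite sqr_sqrtr // !mulr_ge0 ?(ltW D0) // (le_trans ler01). Qed.

(** After taking logarithms, the squared increment is at most [8 * (b - a) / 2 ^ n] times
    [n * ln 4 + ln Z <= 2 * (n + 1) * lam]; hence the 16 in [A]. *)
Let increment n k : (k < 2 ^ n)%N ->
  `|z (dyadic a b n k.+1) - z (dyadic a b n k)| <= A * rate n.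
Proof.
move=> kn; have := zZ kn; set x := _ - _ => xZ.
rewrite -ler_sqr ?nnegrE ?mulr_ge0 ?sqrtr_ge0 // exprMn A2 rate_sqr real_normK ?num_real //.
have n0 : 0 < 2 ^+ n :> R by rewrite exprn_gt0.
have Z0 : 0 < Z by rewrite (lt_le_trans ltr01).
have /andP[_ ln2] := ln2_itv.
have : x ^+ 2 * 2 ^+ n / (8 * (b - a)) <= 2 * n.+1%:R * lam.
  rewrite -ler_expR (le_trans xZ) // -[leLHS]lnK ?posrE ?mulr_gt0 ?exprn_gt0 // ler_expR.
  rewrite lnM ?posrE ?exprn_gt0 // lnXn // (_ : 4 = 2 * 2 :> R); last by rewrite -natrM.
  rewrite lnM ?posrE // -[_ *+ n]mulr_natl.
  have : 0 <= ln Z by rewrite ln_ge0.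
  have : 0 <= n%:R :> R by [].
  by rewrite /lam -(natr1 n); nra.
rewrite ler_pdivrMr ?mulr_gt0 // -ler_pdivlMr // => /le_trans; apply.
by rewrite le_eqVlt; apply/orP; left; apply/eqP; field; rewrite gt_eqF.
Qed.

(** The floors at levels [N] and [N + 1] coincide or are one step of level [N + 1] apart. Writing
    the bound as a difference of rates makes the geometric sum telescope. *)
Let chain t n N : a <= t <= b -> (n <= N)%N ->
  `|z (dyadic_floor a b N t) - z (dyadic_floor a b n t)| <= 8 * A * (rate n.+1 - rate N.+1).
Proof.
move=> tab; have /andP[ta _] := tab; elim: N => [|N IH].
  by rewrite leqn0 => /eqP ->; rewrite !subrr normr0 mulr0.
rewrite leq_eqVlt => /orP[/eqP ->|]; first by rewrite !subrr normr0 mulr0.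
rewrite ltnS => nN; apply: le_trans (ler_distD (z (dyadic_floor a b N t)) _ _) _.
have -> : 8 * A * (rate n.+1 - rate N.+2) =
  8 * A * (rate N.+1 - rate N.+2) + 8 * A * (rate n.+1 - rate N.+1) by ring.
apply: lerD; last exact: IH.
(* The ratio [7 / 8] of [rateSS] gives the factor [8 = 1 / (1 - 7 / 8)]. *)
have rr : rate N.+1 <= 8 * (rate N.+1 - rate N.+2) by have := rateSS N; lra.
rewrite mulrAC; apply: (@le_trans _ _ (rate N.+1 * A)); last by rewrite ler_wpM2r // sqrtr_ge0.
rewrite mulrC; have /andP[h1 h2] := dyadic_index_itv ab N ta.
have /andP[h3 h4] := dyadic_index_itv ab N.+1 ta.
set k := dyadic_index a b N t in h1 h2 *; set k' := dyadic_index a b N.+1 t in h3 h4 *.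
move: h3 h4; rewrite exprS -mulrA => h3 h4.
have kk1 : (k.*2 < k'.+1)%N by rewrite -(ltr_nat R) -muln2 natrM; move: h1 h4; lra.
have kk2 : (k' < k.+1.*2)%N by rewrite -(ltr_nat R) -muln2 natrM; move: h2 h3; lra.
have kN : (k' <= 2 ^ N.+1)%N by exact: dyadic_index_le.
have [kE|kE] : k' = k.*2 \/ k' = k.*2.+1 by move: kk1 kk2; clear; lia.
  by rewrite /dyadic_floor -/k -/k' kE dyadic_double subrr normr0 mulr_ge0 // sqrtr_ge0.
by rewrite /dyadic_floor -/k -/k' -(dyadic_double a b N k) kE; apply: increment; rewrite -kE.
Qed.

Let chain_limit t n : a <= t <= b -> `|z t - z (dyadic_floor a b n t)| <= 8 * A * rate n.
Proof.
move=> tab; apply/ler_addgt0Pr => e e0.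
have /cvgrPdist_le/(_ e e0)[N _ HN] := zcvg tab.
have := HN _ (leq_maxl N n); have := chain tab (leq_maxr N n).
set y := z (dyadic_floor a b _ t) => h1 h2.
apply: le_trans (ler_distD y _ _) _; rewrite addrC lerD // (le_trans h1) //.
rewrite ler_wpM2l ?mulr_ge0 ?sqrtr_ge0 //.
by rewrite lerBlDr (le_trans (rateS n)) // lerDl.
Qed.

(** At distance at most one mesh width the two floors are equal or adjacent, so a single increment
    joins them. *)
Let chain_same n t s : a <= s -> s <= t -> t <= b -> (t - s) / (b - a) <= (2 ^+ n)^-1 ->
  `|z (dyadic_floor a b n t) - z (dyadic_floor a b n s)| <= A * rate n.
Proof.
move=> sa st tb h; have ta := le_trans sa st; have n0 : 0 < 2 ^+ n :> R by rewrite exprn_gt0.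
have /andP[h1 h2] := dyadic_index_itv ab n ta.
have /andP[h3 h4] := dyadic_index_itv ab n sa.
have kt : (dyadic_index a b n t <= 2 ^ n)%N by apply: dyadic_index_le => //; rewrite ta.
rewrite /dyadic_floor; move: (dyadic_index a b n t) (dyadic_index a b n s) h1 h2 h3 h4 kt.
move=> k k' h1 h2 h3 h4 kt.
have tsE : 2 ^+ n * ((t - a) / (b - a)) = 2 ^+ n * ((s - a) / (b - a)) +
  2 ^+ n * ((t - s) / (b - a)) by field; rewrite gt_eqF.
have ts0 : 0 <= 2 ^+ n * ((t - s) / (b - a)).
  by rewrite mulr_ge0 ?(ltW n0) // divr_ge0 ?(ltW D0) // subr_ge0.
have ts1 : 2 ^+ n * ((t - s) / (b - a)) <= 1 by rewrite mulrC -ler_pdivlMr // mul1r.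
have kk1 : (k' < k.+1)%N by rewrite -(ltr_nat R); move: h2 h3; rewrite tsE; lra.
have kk2 : (k < k'.+2)%N.
  by rewrite -(ltr_nat R) -(natr1 k'.+1); move: h1 h4; rewrite tsE; lra.
have [->|kE] : k = k' \/ k = k'.+1 by move: kk1 kk2; clear; lia.
  by rewrite subrr normr0 mulr_ge0 // sqrtr_ge0.
by rewrite kE; apply: increment; rewrite -kE.
Qed.

Let chaining_lt t s : a <= s -> s < t -> t <= b ->
  `|z t - z s| <= 136 * Num.sqrt lam * levy_modulus a b (t - s).
Proof.
move=> sa st tb; pose h := (t - s) / (b - a).
have h0 : 0 < h by rewrite divr_gt0 ?subr_gt0.
have h1 : h <= 1 by rewrite ler_pdivrMr // mul1r lerB.
have [n /andP[nh hn]] := dyadic_scale h0 h1.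
have n0 : 0 < 2 ^+ n :> R by rewrite exprn_gt0.
have tsE : t - s = h * (b - a) by rewrite divfK // gt_eqF.
have tab : a <= t <= b by rewrite tb (le_trans sa (ltW st)).
have sab : a <= s <= b by rewrite sa (le_trans (ltW st) tb).
(* [17 = 8 + 1 + 8]: two chains and one step at level [n]. *)
apply: (@le_trans _ _ (17 * A * rate n)).
  apply: le_trans (ler_distD (z (dyadic_floor a b n t)) _ _) _.
  have -> : 17 * A * rate n = 8 * A * rate n + (A * rate n + 8 * A * rate n) by ring.
  apply: lerD; first exact: chain_limit.
  apply: le_trans (ler_distD (z (dyadic_floor a b n s)) _ _) _.
  apply: lerD; first by apply: chain_same => //; exact: ltW.
  by rewrite distrC; exact: chain_limit.
have lam0 : 0 < lam by rewrite (lt_le_trans ltr01).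
(* From [h <= 1 / 2 ^ n] and [ln 2 >= 1 / 2]: the logarithm in the modulus grows like the level. *)
have ln0 : n.+1%:R * 2^-1 <= ln (2 * (b - a) / (t - s)).
  have -> : 2 * (b - a) / (t - s) = 2 / h by rewrite tsE; field; rewrite !gt_eqF.
  apply: (@le_trans _ _ (ln (2 ^+ n.+1))).
    by rewrite lnXn // -[leRHS]mulr_natl ler_wpM2l //; case/andP: ln2_itv.
  have p0 : 0 < 2 ^+ n.+1 :> R by rewrite exprn_gt0.
  have q0 : 0 < 2 / h by rewrite divr_gt0.
  by rewrite ler_ln ?posrE // exprS ler_wpM2l // -[leLHS]invrK lef_pV2 ?posrE ?invr_gt0.
rewrite /levy_modulus -ler_sqr ?nnegrE; last 2 first.
- by rewrite !mulr_ge0 // sqrtr_ge0.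
- by rewrite !mulr_ge0 // sqrtr_ge0.
have ts0 : 0 < t - s by rewrite subr_gt0.
have L0 : 0 <= ln (2 * (b - a) / (t - s)) by rewrite (le_trans _ ln0) // divr_ge0.
have TL0 : 0 <= (t - s) * ln (2 * (b - a) / (t - s)) by rewrite mulr_ge0 // ltW.
rewrite !exprMn A2 rate_sqr !sqr_sqrtr ?(ltW lam0) //.
(* Passing to [2 ^ (n + 1)] and to [(n + 1) / 2] costs a factor 4, and
   [17 ^ 2 * 16 * 4 = 136 ^ 2]. *)
have -> : 17 ^+ 2 * (16 * (b - a) * lam) * (n.+1%:R / 2 ^+ n) =
    136 ^+ 2 * lam * ((2 ^+ n.+1)^-1 * (b - a) * (n.+1%:R * 2^-1)).
  by rewrite [2 ^+ n.+1]exprS; field; rewrite gt_eqF.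
have c0 : 0 <= 136 ^+ 2 * lam by rewrite mulr_ge0 ?sqr_ge0 // ltW.
apply: ler_wpM2l => //; apply: ler_pM => //.
- by rewrite mulr_ge0 ?(ltW D0) // invr_ge0 exprn_ge0.
- by rewrite tsE ler_wpM2r ?(ltW D0) // ltW.
Qed.

Lemma chaining t s : a <= t <= b -> a <= s <= b -> t != s ->
  `|z t - z s| <= 136 * Num.sqrt (1 + ln Z) * levy_modulus a b `|t - s|.
Proof.
move=> /andP[ta tb] /andP[sa sb]; rewrite neq_lt => /orP[ts|st]; last first.
  by rewrite [`|t - s|]gtr0_norm ?subr_gt0 //; exact: chaining_lt.
by rewrite distrC [`|t - s|]ltr0_norm ?subr_lt0 // opprB; exact: chaining_lt.
Qed.

End Increments.
End Chaining.

Section Modulus.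
Context {R : realType}.

Lemma levy_modulus_gt0 (a b h : R) : a < b -> 0 < h <= b - a -> 0 < levy_modulus a b h.
Proof.
move=> ab /andP[h0 hD]; rewrite sqrtr_gt0 mulr_gt0 // ln_gt0 // ltr_pdivlMr // mul1r.
by rewrite (le_lt_trans hD) // mulr_natl mulr2n ltrDl subr_gt0.
Qed.

Lemma dist_itv (a b t s : R) : a <= t <= b -> a <= s <= b -> t != s ->
  0 < `|t - s| <= b - a.
Proof.
move=> /andP[ta tb] /andP[sa sb] ts; rewrite normr_gt0 subr_eq0 ts /=.
by rewrite ler_norml; apply/andP; split; lra.
Qed.

Lemma levy_modulus_cvg (a b h : R) : a < b -> 0 < h ->
  levy_modulus a b x @[x --> h] --> levy_modulus a b h.
Proof.
move=> ab h0; have c1 : 2 * (b - a) / x @[x --> h] --> 2 * (b - a) / h.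
  by apply: cvgMr; apply: cvgV; [rewrite gt_eqF|exact: cvg_id].
have c2 : ln (2 * (b - a) / x) @[x --> h] --> ln (2 * (b - a) / h).
  apply: (cvg_comp _ (@ln R) c1); apply: continuous_ln.
  by rewrite divr_gt0 // mulr_gt0 // subr_gt0.
have c3 : x * ln (2 * (b - a) / x) @[x --> h] --> h * ln (2 * (b - a) / h).
  by apply: cvgM => //; exact: cvg_id.
exact: (cvg_comp _ Num.sqrt c3 (@sqrt_continuous R _)).
Qed.

(* The ratio is jointly continuous off the diagonal, so dyadic pairs suffice. *)
Lemma modulus_ratio_gtP (a b K : R) (z : R -> R) : a < b ->
  (forall t, a <= t <= b -> z (dyadic_floor a b n t) @[n --> \oo] --> z t) ->
  (K%:E < modulus_ratio a b (levy_modulus a b) z)%E <->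
  exists n k l : nat, [/\ (k <= 2 ^ n)%N, (l <= 2 ^ n)%N,
    dyadic a b n k != dyadic a b n l &
    K < `|z (dyadic a b n k) - z (dyadic a b n l)|
      / levy_modulus a b `|dyadic a b n k - dyadic a b n l| ].
Proof.
move=> ab zc; split; last first.
  move=> [n [k [l [kn ln kl Kr]]]]; rewrite -lte_fin in Kr; apply: (lt_le_trans Kr).
  apply: ereal_sup_ubound; exists (dyadic a b n k), (dyadic a b n l).
  by split=> //; rewrite in_itv /=; exact: dyadic_itv.
move=> /ereal_sup_gt[_ [t [s [+ + ts ->]]]]; rewrite !in_itv /= => tab sab.
rewrite lte_fin => Kr; have /andP[ts0 tsD] := dist_itv tab sab ts.
pose r n := `|z (dyadic_floor a b n t) - z (dyadic_floor a b n s)|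
  / levy_modulus a b `|dyadic_floor a b n t - dyadic_floor a b n s|.
have cdist : `|dyadic_floor a b n t - dyadic_floor a b n s| @[n --> \oo] --> `|t - s|.
  apply: cvg_norm; apply: cvgB; apply: dyadic_floor_cvg => //.
    by case/andP: tab.
  by case/andP: sab.
have cr : r n @[n --> \oo] --> `|z t - z s| / levy_modulus a b `|t - s|.
  apply: cvgM; first by apply: cvg_norm; apply: cvgB; exact: zc.
  apply: cvgV; first by rewrite gt_eqF // levy_modulus_gt0 // ts0.
  exact: (cvg_comp _ (levy_modulus a b) cdist (levy_modulus_cvg ab ts0)).
have [N1 _ H1] := cvgr_gt _ cr _ Kr; have [N2 _ H2] := cvgr_gt _ cdist _ ts0.
pose N := maxn N1 N2; have := H1 N (leq_maxl _ _); have := H2 N (leq_maxr _ _).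
rewrite /= normr_gt0 subr_eq0 => neq Kr'.
exists N, (dyadic_index a b N t), (dyadic_index a b N s); split=> //; exact: dyadic_index_le.
Qed.

Lemma ln_le_powR (v delta : R) : 1 <= v -> 0 < delta ->
  ln (2 * v) <= v `^ delta * (1 + delta^-1).
Proof.
move=> v1 d0; have v0 : 0 < v by rewrite (lt_le_trans ltr01).
have /andP[_ ln2] := @ln2_itv R.
rewrite lnM ?posrE // mulrDr mulr1; apply: lerD.
  apply: (le_trans ln2); rewrite /powR gt_eqF // -[leLHS]expR0 ler_expR.
  by rewrite mulr_ge0 ?(ltW d0) // ln_ge0.
rewrite ler_pdivlMr // mulrC -ln_powR; apply/ltW/ln_sublinear; exact: powR_gt0.
Qed.

(** With [v = (b - a) / h], the squared ratio is [ln (2 * v)] times the power [1 - 2 * alpha] of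
    [h]; bounding the logarithm by the same power of [v] trades [h] for [b - a]. *)
Lemma levy_holder (a b alpha h : R) : a < b -> 0 < h <= b - a -> alpha < 1 / 2 ->
  levy_modulus a b h / h `^ alpha <=
  (b - a) `^ (1 / 2 - alpha) * Num.sqrt (1 + (1 - 2 * alpha)^-1).
Proof.
move=> ab /andP[h0 hD] al; have D0 : 0 < b - a by rewrite subr_gt0.
have d0 : 0 < 1 - 2 * alpha by lra.
have c0 : 0 <= 1 + (1 - 2 * alpha)^-1 by rewrite addr_ge0 // invr_ge0 ltW.
have sq (x r : R) : (x `^ r) ^+ 2 = x `^ (r * 2).
  by rewrite -powR_mulrn ?powR_ge0 // powRrM.
have v1 : 1 <= (b - a) / h by rewrite ler_pdivlMr // mul1r.
have hE : h = h `^ (1 - 2 * alpha) * h `^ (alpha * 2).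
  rewrite -powRD; last by rewrite (gt_eqF h0) implybT.
  by rewrite mulrC subrK powRr1 // ltW.
have DE : (b - a) `^ (1 - 2 * alpha) = h `^ (1 - 2 * alpha) * ((b - a) / h) `^ (1 - 2 * alpha).
  by rewrite -powRM ?(ltW h0) ?divr_ge0 ?(ltW D0) ?(ltW h0) // (mulrC h) divfK // gt_eqF.
have L0 : 0 <= h * ln (2 * (b - a) / h).
  rewrite mulr_ge0 ?(ltW h0) // ln_ge0 // -mulrA (le_trans v1) // ler_peMl ?ler1n //.
  by rewrite (le_trans ler01).
rewrite ler_pdivrMr ?powR_gt0 // -ler_sqr ?nnegrE ?sqrtr_ge0 ?mulr_ge0 ?powR_ge0 ?sqrtr_ge0 //.
rewrite !exprMn !sq !sqr_sqrtr // (_ : (1 / 2 - alpha) * 2 = 1 - 2 * alpha); last by field.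
apply: (@le_trans _ _ (h * (((b - a) / h) `^ (1 - 2 * alpha) * (1 + (1 - 2 * alpha)^-1)))).
  by rewrite ler_wpM2l ?(ltW h0) // -[2 * _ / _]mulrA; exact: ln_le_powR.
rewrite DE [X in X * (_ * _)]hE le_eqVlt; apply/orP; left; apply/eqP.
by rewrite -!mulrA; congr (_ * _); rewrite mulrC -!mulrA.
Qed.

End Modulus.

(** * Moduli of continuity *)

Section CenteredPaths.
Context d (T : measurableType d) (R : realType) (P : probability T R).
Variables (Lam : set int) (I : set R) (L : {RV P >-> cborel (Lam `*` I)}) (j : int).
Hypotheses (LC : class_LC L) (Lj : Lam j).

Let mL t : I t -> measurable_fun setT (fun w => lineval (L w) j t).
Proof. exact: lineval_RV_measurable. Qed.

Lemma centered_measurable t : I t -> measurable_fun setT (centered L j t).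
Proof. by move=> It; apply: measurable_funB => //; exact: mL. Qed.

Lemma lineval_cvg (t_ : R^nat) t w : (forall n, I (t_ n)) -> I t ->
  t_ @ \oo --> t -> lineval (L w) j (t_ n) @[n --> \oo] --> lineval (L w) j t.
Proof.
move=> It_ It tt.
have /subspace_continuousP/(_ t It) cL := @lineval_path_continuous R Lam I (L w) j Lj.
apply: (cvg_comp _ (lineval (L w) j) _ cL) => A /tt tA.
by have : \forall n \near \oo, A (t_ n) by exact: filterS (fun n h => h (It_ n)) tA.
Qed.

(* The mean is deterministic, so it suffices that [min(|M(t_n) - M(t)|, 1)] is at most
   [E min(|L(t_n) - L(t)|, 1) + E |centered increment|], which tends to 0. *)
Lemma line_mean_cvg (t_ : R^nat) t : (forall n, I (t_ n)) -> I t ->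
  t_ @ \oo --> t -> line_mean L j (t_ n) @[n --> \oo] --> line_mean L j t.
Proof.
move=> It_ It tt; pose X n w := lineval (L w) j (t_ n) - lineval (L w) j t.
pose c n w := centered L j (t_ n) w - centered L j t w.
have mX n : measurable_fun setT (X n) by apply: measurable_funB; exact: mL.
have mc n : measurable_fun setT (c n) by apply: measurable_funB; exact: centered_measurable.
have mmin n : measurable_fun setT (fun w => (Num.min `|X n w| 1)%:E).
  by apply/measurable_EFinP; apply: measurable_minr => //; exact: measurableT_comp.
have mabs n : measurable_fun setT (fun w => `|c n w|%:E).
  by apply/measurable_EFinP; exact: measurableT_comp.
have N1 : (normal_abs_moment (1 : R) < +oo)%E.
  apply: le_lt_trans (@normal_prob_abs_lty R); apply: ge0_le_integral_nonmeas => x.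
    by rewrite lee_fin powR_ge0.
  by rewrite powRr1.
have N0 : (0 <= normal_abs_moment (1 : R))%E.
  by apply: integral_ge0 => x _; rewrite lee_fin powR_ge0.
have [M M0 NM] : exists2 M : R, 0 <= M & normal_abs_moment (1 : R) = M%:E.
  by move: N0 N1; case: (normal_abs_moment (1 : R)) => [M|//|//] M0 _; exists M.
have cXw w : (Num.min `|X n w| 1) @[n --> \oo] --> (0 : R).
  have : `|X n w| @[n --> \oo] --> (0 : R).
    rewrite -[X in _ --> X](normr0 R); apply: cvg_norm.
    rewrite -(subrr (lineval (L w) j t)); apply: cvgB; last exact: cvg_cst.
    exact: lineval_cvg.
  move=> cX; apply: (squeeze_cvgr _ (cvg_cst (0 : R)) cX); apply: nearW => n.
  by rewrite le_min normr_ge0 ler01 /= ge_min lexx.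
have e0 : (\int[P]_w (Num.min `|X n w| 1)%:E)%E @[n --> \oo] --> 0%E.
  rewrite -[X in _ --> X](integral_cst_probability P 0).
  apply: (@dominated_cvg _ _ _ P setT _ _ _ (cst 1%E)) => //.
  - by move=> w _; apply: cvg_EFin; [exact: nearW|exact: cXw].
  - exact: finite_measure_integrable_cst.
  - move=> n w _; rewrite /= lee_fin ger0_norm; first by rewrite ge_min lexx orbT.
    by rewrite le_min normr_ge0 ler01.
have /fine_cvgP[efin e0'] := e0.
have cc n : (\int[P]_w `|c n w|%:E <= (M * Num.sqrt `|t_ n - t|)%:E)%E.
  have := centered_moment LC Lj (It_ n) It (lexx 1); rewrite NM -EFinM div1r powR12_sqrt //.
  by under eq_integral do rewrite powRr1 //.
have c0 : M * Num.sqrt `|t_ n - t| @[n --> \oo] --> (0 : R).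
  have n0 : `|t_ n - t| @[n --> \oo] --> (0 : R).
    rewrite -[X in _ --> X](normr0 R); apply: cvg_norm.
    by rewrite -(subrr t); apply: cvgB => //; exact: cvg_cst.
  have := cvg_comp _ Num.sqrt n0 (@sqrt_continuous R _).
  by rewrite sqrtr0 => sn0; rewrite -[X in _ --> X](mulr0 M); apply: cvgMr.
have bound n : ((Num.min `|line_mean L j (t_ n) - line_mean L j t| 1)%:E <=
    \int[P]_w (Num.min `|X n w| 1)%:E + (M * Num.sqrt `|t_ n - t|)%:E)%E.
  apply: le_trans (leeD2l _ (cc n)).
  rewrite -ge0_integralD //.
  rewrite -[leLHS](integral_cst_probability P); apply: ge0_le_integral_nonmeas => w.
    by rewrite lee_fin le_min normr_ge0 ler01.
  rewrite -EFinD lee_fin.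
  have -> : line_mean L j (t_ n) - line_mean L j t = X n w - c n w.
    by rewrite /X /c /centered; lra.
  have := ler_normB (X n w) (c n w); have := normr_ge0 (c n w).
  by case: (leP `|X n w| 1) => h1; case: (leP `|X n w - c n w| 1) => h2; lra.
have dmin : Num.min `|line_mean L j (t_ n) - line_mean L j t| 1 @[n --> \oo] --> (0 : R).
  have sum0 : fine (\int[P]_w (Num.min `|X n w| 1)%:E)%E + M * Num.sqrt `|t_ n - t|
      @[n --> \oo] --> (0 : R) by rewrite -[X in _ --> X](addr0 0); apply: cvgD.
  apply: (squeeze_cvgr _ (cvg_cst (0 : R)) sum0); near=> n.
  rewrite le_min normr_ge0 ler01 /= -lee_fin EFinD fineK //.
  by near: n.
apply/cvgrPdist_lt => e e1; have me : 0 < Num.min e 1 by rewrite lt_min e1 ltr01.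
have /cvgrPdist_lt/(_ _ me) := dmin; apply: filterS => n.
rewrite sub0r normrN ger0_norm; last by rewrite le_min normr_ge0 ler01.
by rewrite distrC lt_min gt_min => /andP[/orP[//|]]; rewrite gt_min ltxx orbF => + /ltW h; lra.
Unshelve. all: by end_near. Qed.

Lemma centered_dyadic_cvg (a b t : R) w : a < b -> `[a, b] `<=` I -> a <= t <= b ->
  centered L j (dyadic_floor a b n t) w @[n --> \oo] --> centered L j t w.
Proof.
move=> ab abI tab; have abI' s : a <= s <= b -> I s by move=> h; apply: abI; rewrite /= in_itv.
have tn n : I (dyadic_floor a b n t) by apply: abI'; exact: dyadic_floor_itv.
have tt : dyadic_floor a b n t @[n --> \oo] --> t.
  by apply: dyadic_floor_cvg => //; case/andP: tab.
apply: cvgB; first by apply: lineval_cvg => //; exact: abI'.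
by apply: line_mean_cvg => //; exact: abI'.
Qed.

End CenteredPaths.

Section ChainingVariable.
Context d (T : measurableType d) (R : realType) (P : probability T R).
Variables (Lam : set int) (I : set R) (L : {RV P >-> cborel (Lam `*` I)}) (j : int).
Variables (a b : R).
Hypotheses (LC : class_LC L) (Lj : Lam j) (ab : a < b) (abI : `[a, b] `<=` I).

Let D0 : 0 < b - a. Proof. by rewrite subr_gt0. Qed.

Let Idyadic n k : (k <= 2 ^ n)%N -> I (dyadic a b n k).
Proof. by move=> kn; apply: abI; rewrite /= in_itv; exact: dyadic_itv. Qed.

Let mcentered n k : (k <= 2 ^ n)%N -> measurable_fun setT (centered L j (dyadic a b n k)).
Proof. by move=> kn; apply: centered_measurable => //; exact: Idyadic. Qed.

(** The grid step is [(b - a) / 2 ^ n], so the exponent is the squared increment over eight steps,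
    whose exponential has mean at most 2. *)
Definition chain_term (n k : nat) (w : T) : R :=
  expR ((centered L j (dyadic a b n k.+1) w - centered L j (dyadic a b n k) w) ^+ 2
    * 2 ^+ n / (8 * (b - a))).

(** [2 ^ n] terms of mean at most 2 with weight [1 / 4 ^ n] give means at most [2 / 2 ^ n], which
    sum to 4. The price, a factor [4 ^ n] on single terms, becomes [n * ln 4] under the logarithm,
    the order of the Levy modulus itself. *)
Definition chain_level (n : nat) (w : T) : \bar R :=
  ((4 ^+ n)^-1%:E * \sum_(k < 2 ^ n) (chain_term n k w)%:E)%E.

Definition chain_var (w : T) : \bar R := (\sum_(0 <= n <oo) chain_level n w)%E.

Let level_sum0 n w : (0 <= \sum_(k < 2 ^ n) (chain_term n k w)%:E)%E.
Proof. by apply: sume_ge0 => k _; rewrite lee_fin expR_ge0. Qed.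

Let pow4 n : 0 < (4 ^+ n)^-1 :> R. Proof. by rewrite invr_gt0 exprn_gt0. Qed.

Let chain_level_ge0 n w : (0 <= chain_level n w)%E.
Proof. by rewrite mule_ge0 // lee_fin ltW. Qed.

Lemma chain_var_ge0 w : (0 <= chain_var w)%E.
Proof. exact: nneseries_ge0. Qed.

Let chain_term_measurable n k : (k < 2 ^ n)%N -> measurable_fun setT (chain_term n k).
Proof.
move=> kn; apply: measurableT_comp => //; apply: measurable_funM => //.
apply: measurable_funM => //; apply: measurable_funX; apply: measurable_funB.
  exact: mcentered.
by apply: mcentered; exact: ltnW.
Qed.

Let level_sum_measurable n :
  measurable_fun setT (fun w => \sum_(k < 2 ^ n) (chain_term n k w)%:E)%E.
Proof.
by apply: emeasurable_sum => k; apply/measurable_EFinP; exact: chain_term_measurable.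
Qed.

Let chain_level_measurable n : measurable_fun setT (chain_level n).
Proof. exact: measurable_funeM. Qed.

Lemma chain_var_measurable : measurable_fun setT chain_var.
Proof. by apply: ge0_emeasurable_sum => // k w _ _; exact: chain_level_ge0. Qed.

Let chain_term_integral n k : (k < 2 ^ n)%N -> (\int[P]_w (chain_term n k w)%:E <= 2%:E)%E.
Proof.
move=> kn; have n0 : 0 < 2 ^+ n :> R by rewrite exprn_gt0.
have step : dyadic a b n k.+1 - dyadic a b n k = (b - a) / 2 ^+ n.
  by rewrite /dyadic -natr1; field; rewrite gt_eqF.
have lt : dyadic a b n k < dyadic a b n k.+1 by rewrite -subr_gt0 step divr_gt0.
have := centered_increment_expR_sqr LC Lj (Idyadic kn) (Idyadic (ltnW kn)) lt.
rewrite step; apply: le_trans; rewrite le_eqVlt; apply/orP; left; apply/eqP.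
apply: eq_integral => w _; congr (expR _)%:E; field.
by rewrite !gt_eqF.
Qed.

Lemma chain_var_integral : (\int[P]_w chain_var w <= 4%:E)%E.
Proof.
rewrite integral_nneseries //.
apply: lime_le; first by apply: is_cvg_nneseries => n _ _; exact: integral_ge0.
apply: nearW => n.
apply: (@le_trans _ _ (\sum_(0 <= i < n) (2 * 2^-1 ^+ i : R)%:E)%E).
  apply: lee_sum => i _; rewrite ge0_integralZl_nonmeas // ge0_integral_sum //; last 2 first.
  - by move=> k; apply/measurable_EFinP; exact: chain_term_measurable.
  - by move=> k w _; rewrite lee_fin expR_ge0.
  apply: (@le_trans _ _ ((4 ^+ i)^-1%:E * \sum_(k < 2 ^ i) 2%:E)%E).
    rewrite lee_pmul2l ?lte_fin //; apply: lee_sum => k _; exact: chain_term_integral.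
  rewrite sumEFin big_const_ord iter_addr addr0 -EFinM lee_fin -[2 *+ _]mulr_natl natrX.
  rewrite (_ : 4 = 2 * 2 :> R); last by rewrite -natrM.
  by rewrite exprMn exprVn le_eqVlt; apply/orP; left; apply/eqP; field; rewrite expf_neq0.
rewrite sumEFin lee_fin.
have -> : \sum_(0 <= i < n) (2 * 2^-1 ^+ i : R) = 4 - 4 * 2^-1 ^+ n.
  elim: n => [|n IH]; first by rewrite big_nil expr0; ring.
  by rewrite big_nat_recr //= IH (exprS _ n); field.
by rewrite gerBl mulr_ge0 // exprn_ge0.
Qed.

Let chain_level_le n w : (chain_level n w <= chain_var w)%E.
Proof.
apply: le_trans (nneseries_lim_ge n.+1 _) => //.
by rewrite big_nat_recr //= leeDr // sume_ge0.
Qed.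

Lemma chain_var_ge1 w : (1 <= chain_var w)%E.
Proof.
apply: le_trans (chain_level_le 0 w); rewrite /chain_level expr0 invr1 mul1e.
rewrite expn0 big_ord1 lee_fin -[leLHS]expR0 ler_expR mulr1.
by rewrite divr_ge0 ?sqr_ge0 // mulr_ge0 // ltW.
Qed.

Lemma chain_var_term n k w : (k < 2 ^ n)%N ->
  ((chain_term n k w)%:E <= (4 ^+ n)%:E * chain_var w)%E.
Proof.
move=> kn; have p4 : 0 < 4 ^+ n :> R by rewrite exprn_gt0.
apply: (@le_trans _ _ ((4 ^+ n)%:E * chain_level n w)%E); last first.
  by rewrite lee_pmul2l ?lte_fin.
rewrite /chain_level muleA -EFinM mulfV ?gt_eqF // mul1e.
rewrite (bigD1 (Ordinal kn)) //= leeDl // sume_ge0 // => i _; by rewrite lee_fin expR_ge0.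
Qed.

Lemma modulus_le_chain_var (zeta : R) w t s : chain_var w = zeta%:E ->
  a <= t <= b -> a <= s <= b -> t != s ->
  `|centered L j t w - centered L j s w| <=
    136 * Num.sqrt (1 + ln zeta) * levy_modulus a b `|t - s|.
Proof.
move=> zetaE tab sab ts.
apply: (@chaining _ a b (fun t => centered L j t w) zeta ab) => //.
- by have := chain_var_ge1 w; rewrite zetaE lee_fin.
- by move=> n k kn; have := chain_var_term w kn; rewrite zetaE -EFinM lee_fin.
- by move=> u uab; exact: centered_dyadic_cvg.
Qed.

Lemma levy_modulus_measurable (K : R) : measurable
  [set w | (K%:E < modulus_ratio a b (levy_modulus a b) (fun t => centered L j t w))%E].
Proof.
pose A n k l := [set w | [/\ (k <= 2 ^ n)%N, (l <= 2 ^ n)%N,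
  dyadic a b n k != dyadic a b n l &
  K < `|centered L j (dyadic a b n k) w - centered L j (dyadic a b n l) w|
      / levy_modulus a b `|dyadic a b n k - dyadic a b n l| ]].
rewrite [X in measurable X](_ : _ = \bigcup_n \bigcup_k \bigcup_l A n k l).
  apply: bigcupT_measurable => n; apply: bigcupT_measurable => k.
  apply: bigcupT_measurable => l; rewrite /A.
  have [[kn ln kl]|no] := pselect [/\ (k <= 2 ^ n)%N, (l <= 2 ^ n)%N &
      dyadic a b n k != dyadic a b n l].
    rewrite [X in measurable X](_ : _ = [set w | K <
      `|centered L j (dyadic a b n k) w - centered L j (dyadic a b n l) w|
      / levy_modulus a b `|dyadic a b n k - dyadic a b n l| ]).
      rewrite -[X in measurable X]setTI; apply: measurable_fun_ltr => //.
      apply: measurable_funM => //; apply: measurableT_comp => //.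
      by apply: measurable_funB; exact: mcentered.
    by apply/seteqP; split=> w [].
  rewrite [X in measurable X](_ : _ = set0) //.
  by apply/seteqP; split=> w // [kn ln kl _]; apply: no.
have zc w t : a <= t <= b ->
    centered L j (dyadic_floor a b n t) w @[n --> \oo] --> centered L j t w.
  by move=> tab; exact: centered_dyadic_cvg.
apply/seteqP; split=> w /=.
  move=> /(modulus_ratio_gtP K ab (zc w))[n [k [l H]]].
  by exists n => //; exists k => //; exists l.
by move=> [n _ [k _ [l _ H]]]; apply/(modulus_ratio_gtP K ab (zc w)); exists n, k, l.
Qed.

Lemma levy_modulus_tail (K : R) : 0 <= K ->
  (P [set w | (K%:E < modulus_ratio a b (levy_modulus a b) (fun t => centered L j t w))%E]
   <= (4 * expR 1 * expR (- (136 ^+ 2)^-1 * K ^+ 2))%:E)%E.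
Proof.
move=> K0; set A := [set w | _]; have mA : measurable A by exact: levy_modulus_measurable.
(* A ratio above [K] forces [K ^+ 2 <= 136 ^+ 2 * (1 + ln zeta)], that is [c <= zeta]. Markov's
   inequality with mean at most 4 then gives both constants of (ii). *)
pose c := expR ((136 ^+ 2)^-1 * K ^+ 2 - 1); have c0 : 0 < c by exact: expR_gt0.
have cA w : A w -> (c%:E <= chain_var w)%E.
  move=> /= Aw; case E : (chain_var w) => [zeta||]; rewrite ?leey //; last first.
    by have := chain_var_ge0 w; rewrite E.
  have zeta1 : 1 <= zeta by have := chain_var_ge1 w; rewrite E lee_fin.
  have lam0 : 0 <= 1 + ln zeta by rewrite addr_ge0 // ln_ge0.
  have : (modulus_ratio a b (levy_modulus a b) (fun t => centered L j t w) <=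
      (136 * Num.sqrt (1 + ln zeta))%:E)%E.
    apply: ge_ereal_sup => _ [t [s [+ + ts ->]]]; rewrite !in_itv /= => tab sab.
    rewrite lee_fin ler_pdivrMr ?levy_modulus_gt0 ?(dist_itv tab sab ts) //.
    exact: modulus_le_chain_var.
  move=> /(lt_le_trans Aw); rewrite lte_fin => Klt.
  have : K ^+ 2 <= 136 ^+ 2 * (1 + ln zeta).
    rewrite -[in leRHS](sqr_sqrtr lam0) -exprMn ler_sqr ?nnegrE ?mulr_ge0 ?sqrtr_ge0 //.
    exact: ltW.
  rewrite -ler_pdivrMl ?exprn_gt0 // => h.
  rewrite lee_fin -[leRHS]lnK ?posrE ?(lt_le_trans ltr01) // ler_expR; lra.
rewrite -(@lee_pmul2l _ c%:E) ?lte_fin //.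
apply: (@le_trans _ _ (\int[P]_w chain_var w)%E).
  rewrite -integral_cst //; apply: (@le_trans _ _ (\int[P]_(w in A) chain_var w)%E).
    apply: ge0_le_integral => //.
    - by move=> w _; rewrite lee_fin ltW.
    - by apply: measurable_funTS; exact: chain_var_measurable.
  apply: ge0_subset_integral => //; first exact: chain_var_measurable.
  by move=> w _; exact: chain_var_ge0.
apply: (le_trans chain_var_integral); rewrite -EFinM lee_fin.
have -> : c * (4 * expR 1 * expR (- (136 ^+ 2)^-1 * K ^+ 2)) =
    4 * (c * expR 1 * expR (- (136 ^+ 2)^-1 * K ^+ 2)) by ring.
rewrite /c -!expRD subrK mulNr subrr expR0; lra.
Qed.

End ChainingVariable.

Section HolderBound.
Context {R : realType}.

(** The first factor comes from chaining and [levy_holder], the next two from bounding a power of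
    [1 + ln zeta] by a multiple of [zeta], and 4 is the bound on the mean of [chain_var]. *)
Definition holder_constant (alpha p : R) : R :=
  (136 * Num.sqrt (1 + (1 - 2 * alpha)^-1)) `^ p * (p / 2) `^ (p / 2) * expR 1 * 4.

Lemma holder_constant_gt0 (alpha p : R) : 0 < alpha < 1 / 2 -> 0 < p ->
  0 < holder_constant alpha p.
Proof.
move=> /andP[_ al] p0; have d0 : 0 < 1 - 2 * alpha by lra.
rewrite !mulr_gt0 ?powR_gt0 ?expR_gt0 ?divr_gt0 //.
by rewrite mulr_gt0 // sqrtr_gt0 addr_gt0 // invr_gt0.
Qed.

Lemma powR_le_expR (x q : R) : 0 <= x -> 0 < q -> x `^ q <= q `^ q * expR x.
Proof.
move=> x0 q0; have -> : expR x = expR (x / q) `^ q.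
  by rewrite -expRM divfK // gt_eqF.
rewrite -powRM ?expR_ge0 ?(ltW q0) //; apply: ge0_ler_powR; rewrite ?nnegrE ?(ltW q0) //.
  by rewrite mulr_ge0 ?expR_ge0 // ltW.
rewrite -ler_pdivrMl // mulrC; apply: le_trans (expR_ge1Dx _); rewrite lerDr //.
Qed.

End HolderBound.

Section HolderMoment.
Context d (T : measurableType d) (R : realType) (P : probability T R).
Variables (Lam : set int) (I : set R) (L : {RV P >-> cborel (Lam `*` I)}) (j : int).
Variables (a b : R).
Hypotheses (LC : class_LC L) (Lj : Lam j) (ab : a < b) (abI : `[a, b] `<=` I).

Lemma holder_moment (alpha p : R) : 0 < p -> 0 < alpha < 1 / 2 ->
  (\int[P]_w holder_norm alpha a b (fun t => centered L j t w) `^ p <=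
   (holder_constant alpha p * (b - a) `^ (p / 2 - alpha * p))%:E)%E.
Proof.
move=> p0 al; have /andP[_ al2] := al; have D0 : 0 < b - a by rewrite subr_gt0.
have d0 : 0 < 1 - 2 * alpha by lra.
pose S := Num.sqrt (1 + (1 - 2 * alpha)^-1).
have S0 : 0 <= S by exact: sqrtr_ge0.
pose C := (136 * S) `^ p * (p / 2) `^ (p / 2) * expR 1 * (b - a) `^ (p / 2 - alpha * p).
have p2 : 0 < p / 2 by rewrite divr_gt0.
have C0 : 0 < C.
  rewrite !mulr_gt0 ?powR_gt0 ?expR_gt0 //.
  by rewrite mulr_gt0 // sqrtr_gt0 addr_gt0 // invr_gt0.
have bound w : (holder_norm alpha a b (fun t => centered L j t w) `^ p <=
    C%:E * chain_var L j a b w)%E.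
  case E : (chain_var L j a b w) => [zeta||]; last 2 first.
  - by rewrite gt0_muley ?lte_fin // leey.
  - by have := chain_var_ge0 L j a b w; rewrite E.
  have zeta1 : 1 <= zeta by have := chain_var_ge1 L j ab w; rewrite E lee_fin.
  have lam0 : 0 <= 1 + ln zeta by rewrite addr_ge0 // ln_ge0.
  pose B := 136 * Num.sqrt (1 + ln zeta) * ((b - a) `^ (1 / 2 - alpha) * S).
  have B0 : 0 <= B by rewrite !mulr_ge0 ?sqrtr_ge0 ?powR_ge0.
  have hB : (holder_norm alpha a b (fun t => centered L j t w) <= B%:E)%E.
    apply: ge_ereal_sup => _ [t [s [+ + ts ->]]]; rewrite !in_itv /= => tab sab.
    have h0 := dist_itv tab sab ts; have /andP[ts0 _] := h0.
    rewrite lee_fin ler_pdivrMr ?powR_gt0 //.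
    apply: le_trans (modulus_le_chain_var LC Lj ab abI E tab sab ts) _.
    rewrite -[leRHS]mulrA ler_wpM2l ?mulr_ge0 ?sqrtr_ge0 // -ler_pdivrMr ?powR_gt0 //.
    exact: levy_holder.
  have h0 : (0 <= holder_norm alpha a b (fun t => centered L j t w))%E.
    apply: (@le_trans _ _ (`|centered L j b w - centered L j a w| / `|b - a| `^ alpha)%:E).
      by rewrite lee_fin divr_ge0 // powR_ge0.
    apply: ereal_sup_ubound; exists b, a; split=> //; rewrite ?in_itv /= ?lexx ?(ltW ab) //.
    by rewrite gt_eqF.
  apply: (@le_trans _ _ (B%:E `^ p)%E).
    by apply: gt0_ler_poweR; rewrite ?(ltW p0) // in_itv /= ?h0 ?lee_fin ?B0 ?leey.
  rewrite poweR_EFin -EFinM lee_fin.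
  have -> : B `^ p = (136 * S) `^ p * (b - a) `^ (p / 2 - alpha * p) * (1 + ln zeta) `^ (p / 2).
    have -> : B = (136 * S) * (b - a) `^ (1 / 2 - alpha) * Num.sqrt (1 + ln zeta).
      by rewrite /B; ring.
    rewrite !powRM ?mulr_ge0 ?powR_ge0 ?sqrtr_ge0 // -powR12_sqrt // -!powRrM.
    by rewrite [2^-1 * p]mulrC mulrBl mul1r [2^-1 * p]mulrC.
  (* The power [p / 2] of [1 + ln zeta] is at most a constant times [zeta], so moments of every
     order cost only the first moment of [chain_var]. *)
  have := powR_le_expR lam0 p2; rewrite expRD lnK ?posrE ?(lt_le_trans ltr01) // => h.
  rewrite (_ : C * zeta = (136 * S) `^ p * (b - a) `^ (p / 2 - alpha * p) *
    ((p / 2) `^ (p / 2) * (expR 1 * zeta))); last by rewrite /C; ring.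
  by rewrite ler_wpM2l // mulr_ge0 // powR_ge0.
apply: (@le_trans _ _ (\int[P]_w (C%:E * chain_var L j a b w))%E).
  by apply: ge0_le_integral_nonmeas => w; [exact: poweR_ge0|exact: bound].
rewrite ge0_integralZl_nonmeas //; last by move=> w; exact: chain_var_ge0.
apply: (@le_trans _ _ (C%:E * 4%:E)%E).
  by rewrite lee_pmul2l ?lte_fin //; exact: (chain_var_integral LC Lj ab abI).
rewrite -EFinM lee_fin /holder_constant le_eqVlt; apply/orP; left; apply/eqP.
by rewrite /C /S; ring.
Qed.

End HolderMoment.

Theorem theorem2p8 (R : realType) :
  exists (C1 C2 : R) (Cap : R -> R -> R),
  [/\ 0 < C1, 0 < C2,
      (forall alpha p : R, 0 < alpha < 1 / 2 -> 0 < p -> 0 < Cap alpha p)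
    & forall (d : measure_display) (T : measurableType d) (P : probability T R)
        (Lam : set int) (I : set R) (L : {RV P >-> cborel (Lam `*` I)}),
      is_interval Lam -> is_interval I -> class_LC L ->
      [/\ (forall j t, Lam j -> I t ->
            P.-integrable setT (fun w => (lineval (L w) j t)%:E)),
          (forall (p : R) j t s, 1 <= p -> Lam j -> I t -> I s ->
            (\int[P]_w (`|centered L j t w - centered L j s w| `^ p)%:E
              <= normal_abs_moment p * (`|t - s| `^ (p / 2))%:E)%E),
          (forall (a b : R) j (K : R), a < b -> `[a, b] `<=` I -> Lam j ->
            0 <= K ->
            (P [set w | modulus_ratio a b (levy_modulus a b)
                          (fun t => centered L j t w) > K%:E]
              <= (C1 * expR (- C2 * K ^+ 2))%:E)%E)
        & (forall (p alpha a b : R) j, 0 < p -> 0 < alpha < 1 / 2 ->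
            a < b -> `[a, b] `<=` I -> Lam j ->
            (\int[P]_w holder_norm alpha a b
                         (fun t => centered L j t w) `^ p
              <= (Cap alpha p * (b - a) `^ (p / 2 - alpha * p))%:E)%E)]].
Proof.
exists (4 * expR 1), ((136 ^+ 2)^-1), (@holder_constant R); split.
- by rewrite mulr_gt0 ?expR_gt0.
- by rewrite invr_gt0 exprn_gt0.
- exact: holder_constant_gt0.
move=> d T P Lam I L _ _ LC; split.
- by move=> j t Lj It; exact: lineval_integrable.
- by move=> p j t s p1 Lj It Is; exact: centered_moment.
- by move=> a b j K ab abI Lj K0; exact: levy_modulus_tail.
- by move=> p alpha a b j p0 al ab abI Lj; exact: holder_moment.
Qed.
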